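(* Let $p\ge2$ be an integer, $h>0$, and $0<\beta<\beta_p$, where $\beta_p>0$ is defined by $8p^2\beta_p^2\exp(16\beta_p^2p)=\frac12$. Let $q$, $A^2$, $B^2$, $C^2$ be the constants (depending on $p,\beta,h$) defined in the context, and let $a(k)=\mathbf E[g^k]$ for a standard Gaussian random variable $g$. Then for every $\hat k\in\mathbb N$ there is a constant $L(\hat k)$, not depending on $N$, such that for all $N\ge p$ $$\left|\nu\Big(\big(R_{1,2}^{p-1}-q^{p-1}\big)^{\hat k}\Big)-\frac{1}{N^{\hat k/2}}\,a(\hat k)\,\big(A^2+2B^2+C^2\big)^{\hat k/2}\right|\le\frac{L(\hat k)}{N^{(\hat k+1)/2}} .$$
   Context: $p$-spin model with external field. Let $\Sigma_N=\{-1,1\}^N$, $A_N^p=\{(i_1,\dots,i_p)\in\mathbb N^p:1\le i_1<\dots<i_p\le N\}$, $u_N=\big(\frac{p!}{2N^{p-1}}\big)^{1/2}$, and let $\{g_{i_1,\dots,i_p}:(i_1,\dots,i_p)\in A_N^p\}$ be independent standard Gaussian random variables (the disorder). The Hamiltonian is $$-H_{N,\beta,h}(\sigma)=\beta u_N\sum_{(i_1,\dots,i_p)\in A_N^p}g_{i_1,\dots,i_p}\sigma_{i_1}\cdots\sigma_{i_p}+h\sum_{i=1}^N\sigma_i,\quad \sigma\in\Sigma_N,$$ and $Z_N=\sum_{\sigma\in\Sigma_N}\exp(-H_{N,\beta,h}(\sigma))$. For $f:\Sigma_N^n\to\mathbb R$, $$\langle f\rangle=Z_N^{-n}\sum_{(\sigma^1,\dots,\sigma^n)\in\Sigma_N^n}f(\sigma^1,\dots,\sigma^n)\exp\Big(-\sum_{l\le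 n}H_{N,\beta,h}(\sigma^l)\Big),\qquad \nu(f)=\mathbf E\langle f\rangle,$$ with $\mathbf E$ the expectation over the disorder. The overlap is $R_{1,2}=\frac1N\sum_{i=1}^N\sigma_i^1\sigma_i^2$. Constants. With $Y$ a standard Gaussian random variable, $q\in[0,1]$ is the (unique) solution of $q=\mathbf E\big[\tanh^2\big(\beta(\frac p2)^{1/2}q^{\frac{p-1}{2}}Y+h\big)\big]$, $\hat q_4=\mathbf E\big[\tanh^4\big(\beta(\frac p2)^{1/2}q^{\frac{p-1}{2}}Y+h\big)\big]$, and $$A^2=\frac{(p-1)^2q^{2(p-2)}(1-2q+\hat q_4)}{1-\frac{p(p-1)}{2}q^{p-2}(1-2q+\hat q_4)\beta^2},$$ $$B^2=(p-1)q^{p-2}(q-\hat q_4)\,\frac{(p-1)q^{p-2}+\beta^2\frac p2A^2}{1-\beta^2\frac{p(p-1)}{2}q^{p-2}(1-4q+3\hat q_4)},$$ $$C^2=(p-1)q^{p-2}\,\frac{(\hat q_4-q^2)\big[(p-1)q^{p-2}+\beta^2\frac p2A^2\big]+\beta^2p(2q+q^2-3\hat q_4)B^2}{1-\beta^2\frac{p(p-1)}{2}q^{p-2}(1-4q+3\hat q_4)}.$$ *)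

(* Defs.v *)
From HB Require Import structures.
From mathcomp Require Import all_boot all_order all_algebra.
From mathcomp Require Import all_classical all_reals all_analysis.

Set Implicit Arguments.
Unset Strict Implicit.
Unset Printing Implicit Defensive.

Import Order.TTheory GRing.Theory Num.Theory.
Import numFieldNormedType.Exports.

Local Open Scope classical_set_scope.
Local Open Scope ring_scope.

Definition tanh {R : realType} (x : R) : R :=
  (expR x - expR (- x)) / (expR x + expR (- x)).

Definition mutually_independent {d : measure_display} {T : measurableType d}
    {R : realType} (P : probability T R) (I : finType) (X : I -> {RV P >-> R})
    : Prop :=
  forall (J : {set I}) (B : I -> set R),
    (forall i, measurable (B i)) ->
    P (\bigcap_(i in [set` J]) (X i @^-1` B i)) =
    (\prod_(i in J) P (X i @^-1` B i))%E.

Definition is_std_gaussian {d : measure_display} {T : measurableType d}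
    {R : realType} (P : probability T R) (X : {RV P >-> R}) : Prop :=
  forall B : set R, measurable B -> distribution P X B = normal_prob 0 1 B.

(* [E f(Y)] for a standard Gaussian [Y], computed under the law of [Y]; it is
   only used for integrable [f], where [fine] loses nothing. *)
Definition gauss_E {R : realType} (f : R -> R) : R :=
  fine ('E_(normal_prob 0 1)[f])%E.

(* The index set [A_N^p], with indices counted from 0. *)
Definition incr_index (N p : nat) : finType :=
  {t : p.-tuple 'I_N | sorted (fun i j : 'I_N => (i < j)%N) t}.

(* [Sigma_N = {-1,1}^N]: booleans encode the signs, read through [spin]. *)
Definition config (N : nat) : finType := {ffun 'I_N -> bool}.

Definition spin {R : realType} {N : nat} (s : config N) (i : 'I_N) : R :=
  if s i then 1 else - 1.

Definition overlap {R : realType} {N : nat} (s t : config N) : R :=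
  N%:R^-1 * \sum_(i < N) spin s i * spin t i.

Definition u_scale (R : realType) (N p : nat) : R :=
  Num.sqrt ((p`!)%:R / (2 * N%:R ^+ (p - 1))).

Definition hamiltonian {R : realType} {N p : nat} (beta h : R)
    (g : incr_index N p -> R) (s : config N) : R :=
  - (beta * u_scale R N p *
       (\sum_(a : incr_index N p) g a * \prod_(j < p) spin s (tnth (val a) j))
     + h * \sum_(i < N) spin s i).

Definition partition_fun {R : realType} {N p : nat} (beta h : R)
    (g : incr_index N p -> R) : R :=
  \sum_(s : config N) expR (- hamiltonian beta h g s).

(* [n] replicas are given as [s : {ffun 'I_n -> config N}]. *)
Definition gibbs {R : realType} {N p : nat} (beta h : R)
    (g : incr_index N p -> R) (n : nat) (f : {ffun 'I_n -> config N} -> R) : R :=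
  (partition_fun beta h g ^+ n)^-1 *
  \sum_(s : {ffun 'I_n -> config N})
     f s * expR (- \sum_(l < n) hamiltonian beta h g (s l)).

Definition nu {R : realType} {d : measure_display} {T : measurableType d}
    (P : probability T R) {N p : nat} (beta h : R)
    (g : incr_index N p -> {RV P >-> R})
    (n : nat) (f : {ffun 'I_n -> config N} -> R) : \bar R :=
  ('E_P[(fun w : T => gibbs beta h (fun a => g a w) f)])%E.

Definition R12 {R : realType} {N : nat} (s : {ffun 'I_2 -> config N}) : R :=
  overlap (s ord0) (s ord_max).

Section constants.
Context {R : realType}.
Variables (p : nat) (beta h q : R).

Definition local_field (y : R) : R :=
  beta * Num.sqrt (p%:R / 2) * (q `^ ((p%:R - 1) / 2)) * y + h.

Definition is_overlap_limit : Prop :=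
  0 <= q <= 1 /\ q = gauss_E (fun y => tanh (local_field y) ^+ 2).

Definition qhat4 : R := gauss_E (fun y => tanh (local_field y) ^+ 4).

Definition Asq : R :=
  (p%:R - 1) ^+ 2 * q ^+ (2 * (p - 2)) * (1 - 2 * q + qhat4) /
  (1 - p%:R * (p%:R - 1) / 2 * q ^+ (p - 2) * (1 - 2 * q + qhat4)
         * beta ^+ 2).

Definition Bsq : R :=
  (p%:R - 1) * q ^+ (p - 2) * (q - qhat4) *
  (((p%:R - 1) * q ^+ (p - 2) + beta ^+ 2 * (p%:R / 2) * Asq) /
   (1 - beta ^+ 2 * (p%:R * (p%:R - 1) / 2) * q ^+ (p - 2)
          * (1 - 4 * q + 3 * qhat4))).

Definition Csq : R :=
  (p%:R - 1) * q ^+ (p - 2) *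
  (((qhat4 - q ^+ 2) *
      ((p%:R - 1) * q ^+ (p - 2) + beta ^+ 2 * (p%:R / 2) * Asq)
    + beta ^+ 2 * p%:R * (2 * q + q ^+ 2 - 3 * qhat4) * Bsq) /
   (1 - beta ^+ 2 * (p%:R * (p%:R - 1) / 2) * q ^+ (p - 2)
          * (1 - 4 * q + 3 * qhat4))).

End constants.

Definition gauss_moment (R : realType) (k : nat) : R :=
  gauss_E (fun y : R => y ^+ k).

(* Main.v *)
Require Import Defs.
From HB Require Import structures.
From mathcomp Require Import all_boot all_order all_algebra.
From mathcomp Require Import all_classical all_reals all_analysis.
From mathcomp Require Import measurable_realfun.
From mathcomp Require Import ring lra zify.

Set Implicit Arguments.
Unset Strict Implicit.
Unset Printing Implicit Defensive.

Import Order.TTheory GRing.Theory Num.Theory.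
Import numFieldNormedType.Exports.

Local Open Scope classical_set_scope.
Local Open Scope ring_scope.

(* The cavity method along the trigonometric path that multiplies every
   interaction containing the site [i] by [sin t] and gives [i] an independent
   effective field [beta sqrt(p/2) q^((p-1)/2) z] multiplied by [cos t].  At
   [t = pi/2] this is the model; at [t = 0] the spins at [i] of the replicas
   are independent of the rest, with moments [E tanh^r].  Gaussian integration
   by parts gives the derivative in [t], a sum over pairs of replicas of
   [sin t cos t beta^2 p/2 eps_l eps_l' (overlap^(p-1) - q^(p-1))].

   At high temperature a first order expansion in [t] shows, by induction on
   [k], that the moments of order [2k] of [R_12 - q] are [O(N^-k)].  The same
   expansion with [f = (R_12 - q)^m] and [R_ab - q] replaced, by symmetry
   among sites, with the spins at one site, expresses
   [nu((R_ab - q)(R_12 - q)^m)], for [(a,b)] equal to [(1,2)], [(1,3)] and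
   [(3,4)], as linear combinations of these three quantities and of
   [m/N nu((R_12 - q)^(m-1))], up to [O(N^-(m+2)/2)].  Solving this 3x3 system
   gives [nu((R_12 - q)^(m+1)) ~ V m/N nu((R_12 - q)^(m-1))], the recursion of
   Gaussian moments, and [R_12^(p-1) - q^(p-1) ~ (p-1) q^(p-2) (R_12 - q)]
   transfers it to the power of the overlap. *)

(** Two constraints shape the argument. The constant must not depend on [N] or on the space carrying
    the disorder, so the facts supplied by the interpolation are isolated in the record [cavity],
    and every estimate is uniform over the type [instance] of all laws satisfying them. From there
    on the disorder is averaged out, and expectations are finite sums. Secondly, the factorization
    at time 0 holds only for functions that do not see the spins at the site [i]. Overlaps are
    therefore stripped of that site; the correction [eps_a eps_b / N], correlated with the spins
    singled out at [i], is the source of the term [m/N] in the recursion. The amplitudes [sin t] and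
    [cos t] are smooth at both ends, and their derivatives combine into [sin t cos t], half the
    derivative of [sin^2 t]. A mean value theorem in the variable [sin^2 t] thus replaces integral
    remainders. The smallness of [beta] serves three times: to absorb a moment into its own bound,
    to invert the linear system, and to show that the limiting variance is nonnegative. *)

(** * Integrals against the Gaussian law and its density *)

Section normal_integral.
Context {R : realType}.
Notation mu := (@lebesgue_measure R).
Notation N01 := (@normal_prob R 0 1).

(** The Radon-Nikodym derivative of the Gaussian law agrees almost everywhere with [normal_pdf],
    since both have the same integral over every measurable set. *)
Lemma ge0_integral_normal (f : R -> \bar R) :
  measurable_fun [set: R] f -> (forall x, 0 <= f x)%E ->
  (\int[N01]_x f x = \int[mu]_x (f x * (normal_pdf 0 1 x)%:E))%E.
Proof.
move=> mf f0.
have dom := @normal_prob_dominates R 0 1.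
rewrite -(Radon_Nikodym_SigmaFinite.change_of_variables dom)//.
have intR := Radon_Nikodym_SigmaFinite.f_integrable dom.
apply: ae_eq_integral => //.
- by apply: emeasurable_funM => //; exact: (measurable_int mu).
- apply: emeasurable_funM => //; apply/measurable_EFinP.
  exact: measurable_normal_pdf.
- apply: ae_eqe_mul2l => /=; apply: integral_ae_eq => //=.
  + by apply/measurable_EFinP; exact: measurable_normal_pdf.
  + by move=> E _ mE; rewrite -Radon_Nikodym_SigmaFinite.f_integral.
Qed.

Lemma integrable_normalP (f : R -> R) : measurable_fun [set: R] f ->
  mu.-integrable [set: R] (fun x => (f x * normal_pdf 0 1 x)%:E) ->
  N01.-integrable [set: R] (EFin \o f).
Proof.
move=> mf /integrableP[_ fi]; apply/integrableP; split.
  exact/measurable_EFinP.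
rewrite ge0_integral_normal//; last first.
  by apply: measurableT_comp => //; exact/measurable_EFinP.
apply: le_lt_trans fi; rewrite le_eqVlt; apply/orP; left; apply/eqP.
apply: eq_integral => x _ /=.
by rewrite normrM [in RHS]EFinM [`|normal_pdf 0 1 x|]ger0_norm// normal_pdf_ge0.
Qed.

Lemma Rintegral_normal (f : R -> R) : N01.-integrable [set: R] (EFin \o f) ->
  mu.-integrable [set: R] (fun x => (f x * normal_pdf 0 1 x)%:E) ->
  \int[N01]_x f x = \int[mu]_x (f x * normal_pdf 0 1 x).
Proof.
move=> fi fmi; rewrite /Rintegral; congr fine.
have mf : measurable_fun setT (EFin \o f) by case/integrableP: fi.
rewrite integralE [RHS]integralE.
rewrite !ge0_integral_normal//; [|exact: measurable_funeneg|exact: measurable_funepos].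
congr (_ - _)%E; apply: eq_integral => x _.
  rewrite !funeposE -!EFin_max -EFinM; congr EFin => /=.
  by rewrite maxr_pMl ?normal_pdf_ge0// mul0r.
rewrite !funenegE -!EFinN -!EFin_max -EFinM; congr EFin => /=.
by rewrite maxr_pMl ?normal_pdf_ge0// mul0r mulNr.
Qed.

End normal_integral.

(** * Gaussian integration by parts on the line *)

Section gauss_ibp.
Context {R : realType}.
Notation mu := (@lebesgue_measure R).
Notation N01 := (@normal_prob R 0 1).

Lemma normal_pdf01E (x : R) :
  normal_pdf 0 1 x = normal_peak 1 * expR (- x ^+ 2 / 2).
Proof.
by rewrite normal_pdfE ?oner_neq0// /normal_fun subr0 expr1n.
Qed.

(** Domination by a multiple of the Gaussian density of variance 2: completing a square gives
    [2|x| - x^2/2 <= 4 - x^2/4]. *)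
Lemma integrable_expR_normal (f : R -> R) (C : R) : measurable_fun [set: R] f ->
  (forall x, `|f x| <= C * expR (2 * `|x|)) ->
  mu.-integrable [set: R] (fun x => (f x * normal_pdf 0 1 x)%:E).
Proof.
move=> mf fC.
have s2 : Num.sqrt 2 != 0 :> R by rewrite gt_eqF// sqrtr_gt0.
have C0 : 0 <= C.
  by have := le_trans (normr_ge0 _) (fC 0); rewrite normr0 mulr0 expR0 mulr1.
pose K := C * normal_peak 1 * expR 4 / normal_peak (Num.sqrt 2).
have iK : mu.-integrable [set: R]
    (fun x => K%:E * (normal_pdf 0 (Num.sqrt 2) x)%:E)%E.
  by apply: integrableZl => //; exact: integrable_normal_pdf.
apply: le_integrable iK => //.
  apply/measurable_EFinP; apply: measurable_funM => //.
  exact: measurable_normal_pdf.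
move=> x _; rewrite -[(K%:E * _)%E]EFinM /= lee_fin.
rewrite normrM (ger0_norm (normal_pdf_ge0 _ _ _)).
rewrite [leRHS]ger0_norm; last first.
  rewrite mulr_ge0 ?normal_pdf_ge0// /K !mulr_ge0 ?invr_ge0 ?normal_peak_ge0 ?expR_ge0//.
apply: le_trans (ler_wpM2r (normal_pdf_ge0 _ _ _) (fC x)) _.
rewrite normal_pdf01E [in leRHS]normal_pdfE// /normal_fun subr0 sqr_sqrtr//.
rewrite /K.
have p2 : normal_peak (Num.sqrt 2) != 0 :> R by rewrite gt_eqF// normal_peak_gt0.
set e1 := expR (2 * `|x|); set e2 := expR (- x ^+ 2 / 2).
set e3 := expR (- x ^+ 2 / (2 *+ 2)).
have -> : C * e1 * (normal_peak 1 * e2) = C * (normal_peak 1 * (e1 * e2)) by ring.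
have -> : C * normal_peak 1 * expR 4 / normal_peak (Num.sqrt 2) *
  (normal_peak (Num.sqrt 2) * e3) = C * (normal_peak 1 * (expR 4 * e3)).
  by field.
rewrite /e1 /e2 /e3 {e1 e2 e3}.
rewrite ler_wpM2l// ler_wpM2l ?normal_peak_ge0// -!expRD ler_expR.
have xx : `|x| ^+ 2 = x ^+ 2 by rewrite real_normK// num_real.
have : 0 <= (`|x| / 2 - 2) ^+ 2 by exact: sqr_ge0.
rewrite -xx; lra.
Qed.

Lemma le_expR_norm2 (x : R) : `|x| * expR `|x| <= expR (2 * `|x|).
Proof.
rewrite mulr_natl mulr2n expRD ler_wpM2r ?expR_ge0//.
by apply: le_trans (expR_ge1Dx _); rewrite lerDr.
Qed.

Lemma expR_norm_le2 (x : R) : expR `|x| <= expR (2 * `|x|).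
Proof. by rewrite ler_expR mulr_natl mulr2n lerDr. Qed.

(** The density times [df - x f] is the derivative of the density times [f]. The fundamental theorem
    of calculus on [[-(n+1), n+1]] leaves boundary terms that tend to 0, and dominated convergence
    yields the integral over the line. Exponential growth covers both bounded functions of the
    disorder and monomials. *)
Lemma gauss_ibp (f df : R -> R) (C : R) :
  (forall x : R, is_derive x 1 f (df x)) -> continuous df ->
  (forall x, `|f x| <= C * expR `|x|) ->
  (forall x, `|df x| <= C * expR `|x|) ->
  [/\ N01.-integrable [set: R] (EFin \o (fun x => x * f x)),
      N01.-integrable [set: R] (EFin \o df) &
      \int[N01]_x (x * f x) = \int[N01]_x df x].
Proof.
move=> fd dfc fC dfC.
have C0 : 0 <= C.
  by have := le_trans (normr_ge0 _) (fC 0); rewrite normr0 expR0 mulr1.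
have fc : continuous f.
  move=> x; apply: differentiable_continuous; apply/derivable1_diffP.
  exact: ex_derive.
have mf : measurable_fun [set: R] f by exact: continuous_measurable_fun.
have mdf : measurable_fun [set: R] df by exact: continuous_measurable_fun.
have mxf : measurable_fun [set: R] (fun x => x * f x) by exact: measurable_funM.
have i1 := @integrable_expR_normal (fun x => x * f x) C mxf.
have {}i1 : mu.-integrable [set: R] (fun x => (x * f x * normal_pdf 0 1 x)%:E).
  apply: i1 => x; rewrite normrM.
  apply: le_trans (ler_wpM2l (normr_ge0 _) (fC x)) _.
  by rewrite mulrCA ler_wpM2l// le_expR_norm2.
have i2 : mu.-integrable [set: R] (fun x => (df x * normal_pdf 0 1 x)%:E).
  apply: (@integrable_expR_normal _ C) => // x.
  by apply: le_trans (dfC x) _; rewrite ler_wpM2l// expR_norm_le2.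
have j1 : N01.-integrable [set: R] (EFin \o (fun x => x * f x)).
  exact: integrable_normalP.
have j2 : N01.-integrable [set: R] (EFin \o df) by exact: integrable_normalP.
split => //.
rewrite !Rintegral_normal//; apply/esym/eqP; rewrite -subr_eq0.
rewrite -RintegralB//; apply/eqP.
pose h x := df x * normal_pdf 0 1 x - x * f x * normal_pdf 0 1 x.
pose F x := f x * normal_pdf 0 1 x.
have pdf_d (x : R) : is_derive x 1 (@normal_pdf R 0 1) (- x * normal_pdf 0 1 x).
  have -> : @normal_pdf R 0 1 = fun y => normal_peak 1 * expR (- y ^+ 2 / 2).
    by apply/funext => y; rewrite normal_pdf01E.
  have -> : (fun y : R => normal_peak 1 * expR (- y ^+ 2 / 2)) =
    normal_peak 1 \*o (expR \o (fun y : R => (- 2^-1) * y ^+ 2)).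
    by apply/funext => y /=; congr (_ * expR _); lra.
  apply: is_derive_eq.
  rewrite /= /GRing.scale/= (_ : - x ^+ 2 / 2 = - 2^-1 * x ^+ 2); last lra.
  by field.
have Fd (x : R) : is_derive x 1 F (h x).
  have -> : F = f * @normal_pdf R 0 1 by [].
  by apply: is_derive_eq; rewrite /= /GRing.scale/= /h; lra.
have hc : continuous h.
  move=> x; apply: cvgB; apply: cvgM.
  - exact: dfc.
  - by apply: continuous_normal_pdf; rewrite oner_neq0.
  - by apply: cvgM; [exact: cvg_id|exact: fc].
  - by apply: continuous_normal_pdf; rewrite oner_neq0.
have hi : mu.-integrable [set: R] (EFin \o h).
  by rewrite (_ : EFin \o h = fun x => (df x * normal_pdf 0 1 x)%:E -
     (x * f x * normal_pdf 0 1 x)%:E)%E//; exact: integrableB.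
have mh : measurable_fun [set: R] h by exact: continuous_measurable_fun.
pose I (n : nat) := `[(- n.+1%:R : R), n.+1%:R]%classic.
have mI n : measurable (I n) by exact: measurable_itv.
have hn n : (\int[mu]_(x in I n) (h x)%:E = (F n.+1%:R)%:E - (F (- n.+1%:R))%:E)%E.
  apply: continuous_FTC2.
  - by rewrite -subr_gt0 opprK addr_gt0// ltr0n.
  - exact: continuous_subspaceT.
  - split.
    + by move=> x _; exact: ex_derive.
    + apply: cvg_at_right_filter; apply: differentiable_continuous.
      by apply/derivable1_diffP; exact: ex_derive.
    + apply: cvg_at_left_filter; apply: differentiable_continuous.
      by apply/derivable1_diffP; exact: ex_derive.
  - by move=> x _; rewrite derive1E; exact: derive_val.
have lim1 : (\int[mu]_(x in I n) (h x)%:E)%E @[n --> \oo] -->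
    (\int[mu]_x (h x)%:E)%E.
  under eq_fun do rewrite integral_mkcond.
  apply: (@dominated_cvg _ _ _ mu setT measurableT _ _ (fun x => `|(h x)%:E|%E)).
  - move=> n; apply/(measurable_restrictT _ (mI n)).
    by apply/measurable_EFinP; exact: measurable_funTS.
  - move=> x _; apply: cvg_near_cst; near=> n.
    rewrite patchE ifT// inE /I/= in_itv/= -ler_norml.
    apply: le_trans (_ : n%:R <= _); last by rewrite ler_nat.
    by near: n; exact: nbhs_infty_ger.
  - by [].
  - exact: integrable_abse.
  - move=> n x _; rewrite patchE; case: ifPn => //= _.
    by rewrite normr0 lee_fin.
(* From [(|x| - 3)^2 >= 0], that is [|x| - x^2/2 <= 9/2 - 2|x|]. *)
have Fb x : `|F x| <= C * normal_peak 1 * expR (9 / 2) * expR (- 2 * `|x|).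
  rewrite /F normrM [X in _ * X]ger0_norm ?normal_pdf_ge0// normal_pdf01E.
  apply: le_trans (ler_wpM2r _ (fC x)) _.
    by rewrite mulr_ge0 ?normal_peak_ge0 ?expR_ge0.
  rewrite mulrACA -[leRHS]mulrA ler_wpM2l ?mulr_ge0 ?normal_peak_ge0//.
  rewrite -!expRD ler_expR.
  have xx : `|x| ^+ 2 = x ^+ 2 by rewrite real_normK// num_real.
  have : 0 <= (`|x| - 3) ^+ 2 by exact: sqr_ge0.
  rewrite -xx; lra.
pose K := C * normal_peak 1 * expR (9 / 2).
have K0 : 0 <= K by rewrite !mulr_ge0 ?normal_peak_ge0 ?expR_ge0.
have Fb2 (n : nat) (x : R) : `|x| = n.+1%:R -> `|F x| <= K * n.+1%:R^-1.
  move=> xn; apply: le_trans (Fb x) _; rewrite xn ler_wpM2l//.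
  rewrite -[expR _]invrK -expRN lef_pV2 ?posrE ?expR_gt0 ?ltr0n//.
  apply: le_trans (expR_ge1Dx _).
  by have : 0 < n.+1%:R :> R by []; lra.
have lim2 : (\int[mu]_(x in I n) (h x)%:E)%E @[n --> \oo] --> 0%E.
  under eq_fun do rewrite hn -EFinB.
  apply: cvg_EFin; first exact: nearW.
  apply: norm_cvg0.
  apply: (@squeeze_cvgr _ _ _ _ (cst 0) (fun n => 2 * K * n.+1%:R^-1)).
  - apply: nearW => n /=; rewrite normr_ge0/=.
    apply: le_trans (ler_normB _ _) _.
    have a1 := @Fb2 n n.+1%:R (ger0_norm (ler0n _ _)).
    have a2 := @Fb2 n (- n.+1%:R) (etrans (normrN _) (ger0_norm (ler0n _ _))).
    by apply: le_trans (lerD a1 a2) _; rewrite -mulrA mulr_natl mulr2n.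
  - exact: cvg_cst.
  - rewrite -[X in _ --> X](mulr0 (2 * K)); apply: cvgM; first exact: cvg_cst.
    exact: cvg_harmonic.
have -> : \int[mu]_x (df x * normal_pdf 0 1 x - x * f x * normal_pdf 0 1 x) =
  fine (\int[mu]_x (h x)%:E)%E by [].
by have -> := cvg_unique _ lim1 lim2.
Unshelve. all: by end_near.
Qed.

End gauss_ibp.

(** * The product sigma-algebra on finite families of reals *)

Section rectangles.
Context {R : realType} (I : finType).

Definition rectangle (B : I -> set R) : set (I -> R) :=
  [set x | forall i, B i (x i)].

Definition rectangles : set (set (I -> R)) :=
  [set rectangle B | B in [set B | forall i, measurable (B i : set R)]].

(** The generating rectangles form a pi-system, on which two laws can be compared. *)
Definition vecT := g_sigma_algebraType rectangles.

Lemma setI_closed_rectangles : setI_closed rectangles.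
Proof.
move=> _ _ [A mA <-] [B mB <-]; exists (fun i => A i `&` B i).
  by move=> i; exact: measurableI.
apply/seteqP; split=> [x AB|x [xA xB] i]; last by split.
by split=> i; have [] := AB i.
Qed.

Lemma measurable_rectangle (B : I -> set R) :
  (forall i, measurable (B i : set R)) -> measurable (rectangle B : set vecT).
Proof. by move=> mB; apply: sub_sigma_algebra; exists B. Qed.

Lemma measurable_coord (i : I) :
  measurable_fun [set: vecT] (fun x : vecT => x i : R).
Proof.
move=> _ B mB; rewrite setTI.
rewrite (_ : _ @^-1` B = rectangle (fun j => if j == i then B else setT)).
  by apply: measurable_rectangle => j; case: ifP.
apply/seteqP; split=> [x xB j|x /(_ i)]; last by rewrite eqxx.
by case: ifP => // /eqP ->.
Qed.

Lemma measurable_fun_vec d (T : measurableType d) (X : T -> vecT) :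
  (forall i, measurable_fun [set: T] (fun w => X w i : R)) ->
  measurable_fun [set: T] X.
Proof.
move=> mX; refine (@measurability _ _ T vecT setT X rectangles _ _); first by [].
move=> _ [_ [B mB <-] <-]; rewrite setTI.
rewrite (_ : X @^-1` rectangle B = \bigcap_(i in setT) (fun w => X w i) @^-1` B i).
  apply: fin_bigcap_measurable => // i _.
  by rewrite -[X in measurable X]setTI; exact: mX.
by apply/seteqP; split=> [x xB i _|x xB i]; [exact: xB|exact: (xB i)].
Qed.

End rectangles.

(** * Independent standard Gaussian families and their joint law *)

Section iid.
Context {R : realType} (I : finType).
Notation N01 := (@normal_prob R 0 1).

(** The joint law is prescribed on rectangles, for a bare family of functions on any measured space,
    so that the notion passes to extended spaces and to resampled families. *)
Definition iid_gauss d (T : measurableType d) (P : {measure set T -> \bar R})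
    (X : T -> I -> R) : Prop :=
  (forall i, measurable_fun [set: T] (fun w => X w i)) /\
  (forall B : I -> set R, (forall i, measurable (B i)) ->
    P [set w | forall i, B i (X w i)] = \prod_i N01 (B i))%E.

Section one_space.
Context d (T : measurableType d) (P : {measure set T -> \bar R}).
Variable X : T -> I -> R.
Hypothesis iidX : iid_gauss P X.

Lemma iid_measurable : measurable_fun [set: T] (X : T -> vecT I).
Proof. by apply: measurable_fun_vec => i; exact: iidX.1. Qed.

Lemma iid_marginal i B : measurable B -> P [set w | B (X w i)] = N01 B.
Proof.
move=> mB; have := iidX.2 (fun j => if j == i then B else setT).
rewrite (bigD1 i)//= eqxx big1 ?mule1; last first.
  by move=> j /negbTE ->; exact: probability_setT.
move=> <-; last by move=> j; case: ifP.
congr (P _); apply/seteqP; split=> [w wB j|w /(_ i)/=]; last by rewrite eqxx.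
by case: ifP => // /eqP ->.
Qed.

Lemma integrable_id_normal : N01.-integrable [set: R] (EFin \o (@idfun R)).
Proof.
have [] := @gauss_ibp R (cst 1) (cst 0) 1 _ _ _ _.
- move=> x; exact: cst_continuous.
- by move=> x; rewrite normr1 mul1r -[leLHS]expR0 ler_expR.
- by move=> x; rewrite normr0 mul1r expR_ge0.
move=> + _ _.
by rewrite (_ : EFin \o _ = EFin \o idfun)//; apply/funext => x /=; rewrite mulr1.
Qed.

Lemma iid_integrable i : P.-integrable [set: T] (fun w => (X w i)%:E).
Proof.
have mX := iidX.1 i; apply/integrableP; split; first exact/measurable_EFinP.
have /integrableP[_] := integrable_id_normal.
apply: le_lt_trans; rewrite le_eqVlt; apply/orP; left; apply/eqP.
have mX' : measurable_fun [set: T] (X^~ i : T -> measurableTypeR R) := mX.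
pose f : {mfun T >-> measurableTypeR R} := HB.pack (X^~ i : T -> measurableTypeR R)
  (isMeasurableFun.Build _ _ _ _ _ mX').
rewrite [RHS](eq_measure_integral (pushforward P f)); last first.
  by move=> B mB _; exact: esym (iid_marginal i mB).
have mabs : measurable_fun [set: R] (fun x : R => `|x%:E|%E).
  by apply: measurableT_comp.
have := @ge0_integral_pushforward _ _ T (measurableTypeR R) R _ mX' P setT
  (fun x => `|x%:E|%E) measurableT mabs.
by rewrite preimage_setT => -> // x _; rewrite lee_fin.
Qed.

End one_space.

Section two_spaces.
Context d1 (T1 : measurableType d1) (P1 : {measure set T1 -> \bar R}).
Context d2 (T2 : measurableType d2) (P2 : {measure set T2 -> \bar R}).
Variables (X1 : T1 -> I -> R) (X2 : T2 -> I -> R).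
Hypotheses (iid1 : iid_gauss P1 X1) (iid2 : iid_gauss P2 X2).

(** Finite measures that agree on a pi-system are equal. Integrals of functions of the disorder can
    thus be computed on whichever space is convenient. *)
Lemma iid_same_law (A : set (vecT I)) : measurable A ->
  P1 (X1 @^-1` A) = P2 (X2 @^-1` A).
Proof.
move=> mA.
have mX1 : measurable_fun [set: T1] (X1 : T1 -> vecT I) := iid_measurable iid1.
have mX2 : measurable_fun [set: T2] (X2 : T2 -> vecT I) := iid_measurable iid2.
pose f1 : {mfun T1 >-> vecT I} := HB.pack (X1 : T1 -> vecT I)
  (isMeasurableFun.Build _ _ _ _ _ mX1).
pose f2 : {mfun T2 >-> vecT I} := HB.pack (X2 : T2 -> vecT I)
  (isMeasurableFun.Build _ _ _ _ _ mX2).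
apply: (@measure_unique _ R (vecT I) (@rectangles R I) (fun=> setT) _ _ _ _
  (pushforward P1 f1) (pushforward P2 f2)) => //.
- exact: setI_closed_rectangles.
- by move=> _; exists (fun=> setT) => //; apply/seteqP; split.
- by rewrite bigcup_const//; exists 0%N.
- move=> _ [B mB <-]; rewrite /pushforward /=.
  by rewrite [LHS]iid1.2// [RHS]iid2.2.
- have P1T : (P1 [set: T1] < +oo)%E.
    have := iid1.2 (fun=> setT) (fun=> measurableT).
    rewrite (_ : [set w | _] = setT); last exact/seteqP.
    by move=> ->; rewrite big1 ?ltry// => i _; exact: probability_setT.
  by move=> _; exact: P1T.
Qed.

Lemma iid_integral (F : vecT I -> R) : measurable_fun [set: vecT I] F ->
  P1.-integrable setT (fun w => (F (X1 w))%:E) ->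
  P2.-integrable setT (fun w => (F (X2 w))%:E) ->
  \int[P1]_w F (X1 w) = \int[P2]_w F (X2 w).
Proof.
move=> mF i1 i2; rewrite /Rintegral; congr fine.
have mX1 : measurable_fun [set: T1] (X1 : T1 -> vecT I) := iid_measurable iid1.
have mX2 : measurable_fun [set: T2] (X2 : T2 -> vecT I) := iid_measurable iid2.
pose f1 : {mfun T1 >-> vecT I} := HB.pack (X1 : T1 -> vecT I)
  (isMeasurableFun.Build _ _ _ _ _ mX1).
pose f2 : {mfun T2 >-> vecT I} := HB.pack (X2 : T2 -> vecT I)
  (isMeasurableFun.Build _ _ _ _ _ mX2).
have mEF : measurable_fun [set: vecT I] (EFin \o F) by exact/measurable_EFinP.
have e1 := @integral_pushforward _ _ _ _ _ f1 mX1 P1 setT (EFin \o F) mEF.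
have e2 := @integral_pushforward _ _ _ _ _ f2 mX2 P2 setT (EFin \o F) mEF.
rewrite !preimage_setT in e1 e2.
rewrite -[LHS](e1 i1 measurableT) -[RHS](e2 i2 measurableT).
by apply: eq_measure_integral => A mA _; exact: iid_same_law.
Qed.

End two_spaces.

End iid.

(** * Adding and resampling one Gaussian coordinate *)

Definition upd {R : Type} {I : eqType} (x : I -> R) (a : I) (y : R) : I -> R :=
  fun i => if i == a then y else x i.

Definition extend {R : Type} {I : eqType} (x : I -> R) (y : R) : option I -> R :=
  fun o => if o is Some i then x i else y.

Section gauss_ext.
Context {R : realType} d (T : measurableType d) (P : probability T R).
Notation N01 := (@normal_prob R 0 1).

(** The extra Gaussian serves either as the effective field at a site or as a fresh copy of a
    coordinate. A separate name allows the product to be declared a probability. *)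
Definition gauss_ext : set (T * measurableTypeR R) -> \bar R := (P \x N01)%E.

HB.instance Definition _ := Measure.on gauss_ext.

Let gauss_ext_setT : gauss_ext setT = 1%E.
Proof.
rewrite /gauss_ext -setXTT product_measure1E//.
by rewrite [X in (X * _)%E]probability_setT [X in (_ * X)%E]probability_setT mule1.
Qed.

HB.instance Definition _ := Measure_isProbability.Build _ _ _ gauss_ext gauss_ext_setT.

End gauss_ext.

Section resampling.
Context {R : realType} (I : finType) d (T : measurableType d) (P : probability T R).
Variable X : T -> I -> R.
Hypothesis iidX : iid_gauss P X.
Notation N01 := (@normal_prob R 0 1).

Let measurable_box (B : I -> set R) : (forall i, measurable (B i)) ->
  measurable [set w | forall i, B i (X w i)].
Proof.
move=> mB; have := iid_measurable iidX measurableT (measurable_rectangle mB).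
by rewrite setTI.
Qed.

Lemma iid_extend :
  iid_gauss (gauss_ext P) (fun w : T * measurableTypeR R => extend (X w.1) w.2).
Proof.
split=> [[i|]|B mB].
- by apply: (measurableT_comp (iidX.1 i)); exact: measurable_fst.
- exact: measurable_snd.
pose A := [set w : T | forall i, B (Some i) (X w i)].
rewrite (_ : [set w | _] = A `*` B None); last first.
  apply/seteqP; split=> [w /= wB|w [wA wB] [i|]]; last exact: wB.
    by split=> [i|]; [exact: (wB (Some i))|exact: (wB None)].
  exact: wA.
rewrite [LHS](product_measure1E P N01 (measurable_box (fun i => mB (Some i))) (mB None)).
rewrite (bigD1 None)//= muleC; congr (_ * _)%E.
rewrite (iidX.2 (fun i => B (Some i)) (fun i => mB (Some i))).
rewrite (reindex_omap (Some : I -> option I) id)/=; last by case.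
by apply: eq_bigl => i; rewrite eqxx.
Qed.

Lemma iid_upd a :
  iid_gauss (gauss_ext P) (fun w : T * measurableTypeR R => upd (X w.1) a w.2).
Proof.
split=> [i|B mB].
  rewrite /upd; case: eqP => _; first exact: measurable_snd.
  by apply: (measurableT_comp (iidX.1 i)); exact: measurable_fst.
pose B' i := if i == a then setT else B i.
have mB' i : measurable (B' i) by rewrite /B'; case: ifP.
rewrite (_ : [set w | _] = [set w | forall i, B' i (X w i)] `*` B a); last first.
  apply/seteqP; split=> [w /= wB|w [wA wB] i].
    split=> [i|]; last by have := wB a; rewrite /upd eqxx.
    by rewrite /B'; have := wB i; rewrite /upd; case: ifP.
  by rewrite /upd; case: eqP => [->//|/eqP/negbTE ia]; have := wA i; rewrite /B' ia.
rewrite [LHS](product_measure1E P N01 (measurable_box mB') (mB a)).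
rewrite iidX.2// [RHS](bigD1 a)//= muleC; congr (_ * _)%E.
rewrite (bigD1 a)//= {1}/B' eqxx [X in (X * _)%E]probability_setT mul1e.
by apply: eq_bigr => i /negbTE ia; rewrite /B' ia.
Qed.

(** The resampled family has the same law, and Fubini isolates the fresh coordinate; this takes the
    place of conditioning on the other coordinates. *)
Lemma iid_resample a (F : vecT I -> R) : measurable_fun [set: vecT I] F ->
  P.-integrable setT (fun w => (F (X w))%:E) ->
  (gauss_ext P).-integrable setT
     (fun w : T * measurableTypeR R => (F (upd (X w.1) a w.2))%:E) ->
  (forall x, N01.-integrable setT (fun y => (F (upd x a y))%:E)) ->
  \int[P]_w F (X w) = \int[P]_w \int[N01]_y F (upd (X w) a y).
Proof.
move=> mF i1 i2 i3; rewrite (iid_integral iidX (iid_upd a) mF i1 i2).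
rewrite /Rintegral; congr fine.
rewrite [LHS](_ : _ = \int[P \x N01]_z (F (upd (X z.1) a z.2))%:E)%E//.
rewrite -integral12_prod_meas1//.
apply: eq_integral => w _; rewrite /fubini_F/= fineK//.
exact: integrable_fin_num.
Qed.

End resampling.

Lemma bounded_integrable d (T : measurableType d) (R : realType)
    (P : probability T R) (F : T -> R) C :
  measurable_fun setT F -> (forall w, `|F w| <= C) ->
  P.-integrable setT (EFin \o F).
Proof.
move=> mF FC; apply: (@le_integrable _ _ _ P setT measurableT _ (cst C%:E)).
- exact/measurable_EFinP.
- by move=> w _; rewrite lee_fin (le_trans (FC _)) ?ler_norm.
- exact: finite_measure_integrable_cst.
Qed.

Section iid_integrable.
Context {R : realType} (I : finType) d (T : measurableType d) (P : probability T R).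
Variable X : T -> I -> R.
Hypothesis iidX : iid_gauss P X.
Variables (G : @vecT R I -> R) (C : R).
Hypotheses (mG : measurable_fun [set: vecT I] G) (GC : forall x, `|G x| <= C).

Lemma iid_measurable_comp : measurable_fun setT (fun w => G (X w)).
Proof. exact: measurableT_comp mG (iid_measurable iidX). Qed.

Lemma iid_bounded_integrable : P.-integrable setT (fun w => (G (X w))%:E).
Proof. exact: bounded_integrable iid_measurable_comp (fun w => GC (X w)). Qed.

Lemma iid_integrableM (a : I) :
  P.-integrable setT (fun w => (X w a * G (X w))%:E).
Proof.
have C0 : 0 <= C := le_trans (normr_ge0 _) (GC (fun=> 0)).
apply: (@le_integrable _ _ _ P setT measurableT _
  (fun w => C%:E * (X w a)%:E)%E).
- apply/measurable_EFinP; apply: measurable_funM; first exact: iidX.1.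
  exact: iid_measurable_comp.
- move=> w _; rewrite lee_fin !normrM mulrC ler_wpM2r//.
  by rewrite (le_trans (GC _)) ?ler_norm.
- by apply: integrableZl => //; exact: iid_integrable.
Qed.

End iid_integrable.

(** Once the coordinate [a] is resampled, the inner integral is a one-dimensional integration by
    parts. The single bound [C] fits its growth condition because [1 <= exp |y|]. *)
Lemma iid_ibp (R : realType) (I : finType) d (T : measurableType d)
    (P : probability T R) (X : T -> I -> R) (a : I) (G dG : @vecT R I -> R) (C : R) :
  iid_gauss P X ->
  measurable_fun [set: vecT I] G -> measurable_fun [set: vecT I] dG ->
  (forall x, `|G x| <= C) -> (forall x, `|dG x| <= C) ->
  (forall (x : I -> R) (y : R), is_derive y 1 (fun z => G (upd x a z)) (dG (upd x a y))) ->
  (forall x : I -> R, continuous (fun y : R => dG (upd x a y))) ->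
  \int[P]_w (X w a * G (X w)) = \int[P]_w dG (X w).
Proof.
move=> iidX mG mdG GC dGC Gd dGc.
have C0 : 0 <= C := le_trans (normr_ge0 _) (GC (fun=> 0)).
have iidX' := iid_upd iidX a.
have bnd z y : z <= C -> z <= C * expR `|y : R|.
  move=> /le_trans; apply; rewrite ler_peMr// -[leLHS]expR0 ler_expR//.
have ibp x := gauss_ibp (Gd x) (dGc x) (fun y => bnd _ _ (GC _)) (fun y => bnd _ _ (dGC _)).
rewrite (@iid_resample _ _ _ _ _ _ iidX a (fun x => x a * G x)).
- rewrite (@iid_resample _ _ _ _ _ _ iidX a dG) //.
  + by apply: eq_Rintegral => w _; have [_ _ <-] := ibp (X w);
      apply: eq_Rintegral => y _; rewrite {1}/upd eqxx.
  + refine (@iid_bounded_integrable R I d T P X iidX dG C mdG dGC).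
  + refine (@iid_bounded_integrable R I _ _ (gauss_ext P) _ iidX' dG C mdG dGC).
  + by move=> x; have [_ + _] := ibp x.
- by apply: measurable_funM => //; exact: measurable_coord.
- refine (@iid_integrableM R I _ _ P _ iidX G C mG GC a).
- refine (@iid_integrableM R I _ _ (gauss_ext P) _ iidX' G C mG GC a).
- move=> x; have [+ _ _] := ibp x.
  by under [in X in _ -> X]eq_fun do rewrite {1}/upd eqxx.
Qed.

(** * Gibbs averages over replicas and their derivatives *)

Definition fupd {I : finType} {S : Type} (w : {ffun I -> S}) (l : I) (s : S) :
  {ffun I -> S} := [ffun j => if j == l then s else w j].

Section replicas.
Context {R : realType} {S : finType} {m : nat}.
Notation Omega := {ffun 'I_m.+1 -> S}.
Implicit Types (H c : S -> R) (f : Omega -> R) (w : Omega).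

Definition weight H (s : S) : R := expR (H s) / \sum_t expR (H t).

Definition gweight H w : R := \prod_l weight H (w l).

Definition av H f : R := \sum_w f w * gweight H w.

Definition dep (n : nat) f : Prop := forall w w' : Omega,
  (forall l : 'I_m.+1, (l < n)%N -> w l = w' l) -> f w = f w'.

(* Replicas are counted from [0]: differentiating the Gibbs average of a
   function of [n] replicas brings in one new replica, of index [n] and
   weight [- n]. *)
Definition kap (n : nat) (l : nat) : R :=
  if (l < n)%N then 1 else if l == n then - n%:R else 0.

(** When the Hamiltonian has derivative [c], the Gibbs average of a function [f] of [n] replicas has
    derivative the average of [f] times [dlt n c]. *)
Definition dlt (n : nat) c w : R := \sum_(l < m.+1) kap n l * c (w l).

Variable s0 : S.

Lemma sum_expR_gt0 H : 0 < \sum_t expR (H t).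
Proof.
rewrite (bigD1 s0)//= ltr_wpDr ?expR_gt0// sumr_ge0// => t _; exact: expR_ge0.
Qed.

Lemma weight_ge0 H s : 0 <= weight H s.
Proof. by rewrite divr_ge0 ?expR_ge0// ltW// sum_expR_gt0. Qed.

Lemma weightE H s : weight H s = expR (H s - ln (\sum_t expR (H t))).
Proof. by rewrite expRD expRN lnK// posrE sum_expR_gt0. Qed.

Lemma sum_weight H : \sum_s weight H s = 1.
Proof. by rewrite -mulr_suml divff// gt_eqF// sum_expR_gt0. Qed.

Lemma gweight_ge0 H w : 0 <= gweight H w.
Proof. by apply: prodr_ge0 => l _; exact: weight_ge0. Qed.

Lemma sum_gweight H : \sum_w gweight H w = 1.
Proof.
rewrite /gweight -(bigA_distr_bigA (fun _ s => weight H s)) big1// => l _.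
exact: sum_weight.
Qed.

Lemma gweight_le1 H w : gweight H w <= 1.
Proof.
rewrite -(sum_gweight H) (bigD1 w)//= lerDl sumr_ge0// => v _.
exact: gweight_ge0.
Qed.

Lemma gweight_perm H (p : 'I_m.+1 -> 'I_m.+1) w : injective p ->
  gweight H [ffun j => w (p j)] = gweight H w.
Proof.
move=> p_inj; rewrite /gweight [RHS](reindex_inj p_inj)/=.
by apply: eq_bigr => l _; rewrite ffunE.
Qed.

Lemma av_norm_le H f : `|av H f| <= \sum_w `|f w|.
Proof.
apply: le_trans (ler_norm_sum _ _ _) _; apply: ler_sum => w _.
by rewrite normrM (ger0_norm (gweight_ge0 _ _)) ler_piMr// gweight_le1.
Qed.

Lemma av_sum H (J : finType) (F : J -> Omega -> R) :
  av H (fun w => \sum_j F j w) = \sum_j av H (F j).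
Proof.
by rewrite /av exchange_big; apply: eq_bigr => w _; rewrite mulr_suml.
Qed.

Lemma avZ H (a : R) f : av H (fun w => a * f w) = a * av H f.
Proof. by rewrite /av mulr_sumr; apply: eq_bigr => w _; rewrite mulrA. Qed.

Lemma eq_av H f1 f2 : f1 =1 f2 -> av H f1 = av H f2.
Proof. by move=> f12; apply: eq_bigr => w _; rewrite f12. Qed.

(** Exchanging the value of replica [l] with an independent extra configuration is an involution
    that preserves the product weight and leaves [f] unchanged. *)
Lemma av_indep H f c l : (forall w s, f (fupd w l s) = f w) ->
  av H (fun w => f w * c (w l)) = av H f * \sum_s weight H s * c s.
Proof.
move=> fl; rewrite -[LHS]mul1r -(sum_weight H).
rewrite /av big_distrl/= [RHS]mulrC [RHS]big_distrl/=.
under eq_bigr do rewrite big_distrr/=.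
under [RHS]eq_bigr do rewrite big_distrr/=.
rewrite !pair_big/=.
pose h (p : S * Omega) : S * Omega := (p.2 l, fupd p.2 l p.1).
have hK : involutive h.
  move=> [s w]; rewrite /h/= ffunE eqxx; congr pair.
  by apply/ffunP => j; rewrite !ffunE; case: eqP => [->|].
rewrite (reindex_inj (inv_inj hK)); apply: eq_bigr => -[s w] _ /=.
rewrite fl ffunE eqxx.
suff E : weight H (w l) * gweight H (fupd w l s) = weight H s * gweight H w.
  by rewrite mulrCA E; ring.
rewrite /gweight (bigD1 l)//= ffunE eqxx [in RHS](bigD1 l)//= mulrCA.
congr (_ * (_ * _)); apply: eq_bigr => j /negbTE jl.
by rewrite ffunE jl.
Qed.

Lemma dep_fupd n f (l : 'I_m.+1) w s : dep n f -> (n <= l)%N ->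
  f (fupd w l s) = f w.
Proof.
move=> fn nl; apply: fn => j jn; rewrite ffunE; case: eqP => // jl.
by move: jn; rewrite jl ltnNge nl.
Qed.

Lemma sum_kap n (F : nat -> R) : (n <= m)%N ->
  \sum_(l < m.+1) kap n l * F l = \sum_(l < m.+1 | (l < n)%N) (F l - F n).
Proof.
move=> nm; rewrite sumrB [X in _ - X](big_ord_narrow (leqW nm)) sumr_const card_ord.
have nm1 : (n < m.+1)%N by [].
rewrite (bigID (fun l : 'I_m.+1 => (l < n)%N))/=; congr (_ + _).
  by apply: eq_bigr => l ln; rewrite /kap ln mul1r.
rewrite (bigD1 (Ordinal nm1)) /= ?ltnn// /kap ltnn eqxx big1 ?addr0; last first.
  move=> l /andP[ln lneq]; rewrite (negbTE ln) ifF ?mul0r//.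
  by apply/eqP => E; move/eqP: lneq; apply; exact/val_inj.
by rewrite mulNr mulr_natl.
Qed.

End replicas.

Lemma is_derive_bigsum {R : realType} (J : Type) (r : seq J) (F : J -> R -> R)
    (dF : J -> R) (x : R) :
  (forall j, is_derive x 1 (F j) (dF j)) ->
  is_derive x 1 (fun y => \sum_(j <- r) F j y) (\sum_(j <- r) dF j).
Proof.
move=> Fd; elim: r => [|j r IH].
  by rewrite big_nil; under eq_fun do rewrite big_nil; exact: is_derive_cst.
by rewrite big_cons; under eq_fun do rewrite big_cons; exact: is_deriveD.
Qed.

Lemma is_derive_eqf {R : realType} (f g : R -> R) (x df dg : R) :
  f =1 g -> df = dg -> is_derive x 1 g dg -> is_derive x 1 f df.
Proof. by move=> /funext -> ->. Qed.

Section derivative.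
Context {R : realType} {S : finType} {m : nat}.
Notation Omega := {ffun 'I_m.+1 -> S}.
Variables (s0 : S) (H : R -> S -> R) (dH : S -> R) (y : R).
Hypothesis Hd : forall s, is_derive y 1 (H^~ s) (dH s).

Let avd : R := \sum_s weight (H y) s * dH s.

Lemma is_derive_lnZ : is_derive y 1 (fun z => ln (\sum_t expR (H z t))) avd.
Proof.
have Z0 : 0 < \sum_t expR (H y t) by exact: sum_expR_gt0.
have dln := is_derive1_ln Z0.
have dZ : is_derive y 1 (fun z => \sum_t expR (H z t)) (\sum_t expR (H y t) * dH t).
  exact: is_derive_bigsum.
have := is_derive1_comp (f := @ln R) (g := fun z => \sum_t expR (H z t)) (x := y).
move=> /(_ _ _ dln dZ); apply: is_derive_eqf => //.
rewrite /avd mulr_sumr; apply: eq_bigr => t _; rewrite /weight; ring.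
Qed.

Lemma is_derive_gweight (w : Omega) :
  is_derive y 1 (fun z => gweight (H z) w)
    (gweight (H y) w * \sum_l (dH (w l) - avd)).
Proof.
pose e z := \sum_l (H z (w l) - ln (\sum_t expR (H z t))).
have gE z : gweight (H z) w = expR (e z).
  by rewrite /gweight /e expR_sum; apply: eq_bigr => l _; rewrite (weightE s0).
have de : is_derive y 1 e (\sum_l (dH (w l) - avd)).
  apply: is_derive_bigsum => l; apply: is_deriveB; exact: is_derive_lnZ.
have D := is_derive1_comp (is_derive_expR (e y)) de.
by apply: is_derive_eqf D => [z|]; rewrite gE.
Qed.

Lemma is_derive_av_all (f : Omega -> R) :
  is_derive y 1 (fun z => av (H z) f)
    (\sum_w f w * (gweight (H y) w * \sum_l (dH (w l) - avd))).
Proof.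
apply: is_derive_bigsum => w; have := is_derive_gweight w.
exact: is_deriveZ.
Qed.

(** Differentiating the weights centres the term of each replica by the mean [avd]. A replica that
    [f] does not see averages to [avd] and cancels; the [n] means that remain to be subtracted are
    carried by the one replica [n]. *)
Lemma is_derive_av (n : nat) (f : Omega -> R) : (n <= m)%N -> dep n f ->
  is_derive y 1 (fun z => av (H z) f) (av (H y) (fun w => f w * dlt n dH w)).
Proof.
move=> nm fn.
apply: (is_derive_eqf (dg := \sum_w f w * (gweight (H y) w * \sum_l (dH (w l) - avd)))) => //; last first.
  exact: is_derive_av_all.
have outer (l : 'I_m.+1) : (n <= l)%N ->
    av (H y) (fun w => f w * dH (w l)) = av (H y) f * avd.
  by move=> nl; apply: (av_indep s0) => w s; exact: dep_fupd fn nl.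
have -> : av (H y) (fun w => f w * dlt n dH w) =
    \sum_(l < m.+1) kap n l * av (H y) (fun w => f w * dH (w l)).
  rewrite -(eq_bigr _ (fun l _ => avZ _ _ _)) -av_sum; apply: eq_av => w.
  by rewrite /dlt mulr_sumr; apply: eq_bigr => l _; ring.
have -> : \sum_w f w * (gweight (H y) w * \sum_l (dH (w l) - avd)) =
    \sum_(l < m.+1) (av (H y) (fun w => f w * dH (w l)) - av (H y) f * avd).
  rewrite (eq_bigr (fun w => \sum_l (f w * dH (w l) * gweight (H y) w -
     f w * gweight (H y) w * avd))); last first.
    move=> w _; generalize avd => a.
    by rewrite !mulr_sumr; apply: eq_bigr => l _; ring.
  rewrite exchange_big; apply: eq_bigr => l _.
  by rewrite sumrB -mulr_suml.
(* The value 0 out of range is a default: [sum_kap] is stated for functions on [nat]. *)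
pose F (j : nat) : R := if insub j is Some l then av (H y) (fun w => f w * dH (w l)) else 0.
have FE (l : 'I_m.+1) : av (H y) (fun w => f w * dH (w l)) = F l.
  by rewrite /F; case: insubP => [k _ /val_inj ->|] //; rewrite ltn_ord.
have Fn : F n = av (H y) f * avd.
  by have nm1 : (n < m.+1)%N by []; rewrite -(FE (Ordinal nm1)) outer.
under eq_bigr do rewrite FE; rewrite sum_kap// Fn.
rewrite [RHS](bigID (fun l : 'I_m.+1 => (l < n)%N))/=.
rewrite [X in _ = _ + X]big1 ?addr0.
  by apply: eq_bigr => l _; rewrite FE.
by move=> l; rewrite -leqNgt => nl; rewrite outer// subrr.
Qed.

End derivative.

(** * The derivative along a Gaussian interpolation *)

Lemma Rintegral_bigsum d (T : measurableType d) (R : realType)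
    (P : {measure set T -> \bar R}) (J : Type) (r : seq J) (F : J -> T -> R) :
  (forall j, P.-integrable setT (EFin \o F j)) ->
  P.-integrable setT (EFin \o (fun w => \sum_(j <- r) F j w)) /\
  \int[P]_w (\sum_(j <- r) F j w) = \sum_(j <- r) \int[P]_w F j w.
Proof.
move=> Fi; elim: r => [|j r [IHi IH]].
  split; last by under eq_Rintegral do rewrite big_nil; rewrite big_nil Rintegral_cst// mul0r.
  rewrite (_ : EFin \o _ = cst 0%E); first exact: integrable0.
  by apply/funext => w /=; rewrite big_nil.
have E : (fun w => \sum_(i <- j :: r) F i w) =
    (fun w => F j w + \sum_(i <- r) F i w).
  by apply/funext => w; rewrite big_cons.
rewrite E big_cons -IH; split; last by rewrite RintegralD.
by apply: (integrableD measurableT (Fi j) IHi).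
Qed.

Section interpolation.
Context {R : realType} {I S : finType} {m : nat}.
Context d (T : measurableType d) (P : probability T R).
Notation Omega := {ffun 'I_m.+1 -> S}.
Variables (X : T -> I -> R) (s0 : S).
Hypothesis iidX : iid_gauss P X.
Variables (al dal : I -> R -> R) (k : I -> S -> R) (mean : S -> R).
Hypothesis al_d : forall i (t : R), is_derive t 1 (al i) (dal i t).
Hypothesis dal1 : forall i t, `|dal i t| <= 1.

Definition ham (t : R) (x : I -> R) (s : S) : R :=
  \sum_i al i t * k i s * x i + mean s.

(** Averaging the Gibbs weight of each family of replicas over the disorder gives a law on a finite
    set, which is all that the later estimates handle. *)
Definition prob_at (t : R) (w : Omega) : R := \int[P]_v gweight (ham t (X v)) w.

Definition nut (t : R) (f : Omega -> R) : R := \sum_w f w * prob_at t w.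

Lemma measurable_gweight t (w : Omega) :
  measurable_fun [set: vecT I] (fun x => gweight (ham t x) w).
Proof.
have mham s : measurable_fun [set: vecT I] (fun x => ham t x s).
  apply: measurable_funD => //; apply: measurable_sum => i.
  by apply: measurable_funM => //; exact: measurable_coord.
apply: measurable_prod => l _.
rewrite (_ : (fun x : vecT I => weight (ham t x) (w l)) = (fun x : vecT I =>
    expR (ham t x (w l) - ln (\sum_s expR (ham t x s))))); last first.
  by apply/funext => x; rewrite (weightE s0).
apply: measurableT_comp => //; apply: measurable_funB => //.
apply: measurableT_comp; first exact: measurable_ln.
by apply: measurable_sum => s; apply: measurableT_comp.
Qed.

Lemma measurable_av t (f : Omega -> R) :
  measurable_fun [set: vecT I] (fun x => av (ham t x) f).
Proof.
apply: measurable_sum => w; apply: measurable_funM => //.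
exact: measurable_gweight.
Qed.

Lemma av_integrable t (f : Omega -> R) :
  P.-integrable setT (EFin \o (fun v => av (ham t (X v)) f)).
Proof.
exact: (@iid_bounded_integrable _ _ _ _ P _ iidX _ _ (measurable_av t f)
  (fun x => av_norm_le s0 _ _)).
Qed.

Lemma nutE t f : nut t f = \int[P]_v av (ham t (X v)) f.
Proof.
have gi (w : Omega) : P.-integrable setT (EFin \o (fun v => gweight (ham t (X v)) w)).
  refine (@iid_bounded_integrable R I d T P X iidX
    (fun x => gweight (ham t x) w) 1 (measurable_gweight t w) _).
  by move=> x; rewrite ger0_norm ?gweight_ge0// gweight_le1.
have gi' w : P.-integrable setT
    (EFin \o (fun v => f w * gweight (ham t (X v)) w)).
  rewrite (_ : _ \o _ = fun v => (f w)%:E * (gweight (ham t (X v)) w)%:E)%E//.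
  by apply: integrableZl => //; exact: gi.
have [_ ->] := Rintegral_bigsum (index_enum Omega) gi'.
by apply: eq_bigr => w _; rewrite RintegralZl.
Qed.

(** The derivative in [t] brings in replica [n]; integration by parts is then applied to a function
    of [n.+1] replicas and brings in replica [n.+1]. Hence the two different indices of [dlt]. *)
Definition Kn (n : nat) (t : R) (w : Omega) : R :=
  \sum_i dal i t * al i t * dlt n (k i) w * dlt n.+1 (k i) w.

Lemma is_derive_ham_coord t (x : I -> R) a (y : R) s :
  is_derive y 1 (fun z => ham t (upd x a z) s) (al a t * k a s).
Proof.
apply: (is_derive_eqf (g := (fun z => al a t * k a s * z) +
   cst (\sum_(i | i != a) al i t * k i s * x i + mean s)) (dg := al a t * k a s * 1 + 0)).
- move=> z; rewrite /ham (bigD1 a)//= {1}/upd eqxx -addrA; congr (_ + (_ + _)).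
  by apply: eq_bigr => i /negbTE ia; rewrite /upd ia.
- by rewrite mulr1 addr0.
Qed.

Lemma nut_ibp t n (f : Omega -> R) a : (n <= m)%N -> dep n f ->
  \int[P]_v (X v a * av (ham t (X v)) f) =
  nut t (fun w => f w * (al a t * dlt n (k a) w)).
Proof.
move=> nm fn; rewrite nutE.
have dltZ w : dlt n (fun s => al a t * k a s) w = al a t * dlt n (k a) w.
  by rewrite /dlt mulr_sumr; apply: eq_bigr => l _; ring.
set g := fun w => f w * (al a t * dlt n (k a) w).
have gE : g = (fun w => f w * dlt n (fun s => al a t * k a s) w).
  by apply/funext => w; rewrite dltZ.
pose C := \sum_w `|f w| + \sum_w `|g w|.
apply: (@iid_ibp R I d T P X a (fun x => av (ham t x) f) (fun x => av (ham t x) g) C).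
- exact: iidX.
- exact: measurable_av.
- exact: measurable_av.
- by move=> x; rewrite (le_trans (av_norm_le s0 _ _))// lerDl sumr_ge0.
- by move=> x; rewrite (le_trans (av_norm_le s0 _ _))// lerDr sumr_ge0.
- move=> x y; rewrite gE.
  apply: (is_derive_av s0 (H := fun z => ham t (upd x a z))) => // s.
  exact: is_derive_ham_coord.
- move=> x y; apply: differentiable_continuous; apply/derivable1_diffP.
  have D := is_derive_av_all s0 (H := fun z => ham t (upd x a z))
    (is_derive_ham_coord t x a y) g.
  exact: (@ex_derive _ _ _ _ _ _ _ D).
Qed.

Lemma dep_dlt n (f : Omega -> R) c : dep n f -> dep n.+1 (fun w => f w * dlt n c w).
Proof.
move=> fn w w' ww'; rewrite (fn _ w'); last by move=> l ln; rewrite ww'// ltnW.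
congr (_ * _); apply: eq_bigr => l _; rewrite /kap.
case: ltngtP => [ln||ln]; [|by rewrite !mul0r|].
  by rewrite ww'// ltnW.
by rewrite ww'// ln.
Qed.

Theorem is_derive_nut (t : R) n (f : Omega -> R) : (n < m)%N -> dep n f ->
  is_derive t 1 (fun z => nut z f) (nut t (fun w => f w * Kn n t w)).
Proof.
move=> nm fn.
pose F z v := av (ham z (X v)) f.
pose dF z v := av (ham z (X v))
  (fun w => f w * dlt n (fun s => \sum_i dal i z * k i s * X v i) w).
have Fd (z : R) v : is_derive z 1 (F^~ v) (dF z v).
  apply: (is_derive_av s0 (H := fun z => ham z (X v))) => [s||//]; last exact: ltnW.
  apply: (is_derive_eqf (g := (fun z => \sum_i al i z * k i s * X v i) +
    cst (mean s)) (dg := \sum_i dal i z * k i s * X v i + 0)) => //.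
    by rewrite addr0.
  apply: is_deriveD; apply: is_derive_bigsum => i.
  apply: (is_derive_eqf (g := (k i s * X v i) *: al i)
    (dg := (k i s * X v i) *: dal i z)).
  - by move=> y; rewrite -[RHS]/(k i s * X v i * al i y); ring.
  - by rewrite -[RHS]/(k i s * X v i * dal i z); ring.
have dFE z v : dF z v = \sum_i dal i z * (X v i * av (ham z (X v)) (fun w => f w * dlt n (k i) w)).
  rewrite /dF; under [RHS]eq_bigr do rewrite mulrA -avZ.
  rewrite -av_sum; apply: eq_av => w; rewrite /dlt mulr_sumr.
  under [RHS]eq_bigr do rewrite !mulr_sumr.
  rewrite exchange_big; apply: eq_bigr => l _; rewrite !mulr_sumr.
  by apply: eq_bigr => i _; ring.
pose B i := \sum_w `|f w * dlt n (k i) w|.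
(* Dominates the derivative uniformly in time: the amplitudes have derivatives bounded by 1, and the
   Gibbs weights are at most 1. *)
pose G v := \sum_i `|X v i| * B i.
have G0 v : 0 <= G v by apply: sumr_ge0 => i _; rewrite mulr_ge0// sumr_ge0.
have Gi : P.-integrable setT (EFin \o G).
  apply: (Rintegral_bigsum (index_enum I) (F := fun i v => `|X v i| * B i) _).1 => i.
  rewrite (_ : _ \o _ = fun v => (B i)%:E * `|(X v i)%:E|)%E; last first.
    by apply/funext => v /=; rewrite -EFinM mulrC.
  by apply: integrableZl => //; apply: integrable_abse; exact: iid_integrable.
have dFG z v : `|dF z v| <= G v.
  rewrite dFE; apply: le_trans (ler_norm_sum _ _ _) _; apply: ler_sum => i _.
  rewrite !normrM mulrA -[leRHS]mul1r -mulrA ler_pM//.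
  by rewrite ler_wpM2l// av_norm_le.
have p1 z v : partial1of2 F z v = dF z v.
  by rewrite partial1of2E; exact: derive_val.
have tin : `]t - 1, t + 1[%classic t by rewrite /= in_itv/=; apply/andP; split; lra.
have Fi z : P.-integrable setT (EFin \o F z) by exact: av_integrable.
have Fdv (z : R) v : derivable (F^~ v) z 1 := @ex_derive _ _ _ _ _ _ _ (Fd z v).
have h1 := @derivable_under_integral R d T P F setT measurableT t (t - 1) (t + 1) tin
  (fun x _ => Fi x) (fun x y _ _ => Fdv x y) G G0 Gi.
have h2 := @differentiation_under_integral R d T P F setT measurableT t (t - 1) (t + 1) tin
  (fun x _ => Fi x) (fun x y _ _ => Fdv x y) G G0 Gi.
have pG x y : `]t - 1, t + 1[%classic x -> setT y -> `|partial1of2 F x y| <= G y.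
  by move=> _ _; rewrite p1.
have {}h1 := h1 pG; have {}h2 := h2 pG.
have -> : (fun z => nut z f) = (fun z => \int[P]_v F z v).
  by apply/funext => z; rewrite nutE.
apply: DeriveDef => //; rewrite -derive1E h2.
under eq_Rintegral do rewrite /= p1 dFE.
have Xi i : P.-integrable setT (EFin \o (fun v => X v i * av (ham t (X v)) (fun w => f w * dlt n (k i) w))).
  exact: (@iid_integrableM R I d T P X iidX (fun x => av (ham t x) _) _ (measurable_av t _) (fun x => av_norm_le s0 _ _)).
have [] := @Rintegral_bigsum d T R P _ (index_enum I) (fun i v => dal i t * (X v i * av (ham t (X v)) (fun w => f w * dlt n (k i) w))).
  move=> i; rewrite (_ : _ \o _ = fun v => (dal i t)%:E * (X v i * av (ham t (X v)) (fun w => f w * dlt n (k i) w))%:E)%E//.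
  by apply: integrableZl => //; exact: Xi.
move=> _ ->.
have step i : \int[P]_v (dal i t * (X v i * av (ham t (X v)) (fun w => f w * dlt n (k i) w))) =
    dal i t * nut t (fun w => f w * dlt n (k i) w * (al i t * dlt n.+1 (k i) w)).
  rewrite -(nut_ibp t i (n := n.+1))//; last exact: dep_dlt.
  exact: (RintegralZl (dal i t) measurableT (Xi i)).
rewrite (eq_bigr _ (fun i _ => step i)).
rewrite /nut; under eq_bigr do rewrite mulr_sumr.
rewrite exchange_big; apply: eq_bigr => w _.
rewrite /Kn mulr_sumr mulr_suml; apply: eq_bigr => i _; ring.
Qed.

End interpolation.

(** * A spin decoupled from the rest, in an external field *)

Section flip.
Context {R : realType} {S : finType} {m : nat}.
Notation Omega := {ffun 'I_m.+1 -> S}.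
Variables (s0 : S) (fl : S -> S) (eps A : S -> R).
Hypotheses (flK : involutive fl) (eps_fl : forall s, eps (fl s) = - eps s).
Hypotheses (eps_sq : forall s, eps s ^+ 2 = 1) (A_fl : forall s, A (fl s) = A s).

Definition field (y : R) (s : S) : R := A s + y * eps s.

Definition flip_at (w : Omega) (l : 'I_m.+1) : Omega := fupd w l (fl (w l)).

Lemma flip_atK l : involutive (flip_at^~ l).
Proof.
move=> w; apply/ffunP => j; rewrite !ffunE eqxx flK.
by case: eqP => [->|].
Qed.

Lemma tanhE (y : R) : tanh y * (expR y + expR (- y)) = expR y - expR (- y).
Proof. by rewrite divfK// gt_eqF// addr_gt0 ?expR_gt0. Qed.

Lemma eps_tanh (y : R) s :
  eps s * (expR (y * eps s) - expR (- (y * eps s))) =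
  tanh y * (expR (y * eps s) + expR (- (y * eps s))).
Proof.
have /eqP : eps s ^+ 2 = 1 := eps_sq s.
rewrite sqrf_eq1 => /orP[]/eqP ->.
  by rewrite mul1r mulr1 tanhE.
by rewrite mulrN1 opprK [in RHS]addrC tanhE; ring.
Qed.

Lemma gweight_flip y (w : Omega) l :
  eps (w l) * (gweight (field y) w - gweight (field y) (flip_at w l)) =
  tanh y * (gweight (field y) w + gweight (field y) (flip_at w l)).
Proof.
have D (v : Omega) : gweight (field y) v = weight (field y) (v l) *
    \prod_(i | i != l) weight (field y) (v i) by rewrite /gweight (bigD1 l).
rewrite !D.
have -> : \prod_(i | i != l) weight (field y) (flip_at w l i) =
    \prod_(i | i != l) weight (field y) (w i).
  by apply: eq_bigr => i /negbTE il; rewrite ffunE il.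
rewrite ffunE eqxx /weight /field A_fl eps_fl mulrN !expRD.
have := eps_tanh y (w l).
set e := expR (y * _); set e' := expR (- _); set Z := \sum_t _; set W := \prod_(i | _) _.
move=> E.
transitivity (eps (w l) * (e - e') * (expR (A (w l)) / Z * W)); first by ring.
by rewrite E; ring.
Qed.

(** Pair each family with the one whose replica [l] is flipped: within a pair the weights are
    proportional to [exp y] and [exp (- y)], while [f] is the same. *)
Lemma av_flip y (f : Omega -> R) l : (forall w, f (flip_at w l) = f w) ->
  av (field y) (fun w => f w * eps (w l)) = tanh y * av (field y) f.
Proof.
move=> fl_inv; pose W := gweight (m := m) (field y).
have ri (F : Omega -> R) : \sum_w F w = \sum_w F (flip_at w l).
  by rewrite (reindex_inj (inv_inj (flip_atK l))).
have two (x z : R) : x + x = z + z -> x = z by lra.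
apply: two; rewrite {2}/av ri {1}/av -big_split/=.
rewrite -mulrDr {2}/av [X in _ = _ * (_ + X)]ri {1}/av -big_split mulr_sumr/=.
apply: eq_bigr => w _; rewrite fl_inv ffunE eqxx eps_fl.
transitivity (f w * (eps (w l) * (W w - W (flip_at w l)))); first by rewrite /W; ring.
rewrite gweight_flip -/W; ring.
Qed.

Lemma av_flips y (f : Omega -> R) (r : seq 'I_m.+1) : uniq r ->
  (forall l w, f (flip_at w l) = f w) ->
  av (field y) (fun w => f w * \prod_(l <- r) eps (w l)) =
  tanh y ^+ size r * av (field y) f.
Proof.
move=> + finv; elim: r => [_|l r IH /andP[lr ur]].
  by rewrite expr0 mul1r; apply: eq_av => w; rewrite big_nil mulr1.
rewrite exprS -mulrA -IH// -(av_flip y (l := l)).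
  by apply: eq_av => w; rewrite big_cons; ring.
move=> w; rewrite finv; congr (_ * _); apply: eq_big_seq => j jr.
by rewrite ffunE; case: eqP => // jl; rewrite -jl jr in lr.
Qed.

Lemma sum_weight_eps y : \sum_s weight (field y) s * eps s = tanh y.
Proof.
have ri (F : S -> R) : \sum_s F s = \sum_s F (fl s).
  by rewrite (reindex_inj (inv_inj flK)).
have two (x z : R) : x + x = z + z -> x = z by lra.
apply: two; rewrite {2}ri -big_split/= -mulr2n -[in RHS]mulr_natr.
have <- : \sum_s (weight (field y) s + weight (field y) (fl s)) = 2.
  by rewrite big_split/= -(ri (weight (field y))) !sum_weight.
rewrite mulr_sumr; apply: eq_bigr => s _.
rewrite /weight /field A_fl eps_fl !mulrN !expRD.
have := eps_tanh y s.
set e := expR (y * _); set e' := expR (- _); set Z := \sum_t _ => E.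
transitivity (eps s * (e - e') * (expR (A s) / Z)); first by ring.
by rewrite E; ring.
Qed.

(** The derivative in [y] is the sum over replicas of the average of [f eps_l] minus [tanh y] times
    that of [f], and each term vanishes by [av_flip]. *)
Lemma av_field_cst y (f : Omega -> R) : (forall l w, f (flip_at w l) = f w) ->
  av (field y) f = av A f.
Proof.
move=> finv.
have Hd (x : R) s : is_derive x 1 (field^~ s) (eps s).
  have D := is_deriveD (is_derive_cst (A s) x (1 : R))
    (is_deriveZ (f := idfun) (eps s) (is_derive_id x (1 : R))).
  apply: (is_derive_eqf _ _ D); first by move=> z; rewrite /field mulrC.
  by rewrite add0r -[RHS]/(eps s * 1) mulr1.
have D (x : R) : is_derive x 1 (fun z => av (field z) f) 0.
  have := is_derive_av_all s0 (Hd x) f.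
  apply: is_derive_eqf => //; rewrite sum_weight_eps.
  transitivity (\sum_l (av (field x) (fun w => f w * eps (w l)) - tanh x * av (field x) f)).
    by rewrite big1// => l _; rewrite av_flip ?subrr.
  rewrite /av; under eq_bigr do rewrite mulr_sumr -sumrB.
  rewrite exchange_big; apply: eq_bigr => w _.
  by rewrite !mulr_sumr; apply: eq_bigr => l _; ring.
rewrite (is_derive_0_is_cst y 0 D) (_ : field 0 = A)//.
by apply/funext => s; rewrite /field mul0r addr0.
Qed.

End flip.

(** * Elementary symmetric polynomials of signs *)

Section elementary_symmetric.
Context {R : realType} {T : finType}.
Implicit Types (U A B : {set T}).

Definition esum_sym (tau : T -> R) U (r : nat) : R :=
  \sum_(A : {set T} | (A \subset U) && (#|A| == r)) \prod_(x in A) tau x.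

Variables (tau : T -> R).
Hypothesis tau_sq : forall x, tau x ^+ 2 = 1.

Lemma norm_tau x : `|tau x| = 1.
Proof.
have /eqP : tau x ^+ 2 = 1 := tau_sq x.
by rewrite sqrf_eq1 => /orP[]/eqP ->; rewrite ?normrN1 ?normr1.
Qed.

Lemma norm_prod_tau A : `|\prod_(x in A) tau x| = 1.
Proof. by rewrite normr_prod big1// => x _; exact: norm_tau. Qed.

Lemma esum_sym0 U : esum_sym tau U 0 = 1.
Proof.
rewrite /esum_sym (big_pred1 finset.set0) ?big_set0// => A.
apply/andP/eqP => [[_]|->]; first by rewrite cards_eq0 => /eqP.
by rewrite cards0 finset.sub0set.
Qed.

(** Double counting: a set [A] of size [r] with a point outside it corresponds to a set of size
    [r.+1] with a marked point. *)
Lemma sum_esum_sym U r :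
  \sum_(A : {set T} | (A \subset U) && (#|A| == r))
    \sum_(x in U | x \notin A) tau x * \prod_(y in A) tau y =
  r.+1%:R * esum_sym tau U r.+1.
Proof.
rewrite /esum_sym mulr_sumr.
transitivity (\sum_(B : {set T} | (B \subset U) && (#|B| == r.+1))
    \sum_(x in U | x \in B) \prod_(y in B) tau y); last first.
  apply: eq_bigr => B /andP[BU /eqP cB].
  rewrite -cB sumr_const mulr_natl; congr (_ *+ _).
  apply: eq_card => x; rewrite unfold_in; apply/andP/idP => [[]//|xB].
  by split => //; exact: (fintype.subsetP BU).
rewrite (exchange_big_dep (mem U))/=; last by move=> A x _ /andP[].
rewrite [RHS](exchange_big_dep (mem U))/=; last by move=> A x _ /andP[].
apply: eq_bigr => x xU.
rewrite [RHS](reindex_onto (fun A => x |: A)%SET (fun B => B :\ x)%SET)/=; last first.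
  by move=> B /andP[_ /andP[_ xB]]; rewrite finset.setD1K.
apply: eq_big => [A|A /andP[_ /andP[_ xA]]]; last first.
  by rewrite (big_setU1 _ xA).
rewrite xU/= finset.setU11 andbT.
case: (boolP (x \in A)) => xA /=.
  rewrite andbF; apply/esym/negbTE; rewrite negb_and; apply/orP; right.
  by apply/eqP => E; rewrite -E !inE eqxx in xA.
rewrite cardsU1 xA add1n eqSS finset.setU1K// eqxx !andbT.
by rewrite finset.subUset finset.sub1set xU.
Qed.

Lemma card_esum_sym U r :
  \sum_(A : {set T} | (A \subset U) && (#|A| == r)) (1 : R) = 'C(#|U|, r)%:R.
Proof.
by rewrite sumr_const -cards_draws; congr (_ *+ _); apply: eq_card => A; rewrite !inE.
Qed.

(** In the expanded product, a point outside the set contributes to [(r+1) e_(r+1)]; the points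
    inside amount to at most [r] for each set of size [r]. *)
Lemma esum_symS U r :
  `|(\sum_(x in U) tau x) * esum_sym tau U r - r.+1%:R * esum_sym tau U r.+1|
    <= r%:R * 'C(#|U|, r)%:R.
Proof.
rewrite -sum_esum_sym {1}/esum_sym mulr_sumr -sumrB.
apply: le_trans (ler_norm_sum _ _ _) _.
rewrite -card_esum_sym mulr_sumr; apply: ler_sum => A /andP[AU /eqP cA].
rewrite (bigID (fun x => x \in A))/= -mulr_suml -mulrBl addrK normrM norm_prod_tau mulr1.
rewrite mulr1 -cA; apply: le_trans (ler_norm_sum _ _ _) _.
rewrite (eq_bigr (fun=> 1)); last by move=> x _; exact: norm_tau.
rewrite sumr_const ler_nat subset_leq_card//.
by apply/fintype.subsetP => x; rewrite unfold_in => /andP[].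
Qed.

Lemma fact_bin_le n r N : (n <= N)%N -> r`!%:R * 'C(n, r)%:R <= N%:R ^+ r :> R.
Proof.
move=> nN; rewrite -natrM mulnC bin_ffact -natrX ler_nat.
apply: (@leq_trans (n ^ r)); last by case: r => // r; rewrite leq_exp2r.
elim: r n {nN} => [|r IH] n; first by rewrite ffactn0.
rewrite ffactnS expnS leq_mul2l; apply/orP; right.
apply: leq_trans (IH _) _; case: r {IH} => // r; rewrite leq_exp2r//; exact: leq_pred.
Qed.

Lemma norm_esum_sym U r N : (#|U| <= N)%N -> r`!%:R * `|esum_sym tau U r| <= N%:R ^+ r.
Proof.
move=> UN; apply: le_trans (fact_bin_le r UN); rewrite ler_wpM2l//.
apply: le_trans (ler_norm_sum _ _ _) _.
rewrite -card_esum_sym; apply: ler_sum => A _; by rewrite norm_prod_tau.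
Qed.

(** Repeated indices in the power of the sum cost one factor [N]. The errors accumulate along the
    induction as [r^2 + r <= (r+1)^2]. *)
Lemma esum_sym_power U r N : (#|U| <= N)%N ->
  `|(\sum_(x in U) tau x) ^+ r - r`!%:R * esum_sym tau U r| <=
    (r ^ 2)%:R * N%:R ^+ (r - 1).
Proof.
move=> UN; set s := \sum_(x in U) tau x.
have sN : `|s| <= N%:R.
  apply: le_trans (ler_norm_sum _ _ _) _.
  rewrite (eq_bigr (fun=> 1)); last by move=> x _; exact: norm_tau.
  by rewrite sumr_const ler_nat.
elim: r => [|r IH]; first by rewrite esum_sym0 expr0 fact0 mulr1 subrr normr0 mul0r.
have -> : s ^+ r.+1 - (r.+1)`!%:R * esum_sym tau U r.+1 =
    s * (s ^+ r - r`!%:R * esum_sym tau U r) +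
    r`!%:R * (s * esum_sym tau U r - r.+1%:R * esum_sym tau U r.+1).
  by rewrite factS natrM exprS; ring.
apply: le_trans (ler_normD _ _) _; rewrite !normrM subSS subn0.
have h1 : `|s| * `|s ^+ r - r`!%:R * esum_sym tau U r| <= (r ^ 2)%:R * N%:R ^+ r.
  apply: le_trans (ler_pM _ _ sN IH) _ => //.
  case: r {IH} => [|r]; first by rewrite !mul0r mulr0.
  by rewrite subSS subn0 mulrCA -exprS.
have h2 : `|r`!%:R| * `|s * esum_sym tau U r - r.+1%:R * esum_sym tau U r.+1| <=
    r%:R * N%:R ^+ r.
  rewrite ger0_norm// -/s; apply: le_trans (ler_wpM2l _ (esum_symS _ _)) _ => //.
  by rewrite mulrCA ler_wpM2l// fact_bin_le.
apply: le_trans (lerD h1 h2) _; rewrite -mulrDl ler_wpM2r ?exprn_ge0//.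
rewrite -natrD ler_nat; lia.
Qed.

End elementary_symmetric.

(** * Increasing tuples as subsets of size [p] *)

Section increasing_tuples.
Context {R : realType} {N p : nat}.

Definition index_set (a : incr_index N p) : {set 'I_N} := [set x in tval (val a)]%SET.

Let ltI := fun i j : 'I_N => (i < j)%N.

Let ltI_trans : transitive ltI. Proof. by move=> j i k; exact: ltn_trans. Qed.
Let ltI_irr : irreflexive ltI. Proof. by move=> i; exact: ltnn. Qed.

Lemma sorted_enum_set (A : {set 'I_N}) : sorted ltI (enum A).
Proof.
rewrite /enum_mem; apply: sorted_filter => //.
rewrite -enumT (_ : ltI = relpre val ltn)// -sorted_map val_enum_ord.
exact: iota_ltn_sorted.
Qed.

Lemma index_set_inj : injective index_set.
Proof.
move=> a b ab; apply/val_inj/val_inj => /=.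
apply: (irr_sorted_eq ltI_trans ltI_irr) => [||x].
- exact: valP a.
- exact: valP b.
- by have /setP/(_ x) := ab; rewrite !inE.
Qed.

Lemma uniq_index (a : incr_index N p) : uniq (tval (val a)).
Proof. exact: sorted_uniq ltI_trans ltI_irr _ (valP a). Qed.

Lemma card_index_set a : #|index_set a| = p.
Proof. by rewrite cardsE (card_uniqP (uniq_index a)) size_tuple. Qed.

Lemma index_set_surj (A : {set 'I_N}) : #|A| = p -> exists a, index_set a = A.
Proof.
move=> cA; have sA : size (enum A) == p by rewrite -cardE cA.
exists (exist _ (Tuple sA) (sorted_enum_set A)).
by apply/setP => x; rewrite !inE/= mem_enum.
Qed.

Lemma sum_incr_index (tau : 'I_N -> R) (P : pred {set 'I_N}) :
  \sum_(a : incr_index N p | P (index_set a)) \prod_(j < p) tau (tnth (val a) j) =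
  \sum_(A : {set 'I_N} | (#|A| == p) && P A) \prod_(x in A) tau x.
Proof.
have prodE (a : incr_index N p) :
    \prod_(j < p) tau (tnth (val a) j) = \prod_(x in index_set a) tau x.
  rewrite -(big_tuple _ _ (val a) xpredT tau)/= big_uniq ?uniq_index//.
  by apply: eq_bigl => x; rewrite inE.
under eq_bigr do rewrite prodE.
rewrite (reindex_omap index_set (fun A => [pick a | index_set a == A]))/=.
  apply: eq_bigl => a; rewrite card_index_set eqxx/=.
  case: pickP => [b /eqP/index_set_inj ->|/(_ a)]; last by rewrite eqxx.
  by rewrite eqxx andbT.
move=> A /andP[/eqP/index_set_surj[a aA] _].
case: pickP => [b /eqP <-//|/(_ a)].
by rewrite aA eqxx.
Qed.

End increasing_tuples.

(** * The cavity interpolation of the p-spin model *)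

Lemma sum_option (R : realType) (I : finType) (F : option I -> R) :
  \sum_o F o = F None + \sum_i F (Some i).
Proof.
rewrite (bigD1 None)//=; congr (_ + _).
rewrite (reindex_omap (Some : I -> option I) id)/=; last by case.
by apply: eq_bigl => i; rewrite eqxx.
Qed.

Lemma iid_fst {R : realType} (I : finType) d (T : measurableType d)
    (P : probability T R) (X : T -> I -> R) : iid_gauss P X ->
  iid_gauss (gauss_ext P) (fun w : T * measurableTypeR R => X w.1).
Proof.
move=> iidX; have [mX' X'E] := iid_extend iidX; split=> [i|B mB].
  exact: (mX' (Some i)).
pose B' (o : option I) : set R := if o is Some i then B i else setT.
have := X'E B'; rewrite (bigD1 None)//= [X in (X * _)%E]probability_setT mul1e.
rewrite (reindex_omap (Some : I -> option I) id)/=; last by case.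
rewrite (eq_bigl xpredT); last by move=> i; rewrite eqxx.
move=> <-; last by case=> [i|]; [exact: mB|exact: measurableT].
congr (gauss_ext P _); apply/seteqP; split => [w wB [i|]//|w wB i].
exact: (wB (Some i)).
Qed.

(* [nrep.+1] replicas suffice: differentiating a function of at most 4
   replicas twice brings in 2 more. *)
Definition nrep : nat := 7.

Definition flip_spin {N : nat} (i : 'I_N) (s : config N) : config N :=
  [ffun j => if j == i then ~~ s j else s j].

Definition ex {R : realType} {W : finType} (pr f : W -> R) : R :=
  \sum_w f w * pr w.

Lemma norm_tanh_le1 {R : realType} (y : R) : `|tanh y| <= 1.
Proof.
have e1 := expR_gt0 y; have e2 := expR_gt0 (- y).
rewrite /tanh normrM normfV [X in _ / X]gtr0_norm ?addr_gt0//.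
by rewrite ler_pdivrMr ?addr_gt0// mul1r ler_norml; apply/andP; split; lra.
Qed.

Lemma measurable_tanh_field {R : realType} p (beta h q : R) :
  measurable_fun [set: R] (fun y => tanh (local_field p beta h q y)).
Proof.
apply: continuous_measurable_fun => y.
have cf : {for y, continuous (local_field p beta h q)}.
  by apply: cvgD; [apply: cvgM; [exact: cvg_cst|exact: cvg_id]|exact: cvg_cst].
have ce : {for y, continuous (fun z => expR (local_field p beta h q z))}.
  by apply: continuous_comp => //; exact: continuous_expR.
have ce' : {for y, continuous (fun z => expR (- local_field p beta h q z))}.
  by apply: continuous_comp; [exact: continuousN|exact: continuous_expR].
apply: cvgM; first exact: cvgB.
apply: cvgV; last exact: cvgD.
by rewrite gt_eqF// addr_gt0// expR_gt0.
Qed.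

(** Expanding in indicators of the two values lets [av_indep] integrate out the other replicas. The
    result no longer mentions [m], so averages over 2 and over [nrep.+1] replicas can be
    identified. *)
Lemma av_pair {R : realType} {S : finType} {m : nat} (s0 : S) (H : S -> R)
    (F : S -> S -> R) (a b : 'I_m.+1) : a != b ->
  av H (fun w : {ffun 'I_m.+1 -> S} => F (w a) (w b)) =
  \sum_s \sum_t F s t * (weight H s * weight H t).
Proof.
move=> ab.
have pick1 (c : S -> R) (t : S) : \sum_s (t == s)%:R * c s = c t.
  rewrite (bigD1 t)//= eqxx mul1r big1 ?addr0// => s /negbTE st.
  by rewrite eq_sym st mul0r.
transitivity (av H (fun w : {ffun 'I_m.+1 -> S} =>
    \sum_s \sum_t F s t * ((w a == s)%:R * (w b == t)%:R))).
  apply: eq_av => w.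
  transitivity (\sum_s (w a == s)%:R * \sum_t (w b == t)%:R * F s t).
    by rewrite pick1 pick1.
  apply: eq_bigr => s _; rewrite mulr_sumr; apply: eq_bigr => t _; ring.
rewrite av_sum; apply: eq_bigr => s _; rewrite av_sum; apply: eq_bigr => t _.
rewrite avZ; congr (_ * _).
rewrite (av_indep s0 H (fun u => (u == t)%:R)); last first.
  by move=> w u; rewrite ffunE (negbTE ab).
rewrite (_ : av H _ = av H (fun w : {ffun 'I_m.+1 -> S} => 1 * (w a == s)%:R)); last first.
  by apply: eq_av => w; rewrite mul1r.
rewrite (av_indep s0 H (f := fun=> 1) (fun u => (u == s)%:R))//.
have -> : av H (fun _ : {ffun 'I_m.+1 -> S} => 1) = 1.
  by rewrite /av -[RHS](sum_gweight s0 (m := m) H); apply: eq_bigr => w _; rewrite mul1r.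
rewrite mul1r; congr (_ * _).
  by under eq_bigr do rewrite mulrC eq_sym; rewrite pick1.
by under eq_bigr do rewrite mulrC eq_sym; rewrite pick1.
Qed.

Section cavity.
Context {R : realType}.
Variables (p : nat) (beta h q : R).

Definition tanh_moment (n : nat) : R :=
  gauss_E (fun y => tanh (local_field p beta h q y) ^+ n).

Context {N : nat}.
Notation Omega := {ffun 'I_nrep.+1 -> config N}.

(* The covariance, up to scaling, of the interactions that contain [i]; it is
   [R_12^(p-1)] up to [O(1/N)]. *)
Definition cav_overlap (i : 'I_N) (s s' : config N) : R :=
  (p - 1)`!%:R / N%:R ^+ (p - 1) *
  esum_sym (fun x => spin s x * spin s' x) [set~ i]%SET (p - 1).

Definition cav_cov (i : 'I_N) (s s' : config N) : R :=
  beta ^+ 2 * (p%:R / 2) *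
  (spin s i * spin s' i * (cav_overlap i s s' - q ^+ (p - 1))).

Definition cav_kernel (n : nat) (i : 'I_N) (w : Omega) : R :=
  \sum_(l < nrep.+1) \sum_(l' < nrep.+1)
    kap n l * kap n.+1 l' * cav_cov i (w l) (w l').

(* [pr i t] is the law of [nrep.+1] replicas, averaged over the disorder, at
   time [t] of the interpolation at the site [i]; [prT] is that of the model. *)
Record cavity (pr : 'I_N -> R -> Omega -> R) (prT : Omega -> R) : Prop := Cavity {
  cav_ge0 : forall i t w, 0 <= pr i t w;
  cav_sum : forall i t, \sum_w pr i t w = 1;
  cav_perm : forall i t (sg : 'I_nrep.+1 -> 'I_nrep.+1) (w : Omega),
    injective sg ->
    pr i t [ffun j => w (sg j)] = pr i t w;
  cav_deriv : forall i (t : R) n (f : Omega -> R), (n < nrep)%N -> dep n f ->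
    is_derive t 1 (fun z => ex (pr i z) f)
      (sin t * cos t * ex (pr i t) (fun w => f w * cav_kernel n i w));
  cav_zero : forall i (f : Omega -> R) (r : seq 'I_nrep.+1), uniq r ->
    (forall l w, f (flip_at (flip_spin i) w l) = f w) ->
    ex (pr i 0) (fun w => f w * \prod_(l <- r) spin (w l) i) =
    tanh_moment (size r) * ex (pr i 0) f;
  cav_end : forall i, pr i (pi / 2) = prT }.

Section model.
Hypotheses (p2 : (2 <= p)%N) (q01 : 0 <= q <= 1) (pN : (p <= N)%N).
Context d (T : measurableType d) (P : probability T R).
Variable g : incr_index N p -> {RV P >-> R}.
Hypotheses (hgauss : forall a, is_std_gaussian (g a))
  (hindep : mutually_independent g).

Lemma iid_disorder : iid_gauss P (fun w a => g a w).
Proof.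
split=> [a|B mB]; first exact: measurable_funPT.
have := @hindep [set: incr_index N p]%SET B mB.
rewrite (_ : \bigcap_(i in _) _ = [set w | forall a, B a (g a w)]); last first.
  by apply/seteqP; split=> [w wB a|w wB a _]; [exact: (wB a (finset.in_setT a))|exact: wB].
move=> E; apply: (etrans E); rewrite big_mkcond/=; apply: eq_bigr => a _.
by rewrite finset.in_setT; exact: hgauss.
Qed.

Notation J := (option (incr_index N p)).

Definition disorder (w : T * measurableTypeR R) : J -> R :=
  extend (fun a => g a w.1) w.2.

(* [None] indexes the effective field at the site [i]. *)
Definition coef (i : 'I_N) (o : J) (s : config N) : R :=
  if o is Some a then beta * u_scale R N p * \prod_(j < p) spin s (tnth (val a) j)
  else beta * Num.sqrt (p%:R / 2) * q `^ ((p%:R - 1) / 2) * spin s i.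

Definition ampl (i : 'I_N) (o : J) (t : R) : R :=
  if o is Some a then if i \in index_set a then sin t else 1 else cos t.

Definition dampl (i : 'I_N) (o : J) (t : R) : R :=
  if o is Some a then if i \in index_set a then cos t else 0 else - sin t.

Definition mean_field (s : config N) : R := h * \sum_(j < N) spin s j.

Definition cav_prob (i : 'I_N) : R -> Omega -> R :=
  prob_at (gauss_ext P) disorder (ampl i) (coef i) mean_field.

Definition gibbs_prob (w : Omega) : R :=
  \int[P]_v gweight (fun s => - hamiltonian beta h (fun a => g a v) s) w.

Let s0 : config N := [ffun=> true].

Lemma iid_ext_disorder : iid_gauss (gauss_ext P) disorder.
Proof. exact: iid_extend iid_disorder. Qed.

Lemma is_derive_ampl i o (t : R) : is_derive t 1 (ampl i o) (dampl i o t).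
Proof.
rewrite /ampl /dampl; case: o => [a|]; last exact: is_derive_cos.
by case: (i \in index_set a); [exact: is_derive_sin|exact: is_derive_cst].
Qed.

Lemma norm_dampl i o t : `|dampl i o t| <= 1.
Proof.
case: o => [a|] /=; last by rewrite normrN ler_norml sin_geN1 sin_le1.
by case: ifP => _; rewrite ?normr0// ler_norml cos_geN1 cos_le1.
Qed.

(** A set of size [p] containing [i] is [i] together with [p - 1] other sites. The scaling comes
    from [u_N^2 = (p/2) (p-1)! / N^(p-1)], and the effective field has variance proportional to the
    square of [q^((p-1)/2)], that is [q^(p-1)]. *)
Lemma coef_cov i (s s' : config N) :
  \sum_(a | i \in index_set a) coef i (Some a) s * coef i (Some a) s' -
    coef i None s * coef i None s' = cav_cov i s s'.
Proof.
pose tau (x : 'I_N) : R := spin s x * spin s' x.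
have -> : \sum_(a | i \in index_set a) coef i (Some a) s * coef i (Some a) s' =
    beta ^+ 2 * u_scale R N p ^+ 2 *
    \sum_(a : incr_index N p | i \in index_set a) \prod_(j < p) tau (tnth (val a) j).
  rewrite mulr_sumr; apply: eq_bigr => a _; rewrite /= big_split/=; ring.
rewrite (sum_incr_index tau (fun A => i \in A)).
have -> : \sum_(A : {set 'I_N} | (#|A| == p) && (i \in A)) \prod_(x in A) tau x =
    tau i * esum_sym tau [set~ i]%SET (p - 1).
  rewrite /esum_sym mulr_sumr.
  rewrite (reindex_onto (fun A : {set 'I_N} => i |: A)%SET (fun B => B :\ i)%SET)/=; last first.
    by move=> B /andP[_ iB]; rewrite finset.setD1K.
  apply: eq_big => [A|A /andP[_ /eqP iA]].
    rewrite finset.setU11 andbT.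
    have -> : (A \subset [set~ i]%SET) = (i \notin A).
      apply/fintype.subsetP/idP => [Ai|iA x xA].
        by apply/negP => /Ai; rewrite !inE eqxx.
      by rewrite !inE; apply: contraNneq iA => <-.
    case: (boolP (i \in A)) => iA /=.
      apply/negbTE; rewrite negb_and; apply/orP; right.
      by apply/eqP => E; rewrite -E !inE eqxx in iA.
    rewrite cardsU1 iA finset.setU1K// eqxx andbT.
    by case: (p) p2 => // n _; rewrite subSS subn0 add1n eqSS.
  by rewrite (big_setU1)// -iA !inE eqxx.
have N0 : N%:R != 0 :> R by rewrite pnatr_eq0 -lt0n (leq_trans _ pN)// ltnW.
have uE : u_scale R N p ^+ 2 = p%:R / 2 * ((p - 1)`!%:R / N%:R ^+ (p - 1)).
  rewrite sqr_sqrtr; last by rewrite divr_ge0// mulr_ge0// exprn_ge0.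
  rewrite (_ : p`! = p * (p - 1)`!)%N; last by case: (p) p2 => // n _; rewrite subSS subn0 factS.
  by rewrite natrM; field; rewrite expf_neq0.
have qE : (q `^ ((p%:R - 1) / 2)) ^+ 2 = q ^+ (p - 1).
  have q0 : 0 <= q by case/andP: q01.
  rewrite -powR_mulrn ?powR_ge0// -powRrM divfK// -powR_mulrn// natrB//.
  exact: ltnW.
have sE : Num.sqrt (p%:R / 2) ^+ 2 = p%:R / 2 :> R by rewrite sqr_sqrtr// divr_ge0.
rewrite uE /coef /cav_cov /cav_overlap -/tau.
transitivity (beta ^+ 2 * (p%:R / 2) * (tau i * ((p - 1)`!%:R / N%:R ^+ (p - 1) * esum_sym tau [set~ i]%SET (p - 1))) -
   beta ^+ 2 * Num.sqrt (p%:R / 2) ^+ 2 * (q `^ ((p%:R - 1) / 2)) ^+ 2 * tau i).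
  by rewrite /tau; ring.
by rewrite qE sE /tau; ring.
Qed.

(** Interactions that avoid [i] have constant amplitude and drop out; the effective field enters
    with a minus sign because [cos' cos = - sin cos]. *)
Lemma Kn_cav_kernel n i t (w : Omega) :
  Kn (ampl i) (dampl i) (coef i) n t w = sin t * cos t * cav_kernel n i w.
Proof.
rewrite /Kn sum_option /= .
transitivity (\sum_(a | i \in index_set a) sin t * cos t *
    (dlt n (coef i (Some a)) w * dlt n.+1 (coef i (Some a)) w) -
    sin t * cos t * (dlt n (coef i None) w * dlt n.+1 (coef i None) w)).
  rewrite addrC [in RHS]big_mkcond; congr (_ + _); last by ring.
  by apply: eq_bigr => a _; case: ifP => _; ring.
rewrite -mulr_sumr -mulrBr; congr (_ * _).
have dd (c : config N -> R) : dlt n c w * dlt n.+1 c w =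
    \sum_(l < nrep.+1) \sum_(l' < nrep.+1) kap n l * kap n.+1 l' * (c (w l) * c (w l')).
  rewrite /dlt mulr_suml; apply: eq_bigr => l _; rewrite mulr_sumr.
  by apply: eq_bigr => l' _; ring.
under eq_bigr do rewrite dd; rewrite dd exchange_big -sumrB.
apply: eq_bigr => l _; rewrite exchange_big -sumrB; apply: eq_bigr => l' _.
by rewrite -mulr_sumr -mulrBr coef_cov.
Qed.

Lemma flip_spinK (i : 'I_N) : involutive (flip_spin i).
Proof. by move=> s; apply/ffunP => j; rewrite !ffunE; case: eqP => // _; rewrite negbK. Qed.

Lemma spin_flip (i : 'I_N) s : spin (flip_spin i s) i = - spin s i :> R.
Proof. by rewrite /spin ffunE eqxx; case: (s i); rewrite ?opprK. Qed.

Lemma spin_flip_neq (i j : 'I_N) s : j != i ->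
  spin (flip_spin i s) j = spin s j :> R.
Proof. by move=> /negbTE ji; rewrite /spin ffunE ji. Qed.

Lemma spin_sq (i : 'I_N) (s : config N) : spin s i ^+ 2 = 1 :> R.
Proof. by rewrite /spin; case: (s i); rewrite ?sqrrN expr1n. Qed.

Definition cavity_ham (i : 'I_N) (x : J -> R) (s : config N) : R :=
  \sum_(a | i \notin index_set a) coef i (Some a) s * x (Some a) +
  h * \sum_(j < N | j != i) spin s j.

Lemma cavity_ham_flip i x s : cavity_ham i x (flip_spin i s) = cavity_ham i x s.
Proof.
rewrite /cavity_ham; congr (_ + _ * _).
  apply: eq_bigr => a ia; congr (_ * _); rewrite /coef; congr (_ * _).
  apply: eq_bigr => j _; apply: spin_flip_neq.
  by apply: contraNneq ia => <-; rewrite inE mem_tnth.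
by apply: eq_bigr => j ji; exact: spin_flip_neq.
Qed.

Lemma ham0E i (x : J -> R) :
  ham (ampl i) (coef i) mean_field 0 x =
  field (fun s => spin s i) (cavity_ham i x) (local_field p beta h q (x None)).
Proof.
apply/funext => s; rewrite /ham /field sum_option /= cos0 /cavity_ham /mean_field.
rewrite (bigID (fun a => i \in index_set a))/= big1 ?add0r; last first.
  by move=> a ->; rewrite sin0 !mul0r.
rewrite [\sum_j spin s j](bigD1 i)//= /local_field.
rewrite (eq_bigr (fun a => coef i (Some a) s * x (Some a))); last first.
  by move=> a /negbTE ->; rewrite mul1r.
rewrite /coef; ring.
Qed.

Lemma hamT i (x : J -> R) :
  ham (ampl i) (coef i) mean_field (pi / 2) x =
  fun s => - hamiltonian beta h (fun a => x (Some a)) s.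
Proof.
apply/funext => s; rewrite /ham sum_option /= cos_pihalf mul0r mul0r add0r.
rewrite /hamiltonian opprK /mean_field mulr_sumr; congr (_ + _).
apply: eq_bigr => a _; rewrite sin_pihalf if_same /coef; ring.
Qed.

(** Seen as an interpolation with constant amplitudes, the model inherits the measurability and
    integrability results proved for [ham]. *)
Lemma ham_disorder (i : 'I_N) (x : incr_index N p -> R) :
  (fun s => - hamiltonian beta h x s) =
  ham (fun _ _ => 1) (fun a => coef i (Some a)) mean_field 0 x.
Proof.
apply/funext => s.
rewrite /hamiltonian opprK /ham /mean_field mulr_sumr; congr (_ + _).
by apply: eq_bigr => a _; rewrite /coef; ring.
Qed.

(** The extra Gaussian has amplitude [cos (pi/2) = 0], and the remaining coordinates have the same
    law on the extended space as on the original one. *)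
Lemma cav_prob_end i : cav_prob i (pi / 2) = gibbs_prob.
Proof.
apply/funext => w; rewrite /cav_prob /prob_at /gibbs_prob.
under eq_Rintegral do rewrite hamT.
pose F (x : vecT (incr_index N p)) : R := gweight (fun s => - hamiltonian beta h x s) w.
have mF : measurable_fun [set: vecT (incr_index N p)] F.
  rewrite (_ : F = fun x => gweight (ham (fun _ _ => 1)
    (fun a => coef i (Some a)) mean_field 0 x) w); first exact: measurable_gweight.
  by apply/funext => x; rewrite /F (ham_disorder i).
have F1 x : `|F x| <= 1 by rewrite ger0_norm ?gweight_ge0// gweight_le1.
have i1 := @iid_bounded_integrable R _ _ _ (gauss_ext P) _ (iid_fst iid_disorder) F 1 mF F1.
have i2 := @iid_bounded_integrable R _ _ _ P _ iid_disorder F 1 mF F1.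
exact: (iid_integral (iid_fst iid_disorder) iid_disorder mF i1 i2).
Qed.

Lemma ex_cav_prob i t f : ex (cav_prob i t) f =
  \int[gauss_ext P]_v av (ham (ampl i) (coef i) mean_field t (disorder v)) f.
Proof. exact: (nutE s0 iid_ext_disorder). Qed.

(** Resample the effective field: the average of [f] does not feel it, and each spin at [i]
    contributes a factor [tanh] of it, so the double integral splits into a product. *)
Lemma cav_prob_zero i (f : Omega -> R) (r : seq 'I_nrep.+1) : uniq r ->
  (forall l w, f (flip_at (flip_spin i) w l) = f w) ->
  ex (cav_prob i 0) (fun w => f w * \prod_(l <- r) spin (w l) i) =
  tanh_moment (size r) * ex (cav_prob i 0) f.
Proof.
move=> ur finv; rewrite !ex_cav_prob.
pose Y (x : J -> R) := local_field p beta h q (x None).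
pose b (x : J -> R) := av (cavity_ham i x) f.
have avb x : av (ham (ampl i) (coef i) mean_field 0 x) f = b x.
  rewrite ham0E; apply: (av_field_cst s0 (flip_spinK i)) => //.
  - exact: spin_flip.
  - by move=> s; exact: spin_sq.
  - exact: cavity_ham_flip.
have avab x : av (ham (ampl i) (coef i) mean_field 0 x)
    (fun w => f w * \prod_(l <- r) spin (w l) i) = tanh (Y x) ^+ size r * b x.
  rewrite -avb ham0E; apply: (av_flips (flip_spinK i)) => //.
  - exact: spin_flip.
  - by move=> s; exact: spin_sq.
  - exact: cavity_ham_flip.
pose F x := av (ham (ampl i) (coef i) mean_field 0 x)
  (fun w => f w * \prod_(l <- r) spin (w l) i).
have mF : measurable_fun [set: vecT J] F by exact: measurable_av.
have mB : measurable_fun [set: vecT J] (fun x => av (ham (ampl i) (coef i) mean_field 0 x) f).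
  exact: measurable_av.
have F1 x : `|F x| <= \sum_w `|f w * \prod_(l <- r) spin (w l) i| by exact: av_norm_le.
have i1 := @iid_bounded_integrable R _ _ _ (gauss_ext P) _ iid_ext_disorder F _ mF F1.
have iid2 := iid_upd iid_ext_disorder (None : J).
have i2 := @iid_bounded_integrable R _ _ _ _ _ iid2 F _ mF F1.
have tm : measurable_fun [set: R] (fun y => tanh (local_field p beta h q y) ^+ size r).
  apply: measurable_funX; exact: measurable_tanh_field.
have ti : (normal_prob 0 1).-integrable [set: R]
    (EFin \o (fun y => tanh (local_field p beta h q y) ^+ size r)).
  apply: (@bounded_integrable _ _ _ _ _ 1) => // y.
  by rewrite normrX exprn_ile1// norm_tanh_le1.
have bupd x y : b (upd x (None : J) y) = b x.
  by rewrite /b; congr av.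
have Fupd x y : F (upd x (None : J) y) = tanh (local_field p beta h q y) ^+ size r * b x.
  by rewrite /F avab bupd /Y /upd eqxx.
have i3 x : (normal_prob 0 1).-integrable setT (fun y => (F (upd x (None : J) y))%:E).
  rewrite (_ : (fun y => _) = fun y => ((b x)%:E * (tanh (local_field p beta h q y) ^+ size r)%:E)%E).
    exact: integrableZl.
  by apply/funext => y; rewrite Fupd mulrC.
rewrite [LHS](iid_resample iid_ext_disorder mF i1 i2 i3).
have bi := @iid_bounded_integrable R _ _ _ (gauss_ext P) _ iid_ext_disorder _ _ mB (fun x => av_norm_le s0 _ _).
have tE : tanh_moment (size r) =
    \int[normal_prob 0 1]_y (tanh (local_field p beta h q y) ^+ size r).
  by rewrite /tanh_moment /gauss_E unlock.
rewrite tE -[RHS](RintegralZl _ measurableT bi); apply: eq_Rintegral => v _.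
rewrite [RHS](congr1 _ (avb _)) -[RHS](RintegralZr (b (disorder v)) measurableT ti).
by apply: eq_Rintegral => y _; exact: Fupd.
Qed.

Lemma model_cavity : cavity cav_prob gibbs_prob.
Proof.
split.
- move=> i t w; apply: Rintegral_ge0 => v _; exact: gweight_ge0.
- move=> i t; have := ex_cav_prob i t (fun=> 1).
  rewrite /ex (eq_bigr (cav_prob i t)) => [->|w _]; last by rewrite mul1r.
  under eq_Rintegral do rewrite /av (eq_bigr _ (fun w _ => mul1r _)) sum_gweight//.
  rewrite Rintegral_cst// mul1r.
  exact: (congr1 fine (probability_setT (gauss_ext P))).
- move=> i t sg w inj; rewrite /cav_prob /prob_at.
  by apply: eq_Rintegral => v _; rewrite gweight_perm.
- move=> i t n f nm fn.
  have := is_derive_nut s0 iid_ext_disorder (coef i) mean_field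
    (is_derive_ampl i) (norm_dampl i) t nm fn.
  apply: is_derive_eqf => //.
  rewrite /ex mulr_sumr; apply: eq_bigr => w _.
  by rewrite Kn_cav_kernel /cav_prob; ring.
- exact: cav_prob_zero.
- exact: cav_prob_end.
Qed.

Lemma gibbsE (x : incr_index N p -> R) (f : {ffun 'I_2 -> config N} -> R) :
  gibbs beta h x f = av (fun s => - hamiltonian beta h x s) f.
Proof.
rewrite /gibbs mulr_sumr; apply: eq_bigr => w _.
rewrite mulrCA; congr (_ * _).
rewrite /gweight /weight prodf_div -expR_sum -sumrN prodr_const card_ord mulrC.
by [].
Qed.

Lemma nu_gibbs_prob (F : config N -> config N -> R) :
  nu beta h g (fun s : {ffun 'I_2 -> config N} => F (s ord0) (s ord_max)) =
  (ex gibbs_prob (fun w => F (w ord0) (w (inord 1))))%:E.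
Proof.
pose i := Ordinal (leq_trans (ltnW p2) pN).
pose f (w : Omega) := F (w ord0) (w (inord 1)).
pose H x := ham (fun _ _ => 1) (fun a => coef i (Some a)) mean_field 0 x.
have E : ex gibbs_prob f = \int[P]_v av (H (fun a => g a v)) f.
  rewrite -(nutE s0 iid_disorder); apply: eq_bigr => w _; congr (_ * _).
  by rewrite /gibbs_prob; under eq_Rintegral do rewrite (ham_disorder i).
have fi := av_integrable s0 iid_disorder (fun _ _ => 1) (fun a => coef i (Some a))
  mean_field 0 f.
rewrite E /Rintegral fineK; last exact: integrable_fin_num.
rewrite /nu unlock; apply: eq_integral => v _; congr EFin.
rewrite gibbsE (ham_disorder i) -/(H _) /f (av_pair s0)//.
rewrite (av_pair s0) => //.
by apply/eqP => /(congr1 val); rewrite /= inordK.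
Qed.

End model.

End cavity.

(** * Elementary inequalities for powers *)

Section power_inequalities.
Context {R : realType}.
Implicit Types (x y a b : R) (n r : nat).

Lemma norm_expr_sub x y r B : `|x| <= B -> `|y| <= B ->
  `|x ^+ r.+1 - y ^+ r.+1| <= r.+1%:R * B ^+ r * `|x - y|.
Proof.
move=> xB yB; have B0 : 0 <= B := le_trans (normr_ge0 _) xB.
elim: r => [|r IH]; first by rewrite !expr1 mulr1 mul1r.
have -> : x ^+ r.+2 - y ^+ r.+2 =
  x * (x ^+ r.+1 - y ^+ r.+1) + y ^+ r.+1 * (x - y) by rewrite !exprS; ring.
apply: le_trans (ler_normD _ _) _; rewrite !normrM normrX.
have h1 := ler_pM (normr_ge0 _) (normr_ge0 _) xB IH.
have h2 : `|y| ^+ r.+1 * `|x - y| <= B ^+ r.+1 * `|x - y|.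
  by rewrite ler_wpM2r// lerXn2r// nnegrE.
apply: le_trans (lerD h1 h2) _.
by rewrite -[in leRHS]natr1 exprS le_eqVlt; apply/orP; left; apply/eqP; ring.
Qed.

Lemma norm_expr_taylor x y r : `|x| <= 1 -> `|y| <= 1 ->
  `|x ^+ r - y ^+ r - r%:R * y ^+ r.-1 * (x - y)| <= (r ^ 2)%:R * (x - y) ^+ 2.
Proof.
move=> x1 y1; elim: r => [|r IH].
  by rewrite !expr0 subrr !mul0r subr0 normr0.
have -> : x ^+ r.+1 - y ^+ r.+1 - r.+1%:R * y ^+ r * (x - y) =
   x * (x ^+ r - y ^+ r - r%:R * y ^+ r.-1 * (x - y)) +
   r%:R * y ^+ r.-1 * (x - y) ^+ 2.
  by rewrite -natr1 !exprS; case: r {IH} => [|r] /=; rewrite ?expr0 ?exprS; ring.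
apply: le_trans (ler_normD _ _) _.
have h1 : `|x * (x ^+ r - y ^+ r - r%:R * y ^+ r.-1 * (x - y))| <= (r ^ 2)%:R * (x - y) ^+ 2.
  by rewrite normrM -[leRHS]mul1r ler_pM.
have h2 : `|r%:R * y ^+ r.-1 * (x - y) ^+ 2| <= r%:R * (x - y) ^+ 2.
  rewrite normrM [X in _ * X]ger0_norm ?sqr_ge0// ler_wpM2r ?sqr_ge0//.
  by rewrite normrM ger0_norm// ler_piMr// normrX exprn_ile1.
apply: le_trans (lerD h1 h2) _; rewrite -mulrDl ler_wpM2r ?sqr_ge0//.
rewrite -natrD ler_nat; lia.
Qed.

(** Young's inequality. The inductive step multiplies by [b] and adds [(n+1) a^n (a - b)^2 >= 0]. *)
Lemma young_power a b n : 0 <= a -> 0 <= b ->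
  n.+1%:R * (a ^+ n * b) <= n%:R * a ^+ n.+1 + b ^+ n.+1.
Proof.
move=> a0 b0; elim: n => [|n IH]; first by rewrite mul1r !mul0r add0r mul1r expr1.
have h := ler_wpM2l b0 IH.
have h2 : 0 <= n.+1%:R * (a ^+ n * (a - b) ^+ 2).
  by rewrite mulr_ge0// mulr_ge0 ?sqr_ge0// exprn_ge0.
rewrite [b ^+ n.+2]exprS -subr_ge0.
move: h; rewrite -subr_ge0 => h.
apply: le_trans (addr_ge0 h h2) _.
rewrite le_eqVlt; apply/orP; left; apply/eqP.
by rewrite -!natr1 !exprS; ring.
Qed.

(** With [x] of size [D] and [y] of size [D^2], the terms quadratic in [y] have size [D^(m+2)]. The
    bound [B] on [D] gives [|x + y| <= (1 + B) D]. *)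
Lemma norm_taylor_second m (B : R) : 0 <= B -> exists2 C, 0 <= C &
  forall x y D, 0 <= D <= B -> `|x| <= D -> `|y| <= D ^+ 2 ->
  `|(x + y) ^+ m - x ^+ m - m%:R * (y * x ^+ m.-1)| <= C * D ^+ m.+2.
Proof.
move=> B0; elim: m => [|m [C C0 IH]].
  by exists 0 => // x y D _ _ _; rewrite !expr0 subrr !mul0r subr0 normr0.
exists ((1 + B) * C + m%:R) => [|x y D DB xD yD].
  by rewrite addr_ge0// mulr_ge0// addr_ge0.
have D0 : 0 <= D by case/andP: DB.
have -> : (x + y) ^+ m.+1 - x ^+ m.+1 - m.+1%:R * (y * x ^+ m) =
   (x + y) * ((x + y) ^+ m - x ^+ m - m%:R * (y * x ^+ m.-1)) +
   m%:R * (y ^+ 2 * x ^+ m.-1).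
  by rewrite -natr1 !exprS; case: m {IH} => [|m] /=; rewrite ?expr0 ?exprS; ring.
apply: le_trans (ler_normD _ _) _; rewrite [leRHS]mulrDl lerD//.
  rewrite normrM exprS -mulrA [leRHS](_ : _ = ((1 + B) * D) * (C * D ^+ m.+2)); last by ring.
  rewrite ler_pM// ?(IH x y D)//; apply: le_trans (ler_normD _ _) _.
  apply: le_trans (lerD xD yD) _; rewrite [leRHS]mulrDl mul1r lerD2l expr2.
  by rewrite ler_wpM2r//; case/andP: DB.
case: m {IH} => [|m] /=; first by rewrite !mul0r normr0.
rewrite normrM ger0_norm// ler_wpM2l// normrM !normrX.
rewrite (_ : m.+4 = (2 * 2 + m)%N)// exprD exprM ler_pM ?exprn_ge0//.
  by rewrite lerXn2r// nnegrE ?exprn_ge0.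
by rewrite lerXn2r// nnegrE.
Qed.

End power_inequalities.

(** * The mean value theorem in the variable [sin^2 t] *)

Section mean_value.
Context {R : realType}.
Variables (phi psi : R -> R).
Hypothesis phi_d : forall t : R, is_derive t 1 phi (sin t * cos t * psi t).

Lemma is_derive_sin2 (c t : R) :
  is_derive t 1 (fun z => c * sin z ^+ 2) (c * 2 * (sin t * cos t)).
Proof.
have D := is_deriveZ (f := fun z => sin z ^+ 2) c (is_deriveX (f := @sin R) 2 (is_derive_sin t)).
apply: (is_derive_eqf _ _ D) => //.
rewrite /GRing.scale/= expr1; ring.
Qed.

(** Rolle's theorem for [phi] minus the multiple of [sin^2] that equalizes the end values; inside
    the interval [sin t cos t] is nonzero and can be divided out. *)
Lemma cavity_mvt (t1 : R) : 0 < t1 <= pi / 2 ->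
  exists2 xi, 0 < xi < t1 & phi t1 - phi 0 = sin t1 ^+ 2 / 2 * psi xi.
Proof.
move=> /andP[t0 t1p].
have s1 : 0 < sin t1.
  apply: sin_gt0_pi; rewrite t0/=; apply: le_lt_trans t1p _.
  by have := pi_gt0 R; lra.
pose Dl := (phi t1 - phi 0) / sin t1 ^+ 2.
pose G t := phi t - Dl * sin t ^+ 2.
have Gd (t : R) : is_derive t 1 G (sin t * cos t * psi t - Dl * 2 * (sin t * cos t)).
  have D := is_deriveB (phi_d t) (is_derive_sin2 Dl t).
  exact: (is_derive_eqf _ _ D).
have Gc : {within `[0, t1], continuous G}.
  apply: derivable_within_continuous => t _.
  exact: (@ex_derive _ _ _ _ _ _ _ (Gd t)).
have G01 : G 0 = G t1.
  rewrite /G sin0 expr0n mulr0 subr0 /Dl divfK ?expf_neq0 ?gt_eqF//; ring.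
have [xi xi01 [xid xiE]] := Rolle t0 (fun t _ => @ex_derive _ _ _ _ _ _ _ (Gd t)) Gc G01.
exists xi; first by move: xi01; rewrite in_itv.
have := @derive_val _ _ _ _ _ _ _ (Gd xi); rewrite xiE => E.
move: xi01; rewrite in_itv/= => /andP[x0 x1].
have sx : 0 < sin xi by apply: sin_gt0_pi; rewrite x0/=; have := pi_gt0 R; lra.
have cx : 0 < cos xi by apply: cos_gt0_pihalf; have := pi_gt0 R; lra.
have : sin xi * cos xi * (psi xi - Dl * 2) = 0 by rewrite [RHS]E; ring.
move=> /eqP; rewrite !mulf_eq0 (gt_eqF sx) (gt_eqF cx) /= subr_eq0 => /eqP ->.
by rewrite /Dl; field; rewrite gt_eqF.
Qed.

End mean_value.

(** * Expectations under a law on a finite set *)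

Section expectation.
Context {R : realType} {W : finType}.
Implicit Types (pr f g : W -> R).

Lemma eq_ex pr f g : f =1 g -> ex pr f = ex pr g.
Proof. by move=> fg; apply: eq_bigr => w _; rewrite fg. Qed.

Lemma exD pr f g : ex pr (fun w => f w + g w) = ex pr f + ex pr g.
Proof. by rewrite /ex -big_split; apply: eq_bigr => w _; rewrite mulrDl. Qed.

Lemma exZ pr c f : ex pr (fun w => c * f w) = c * ex pr f.
Proof. by rewrite /ex mulr_sumr; apply: eq_bigr => w _; rewrite mulrA. Qed.

Lemma exB pr f g : ex pr (fun w => f w - g w) = ex pr f - ex pr g.
Proof. by rewrite /ex -sumrB; apply: eq_bigr => w _; rewrite mulrBl. Qed.

Lemma ex_sum pr (J : Type) (r : seq J) (P : pred J) (F : J -> W -> R) :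
  ex pr (fun w => \sum_(j <- r | P j) F j w) = \sum_(j <- r | P j) ex pr (F j).
Proof. by rewrite /ex exchange_big; apply: eq_bigr => w _; rewrite mulr_suml. Qed.

Lemma ex_le pr f g : (forall w, 0 <= pr w) -> (forall w, f w <= g w) ->
  ex pr f <= ex pr g.
Proof. by move=> pr0 fg; apply: ler_sum => w _; rewrite ler_wpM2r. Qed.

Lemma ex_ge0 pr f : (forall w, 0 <= pr w) -> (forall w, 0 <= f w) -> 0 <= ex pr f.
Proof. by move=> pr0 f0; apply: sumr_ge0 => w _; rewrite mulr_ge0. Qed.

Lemma ex_norm pr f : (forall w, 0 <= pr w) -> `|ex pr f| <= ex pr (fun w => `|f w|).
Proof.
move=> pr0; apply: le_trans (ler_norm_sum _ _ _) _; apply: ler_sum => w _.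
by rewrite normrM (ger0_norm (pr0 _)).
Qed.

Lemma ex_cst pr c : \sum_w pr w = 1 -> ex pr (fun=> c) = c.
Proof. by move=> pr1; rewrite /ex -mulr_sumr pr1 mulr1. Qed.

End expectation.

(** * Overlaps with one site removed *)

Section overlaps.
Context {R : realType} {N : nat}.
Hypothesis N0 : (0 < N)%N.
Implicit Types (s t : config N) (i : 'I_N).

(** Blind to the spins at [i], yet still normalized by [N] and not [N - 1], so that it differs from
    the overlap by a single explicit term. *)
Definition ovl_cavity i s t : R := overlap s t - N%:R^-1 * (spin s i * spin t i).

Lemma ovl_cavityE i s t : ovl_cavity i s t =
  N%:R^-1 * \sum_(j in [set~ i]%SET) spin s j * spin t j.
Proof.
rewrite /ovl_cavity /overlap (bigD1 i)//= mulrDr addrAC subrr add0r; congr (_ * _).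
by apply: eq_bigl => j; rewrite !inE.
Qed.

Lemma tau_sq s t i : (spin s i * spin t i) ^+ 2 = 1 :> R.
Proof. by rewrite exprMn !spin_sq mulr1. Qed.

Lemma norm_tau1 s t i : `|spin s i * spin t i| = 1 :> R.
Proof. exact: (norm_tau (tau_sq s t)). Qed.

Lemma N_gt0 : 0 < N%:R :> R. Proof. by rewrite ltr0n. Qed.

Lemma norm_invN : `|N%:R^-1| = N%:R^-1 :> R.
Proof. by rewrite ger0_norm// invr_ge0. Qed.

Lemma norm_overlap s t : `|overlap s t : R| <= 1.
Proof.
rewrite /overlap normrM norm_invN ler_pdivrMl ?N_gt0// mulr1.
apply: le_trans (ler_norm_sum _ _ _) _.
by rewrite (eq_bigr (fun=> 1)) ?sumr_const ?card_ord// => i _; exact: norm_tau1.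
Qed.

Lemma norm_ovl_cavity i s t : `|ovl_cavity i s t| <= 1.
Proof.
rewrite ovl_cavityE normrM norm_invN ler_pdivrMl ?N_gt0// mulr1.
apply: le_trans (ler_norm_sum _ _ _) _.
rewrite (eq_bigr (fun=> 1)); last by move=> j _; exact: norm_tau1.
by rewrite sumr_const ler_nat -[leqRHS]card_ord max_card.
Qed.

Lemma norm_cav_overlap p i s t : `|cav_overlap p i s t : R| <= 1.
Proof.
rewrite /cav_overlap mulrAC normrM normfV [X in _ / X]ger0_norm ?exprn_ge0//.
rewrite ler_pdivrMr ?exprn_gt0 ?N_gt0// mul1r normrM ger0_norm//.
by apply: norm_esum_sym (tau_sq s t) _ _ _ _; rewrite -[leqRHS]card_ord max_card.
Qed.

Lemma cav_overlap_power p i s t : (2 <= p)%N ->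
  `|cav_overlap p i s t - ovl_cavity i s t ^+ (p - 1)| <= ((p - 1) ^ 2)%:R * N%:R^-1 :> R.
Proof.
move=> p2; have Np := exprn_gt0 (p - 1) N_gt0.
rewrite ovl_cavityE exprMn exprVn /cav_overlap mulrAC [_^-1 * _]mulrC -mulrBl.
rewrite normrM (ger0_norm (x := (_ ^+ _)^-1)) ?invr_ge0 ?exprn_ge0//.
rewrite ler_pdivrMr// distrC.
have := esum_sym_power (tau_sq s t) (U := [set~ i]%SET) (p - 1) (N := N) _.
rewrite -[X in (_ <= X)%N]card_ord max_card => /(_ isT) /le_trans; apply.
rewrite -mulrA ler_wpM2l//.
case: p p2 {Np} => [//|[//|r]] _; rewrite !subSS !subn0 exprS mulKf//.
by rewrite gt_eqF// N_gt0.
Qed.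

Lemma overlap_flip i s t :
  ovl_cavity i (flip_spin i s) t = ovl_cavity i s t.
Proof.
rewrite !ovl_cavityE; congr (_ * _); apply: eq_bigr => j; rewrite !inE => ji.
by rewrite spin_flip_neq.
Qed.

Lemma ovl_cavityC i s t : ovl_cavity i s t = ovl_cavity i t s.
Proof. by rewrite !ovl_cavityE; congr (_ * _); apply: eq_bigr => j _; rewrite mulrC. Qed.

Lemma overlap_flipr i s t :
  ovl_cavity i s (flip_spin i t) = ovl_cavity i s t.
Proof. by rewrite ovl_cavityC overlap_flip ovl_cavityC. Qed.

Lemma cav_overlap_flip p i s t :
  cav_overlap p i (flip_spin i s) t = cav_overlap p i s t :> R.
Proof.
rewrite /cav_overlap; congr (_ * _); apply: eq_bigr => A /andP[AU _].
apply: eq_bigr => j jA; rewrite spin_flip_neq//.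
by have := fintype.subsetP AU _ jA; rewrite !inE.
Qed.

Lemma cav_overlapC p i s t : cav_overlap p i s t = cav_overlap p i t s :> R.
Proof.
by rewrite /cav_overlap; congr (_ * _); apply: eq_bigr => A _; apply: eq_bigr => j _; rewrite mulrC.
Qed.

Lemma cav_overlap_flipr p i s t :
  cav_overlap p i s (flip_spin i t) = cav_overlap p i s t :> R.
Proof. by rewrite cav_overlapC cav_overlap_flip cav_overlapC. Qed.

Lemma cav_overlap_diag p i s t : cav_overlap p i s s = cav_overlap p i t t :> R.
Proof.
rewrite /cav_overlap; congr (_ * _); apply: eq_bigr => A _; apply: eq_bigr => j _.
by rewrite -!expr2 !spin_sq.
Qed.

End overlaps.

(** * Renaming replicas *)

Section renaming.
Variable m : nat.

Lemma exists_renaming (s : seq 'I_m.+1) : uniq s ->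
  exists2 sg : 'I_m.+1 -> 'I_m.+1, injective sg &
    forall j, (j < size s)%N -> sg (inord j) = nth ord0 s j.
Proof.
move=> us; pose L := s ++ [seq x <- enum 'I_m.+1 | x \notin s].
have uL : uniq L.
  rewrite cat_uniq us filter_uniq ?enum_uniq// andbT/=.
  by apply/hasPn => x; rewrite mem_filter => /andP[].
have sL : size L = m.+1.
  rewrite -[RHS](size_enum_ord) -(perm_size (uniq_perm uL (enum_uniq _) _))// => x.
  by rewrite mem_cat mem_filter mem_enum andbT; case: (x \in s).
exists (fun j => nth ord0 L j) => [i j /eqP|j js].
  by rewrite nth_uniq ?sL// => /eqP/val_inj.
have jm : (j < m.+1)%N by rewrite -sL size_cat ltn_addr.
by rewrite inordK// nth_cat js.
Qed.

End renaming.

(** * The family of all cavity laws, and the kernel of the derivative *)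

Section instances.
Context {R : realType}.
Variables (p : nat) (beta h q : R).

(** Everything that varies once [p], [beta], [h] and [q] are fixed. A constant uniform over this
    type depends neither on [N], nor on the probability space, nor on the site. *)
Record instance := Instance {
  iN : nat; ile : (p <= iN)%N;
  ipr : 'I_iN -> R -> {ffun 'I_nrep.+1 -> config iN} -> R;
  iprT : {ffun 'I_nrep.+1 -> config iN} -> R;
  icav : cavity p beta h q ipr iprT;
  isite : 'I_iN }.

Hypotheses (p2 : (2 <= p)%N) (q01 : 0 <= q <= 1).

Section one_instance.
Variable I : instance.
Notation N := (iN I).
Notation i := (isite I).
Notation Omega := {ffun 'I_nrep.+1 -> config N}.
Implicit Types (w : Omega) (f : Omega -> R) (a b l : 'I_nrep.+1).

Definition dl : R := (Num.sqrt N%:R)^-1.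
Definition E0 f : R := ex (ipr i 0) f.
Definition Et (t : R) f : R := ex (ipr i t) f.
Definition ET f : R := ex (@iprT I) f.
(** [Xr] is the centred overlap of the model; [Xm] and [Qm] below are its counterparts without the
    site, to which the factorization at time 0 applies. *)
Definition Xr a b w : R := overlap (w a) (w b) - q.
Definition ep a b w : R := spin (w a) i * spin (w b) i.
Definition Xm a b w : R := ovl_cavity i (w a) (w b) - q.
Definition Qm a b w : R := cav_overlap p i (w a) (w b) - q ^+ (p - 1).
Definition b0 : R := beta ^+ 2 * (p%:R / 2).

Lemma iN_gt0 : (0 < N)%N. Proof. by apply: leq_trans (ile I); exact: ltnW. Qed.

Lemma dl_gt0 : 0 < dl.
Proof. by rewrite invr_gt0 sqrtr_gt0 ltr0n iN_gt0. Qed.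

Lemma dl_sq : dl ^+ 2 = N%:R^-1.
Proof. by rewrite exprVn sqr_sqrtr. Qed.

Lemma dl_le1 : dl <= 1.
Proof.
rewrite invf_le1 ?sqrtr_gt0 ?ltr0n ?iN_gt0// -[leLHS]sqrtr1 ler_wsqrtr//.
by rewrite ler1n iN_gt0.
Qed.

Lemma XmE a b w : Xm a b w = Xr a b w - dl ^+ 2 * ep a b w.
Proof. by rewrite /Xm /ovl_cavity /Xr dl_sq /ep; ring. Qed.

Lemma norm_ep a b w : `|ep a b w| = 1.
Proof. exact: norm_tau1. Qed.

Lemma norm_Xr a b w : `|Xr a b w| <= 2.
Proof.
apply: le_trans (ler_normB _ _) _; have /andP[q0 q1] := q01.
have := norm_overlap (R := R) iN_gt0 (w a) (w b); rewrite (ger0_norm q0); lra.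
Qed.

Lemma norm_Xm a b w : `|Xm a b w| <= 2.
Proof.
apply: le_trans (ler_normB _ _) _; have /andP[q0 q1] := q01.
have := norm_ovl_cavity (R := R) iN_gt0 i (w a) (w b); rewrite (ger0_norm q0); lra.
Qed.

Lemma norm_epq a b w : `|ep a b w - q| <= 2.
Proof.
apply: le_trans (ler_normB _ _) _; have /andP[q0 q1] := q01.
rewrite norm_ep (ger0_norm q0); lra.
Qed.

Lemma norm_qX n : `|q ^+ n| <= 1.
Proof.
have /andP[q0 q1] := q01.
by rewrite ger0_norm ?exprn_ge0// exprn_ile1.
Qed.

Lemma norm_q : `|q| <= 1. Proof. exact: norm_qX 1. Qed.

Lemma norm_Qm2 a b w : `|Qm a b w| <= 2.
Proof.
apply: le_trans (ler_normB _ _) _.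
have := norm_cav_overlap (R := R) iN_gt0 p i (w a) (w b).
by have := norm_qX (p - 1); lra.
Qed.

Lemma norm_Qm_power a b w :
  `|Qm a b w - (ovl_cavity i (w a) (w b) ^+ (p - 1) - q ^+ (p - 1))| <=
   ((p - 1) ^ 2)%:R * dl ^+ 2.
Proof.
rewrite dl_sq /Qm (_ : _ - _ - _ = cav_overlap p i (w a) (w b) - ovl_cavity i (w a) (w b) ^+ (p - 1)); last by ring.
by apply: cav_overlap_power => //; exact: iN_gt0.
Qed.

Lemma norm_Qm a b w :
  `|Qm a b w| <= (p - 1)%:R * `|Xm a b w| + ((p - 1) ^ 2)%:R * dl ^+ 2.
Proof.
have h1 := norm_Qm_power a b w.
have [r pr] : exists r, (p - 1 = r.+1)%N.
  by exists (p - 2)%N; move: p2; lia.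
have h2 := norm_expr_sub r (norm_ovl_cavity (R := R) iN_gt0 i (w a) (w b)) norm_q.
rewrite expr1n mulr1 -pr in h2.
rewrite -(subrK (ovl_cavity i (w a) (w b) ^+ (p - 1) - q ^+ (p - 1)) (Qm a b w)) addrC.
apply: le_trans (ler_normD _ _) _; exact: lerD.
Qed.

Lemma norm_Qm_taylor a b w :
  `|Qm a b w - (p - 1)%:R * q ^+ (p - 2) * Xm a b w| <=
  ((p - 1) ^ 2)%:R * (Xm a b w ^+ 2 + dl ^+ 2).
Proof.
have h1 := norm_Qm_power a b w.
have h2 := norm_expr_taylor (p - 1) (norm_ovl_cavity (R := R) iN_gt0 i (w a) (w b)) norm_q.
rewrite (_ : (p - 1).-1 = p - 2)%N in h2; last by lia.
rewrite -(subrK (ovl_cavity i (w a) (w b) ^+ (p - 1) - q ^+ (p - 1)) (Qm a b w)).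
rewrite -addrA [leRHS]mulrDr [leRHS]addrC; apply: le_trans (ler_normD _ _) _.
exact: lerD.
Qed.

Lemma kernelE n w : cav_kernel p beta q n i w =
  \sum_(l < nrep.+1) \sum_(l' < nrep.+1)
    kap n l * kap n.+1 l' * (b0 * (ep l l' w * Qm l l' w)).
Proof. by []. Qed.

(** Spins square to 1, so the self-overlap is the same for all replicas and the diagonal terms are
    proportional to the sum of [kap n l * kap n.+1 l], which is [n - n = 0]. Only differences of
    genuine overlaps with [q] remain, and these are small. *)
Lemma kernel_offdiag n w : (n < nrep)%N -> cav_kernel p beta q n i w =
  \sum_(l < nrep.+1) \sum_(l' < nrep.+1 | l' != l)
    kap n l * kap n.+1 l' * (b0 * (ep l l' w * Qm l l' w)).
Proof.
move=> nm; rewrite kernelE.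
rewrite (eq_bigr (fun l => kap n l * kap n.+1 l * (b0 * (ep l l w * Qm l l w)) +
  \sum_(l' < nrep.+1 | l' != l) kap n l * kap n.+1 l' *
     (b0 * (ep l l' w * Qm l l' w)))); last by move=> l _; rewrite (bigD1 l).
rewrite big_split/= [X in X + _](_ : _ = 0) ?add0r//.
pose c := b0 * Qm ord0 ord0 w.
rewrite (eq_bigr (fun l : 'I_nrep.+1 => c * (kap n l * kap n.+1 l))); last first.
  move=> l _; rewrite /ep -expr2 spin_sq mul1r /c /Qm.
  by rewrite (cav_overlap_diag _ _ (w l) (w ord0)); ring.
rewrite -mulr_sumr (sum_kap (kap n.+1))//; last exact: ltnW.
rewrite big1 ?mulr0// => l ln; rewrite /kap ltnS (ltnW ln) ltnS leqnn subrr//.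
Qed.

Lemma ipr_ge0 t w : 0 <= ipr i t w. Proof. exact: cav_ge0 (icav I) _ _ _. Qed.
Lemma iprT_E j : ipr j (pi / 2) = @iprT I. Proof. exact: cav_end (icav I) _. Qed.
Lemma Et_pihalf f : Et (pi / 2) f = ET f. Proof. by rewrite /Et iprT_E. Qed.
Lemma iprT_ge0 w : 0 <= @iprT I w. Proof. by rewrite -(iprT_E i); exact: ipr_ge0. Qed.

Lemma Et_cst t c : Et t (fun=> c) = c.
Proof. by apply: ex_cst; exact: cav_sum (icav I) _ _. Qed.

Lemma Et_norm t f : `|Et t f| <= Et t (fun w => `|f w|).
Proof. by apply: ex_norm; exact: ipr_ge0. Qed.

Lemma Et_le t f g : (forall w, f w <= g w) -> Et t f <= Et t g.
Proof. by move=> fg; apply: ex_le fg; exact: ipr_ge0. Qed.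

Lemma Et_rename t f (s : seq 'I_nrep.+1) : uniq s -> exists2 sg,
  forall j, (j < size s)%N -> sg (inord j) = nth ord0 s j &
  Et t f = Et t (fun w => f [ffun j => w (sg j)]).
Proof.
move=> /exists_renaming[sg sg_inj sgE]; exists sg => //.
rewrite /Et /ex.
have rinj : injective (fun w => [ffun j => w (sg j)] : Omega).
  have [sg' K K'] := injF_bij sg_inj.
  move=> w w' /ffunP E; apply/ffunP => j.
  by have := E (sg' j); rewrite !ffunE K'.
rewrite (reindex_inj rinj)/=; apply: eq_bigr => w _.
by rewrite (cav_perm (icav I) _ _ _ sg_inj).
Qed.

Lemma Et_pair t (F : config N -> config N -> R) a b : a != b ->
  Et t (fun w => F (w a) (w b)) = Et t (fun w => F (w ord0) (w (inord 1))).
Proof.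
move=> ab; have us : uniq [:: a; b] by rewrite /= inE ab.
have [sg sgE ->] := Et_rename t (fun w => F (w ord0) (w (inord 1))) us.
apply: eq_ex => w; rewrite !ffunE (sgE 1%N)// -[ord0](inord_val)  (sgE 0%N)//.
Qed.

Lemma Et_deriv n f (t : R) : (n < nrep)%N -> dep n f ->
  is_derive t 1 (fun z => Et z f)
    (sin t * cos t * Et t (fun w => f w * cav_kernel p beta q n i w)).
Proof. exact: cav_deriv (icav I) _ _ _ _. Qed.

Lemma Et_mvt n f t1 : (n < nrep)%N -> dep n f -> 0 < t1 <= pi / 2 ->
  exists2 xi, 0 < xi < t1 &
  Et t1 f - E0 f = sin t1 ^+ 2 / 2 * Et xi (fun w => f w * cav_kernel p beta q n i w).
Proof. by move=> nm fn; exact: (cavity_mvt (fun t => Et_deriv t nm fn)). Qed.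

End one_instance.

End instances.

(** * The contraction estimate for even moments *)

Lemma expr_add_le {R : realType} (a b : R) n : 0 <= a -> 0 <= b ->
  (a + b) ^+ n <= 2 ^+ n * (a ^+ n + b ^+ n).
Proof.
wlog ab : a b / a <= b => [H a0 b0|a0 b0].
  by case: (leP a b) => ab; [exact: H|rewrite addrC [X in _ * X]addrC; apply: H; rewrite // ltW].
have h : (a + b) ^+ n <= (2 * b) ^+ n.
  by rewrite lerXn2r ?nnegrE ?addr_ge0 ?mulr_ge0// mulr2n mulrDl mul1r lerD2r.
by apply: le_trans h _; rewrite exprMn ler_wpM2l ?exprn_ge0// lerDr exprn_ge0.
Qed.

Section moments.
Context {R : realType}.
Variables (p : nat) (beta h q : R).
Hypotheses (p2 : (2 <= p)%N) (q01 : 0 <= q <= 1).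
Hypothesis m2 : tanh_moment p beta h q 2 = q.
Notation instance := (instance p beta h q).
Notation bb := (b0 p beta).

(* [20] is the sum of the absolute weights of the pairs of replicas in the
   derivative of a function of two replicas, and [expR (24 * bb)] is the cost
   of returning from time [t] to the model. *)
Definition contraction_rate : R := 20 * bb * (p - 1)%:R * expR (24 * bb).

Lemma b0_ge0 : 0 <= bb.
Proof. by rewrite /b0 mulr_ge0 ?sqr_ge0// divr_ge0. Qed.

Section one_instance.
Variable I : instance.
Notation N := (iN I).
Notation i := (isite I).
Notation Omega := {ffun 'I_nrep.+1 -> config N}.
Implicit Types (w : Omega) (f : Omega -> R) (a b l : 'I_nrep.+1).

Lemma Xm_flip a b w l : Xm a b (flip_at (flip_spin i) w l) = Xm a b w.
Proof.
rewrite /Xm !ffunE; congr (_ - _).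
by case: eqP => [->|_]; case: eqP => [->|_]; rewrite ?overlap_flip ?overlap_flipr.
Qed.

Lemma Qm_flip a b w l : Qm a b (flip_at (flip_spin i) w l) = Qm a b w.
Proof.
rewrite /Qm !ffunE; congr (_ - _).
by case: eqP => [->|_]; case: eqP => [->|_]; rewrite ?cav_overlap_flip ?cav_overlap_flipr.
Qed.

Lemma E0_factor (r : seq 'I_nrep.+1) f : uniq r ->
  (forall l w, f (flip_at (flip_spin i) w l) = f w) ->
  E0 (I := I) (fun w => f w * \prod_(l <- r) spin (w l) i) =
  tanh_moment p beta h q (size r) * E0 f.
Proof. by move=> ur finv; exact: (cav_zero (icav I)). Qed.

Lemma sum_norm_kap n : (n <= nrep)%N -> \sum_(l < nrep.+1) `|kap n l : R| = 2 * n%:R.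
Proof.
move=> nm; have nm1 : (n < nrep.+1)%N by [].
rewrite (bigID (fun l : 'I_nrep.+1 => (l < n)%N))/= mulr2n mulrDl mul1r; congr (_ + _).
  rewrite (eq_bigr (fun=> 1)); last by move=> l ln; rewrite /kap ln normr1.
  by rewrite (big_ord_narrow (leqW nm)) sumr_const card_ord.
rewrite (bigD1 (Ordinal nm1)) /= ?ltnn// /kap ltnn eqxx normrN normr_nat big1 ?addr0// => l.
move=> /andP[ln lneq]; rewrite (negbTE ln) ifF ?normr0//.
by apply/eqP => E; move/eqP: lneq; apply; exact/val_inj.
Qed.

(** All ordered pairs have total absolute weight [4 * 6 = 24], and the diagonal ones [1 + 1 + 2]. *)
Lemma sum_kap_offdiag :
  \sum_(l < nrep.+1) \sum_(l' < nrep.+1 | l' != l) `|kap 2 l * kap 3 l' : R| = 20.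
Proof.
have E (l : 'I_nrep.+1) : \sum_(l' < nrep.+1 | l' != l) `|kap 2 l * kap 3 l' : R| =
    `|kap 2 l| * (6 - `|kap 3 l|).
  have := sum_norm_kap (isT : (3 <= nrep)%N); rewrite (bigD1 l)//= => E.
  rewrite (eq_bigr (fun l' : 'I_nrep.+1 => `|kap 2 l : R| * `|kap 3 l' : R|)); last by move=> l' _; rewrite normrM.
  rewrite -mulr_sumr; congr (_ * _); move: E; set z := \sum_(i < _ | _) _; lra.
rewrite (eq_bigr _ (fun l _ => E l)) !big_ord_recl big_ord0 /kap /=.
by rewrite !(normr1, normrN, normr0, normr_nat); ring.
Qed.

Lemma E0_ep a b f : a != b ->
  (forall l w, f (flip_at (flip_spin i) w l) = f w) ->
  E0 (I := I) (fun w => (ep a b w - q) * f w) = 0.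
Proof.
move=> ab finv; have us : uniq [:: a; b] by rewrite /= inE ab.
have := E0_factor us finv; rewrite m2 => E.
rewrite (_ : E0 _ = E0 (I := I) (fun w => f w * \prod_(l <- [:: a; b]) spin (w l) i) - q * E0 f).
  by rewrite E subrr.
rewrite -exZ -exB; apply: eq_ex => w.
by rewrite !big_cons big_nil mulr1 /ep; ring.
Qed.

Lemma dep_pair n a b (F : config N -> config N -> R) : (a < n)%N -> (b < n)%N ->
  dep n (fun w : Omega => F (w a) (w b)).
Proof. by move=> an bn w w' ww'; rewrite !ww'. Qed.

Lemma norm_kernel n w : (n < nrep)%N ->
  `|cav_kernel p beta q n i w| <= 8 * n%:R * n.+1%:R * bb.
Proof.
move=> nm; rewrite kernelE.
apply: le_trans (ler_norm_sum _ _ _) _.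
rewrite (_ : 8 * n%:R * n.+1%:R * bb = \sum_(l < nrep.+1) `|kap n l : R| *
   ((\sum_(l' < nrep.+1) `|kap n.+1 l' : R|) * (bb * 2))); last first.
  rewrite -mulr_suml (sum_norm_kap (ltnW nm)) (sum_norm_kap nm).
  by move: (n%:R) (n.+1%:R) (bb) => x y z; ring.
apply: ler_sum => l _; apply: le_trans (ler_norm_sum _ _ _) _.
rewrite mulr_suml mulr_sumr; apply: ler_sum => l' _.
rewrite normrM (normrM (kap n l)) [leRHS]mulrA ler_wpM2l ?mulr_ge0//.
rewrite normrM (ger0_norm b0_ge0).
rewrite ler_wpM2l ?b0_ge0// normrM -[X in X * _]/`|ep l l' w| norm_ep mul1r.
exact: norm_Qm2.
Qed.

(** For two replicas the kernel is at least [- 48 bb]. The factor [exp (24 bb sin^2 t)], whose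
    logarithm has derivative [48 bb sin t cos t], therefore turns the expectation into a
    nondecreasing function of time. *)
Lemma gronwall f t : dep 2 f -> (forall w, 0 <= f w) -> 0 <= t <= pi / 2 ->
  Et t f <= expR (24 * bb) * ET f.
Proof.
move=> f2 f0 t01.
pose psi z := Et z f * expR (24 * bb * sin z ^+ 2).
pose dpsi z := expR (24 * bb * sin z ^+ 2) * (sin z * cos z) *
   (Et z (fun w => f w * cav_kernel p beta q 2 i w) + 48 * bb * Et z f).
have psid (z : R) : is_derive z 1 psi (dpsi z).
  have D1 := Et_deriv z (isT : (2 < nrep)%N) f2.
  have D2 := is_derive1_comp (is_derive_expR _) (is_derive_sin2 (24 * bb) z).
  have D := is_deriveM D1 D2.
  apply: (is_derive_eqf _ _ D) => //.
  by rewrite /GRing.scale/= /dpsi; ring.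
have psi_c : {within `[0, pi / 2], continuous psi}.
  apply: derivable_within_continuous => z _.
  exact: (@ex_derive _ _ _ _ _ _ _ (psid z)).
have dpsi0 z : z \in `]0, (pi / 2)[ -> 0 <= psi^`()%classic z.
  rewrite in_itv/= => /andP[z0 z1].
  rewrite derive1E (@derive_val _ _ _ _ _ _ _ (psid z)) /dpsi.
  rewrite !mulr_ge0 ?expR_ge0//.
  - by apply/ltW/sin_gt0_pi; rewrite z0/=; have := pi_gt0 R; lra.
  - by apply/ltW/cos_gt0_pihalf; have := pi_gt0 R; lra.
  rewrite /Et -exZ -exD; apply: ex_ge0 => [w|w]; first exact: ipr_ge0.
  have := norm_kernel w (isT : (2 < nrep)%N); rewrite ler_norml => /andP[+ _].
  rewrite (_ : 8 * 2%:R * 3%:R * bb = 48 * bb); last by ring.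
  by have := f0 w; nra.
have pd z : z \in `]0, (pi / 2)[ -> derivable psi z 1.
  by move=> _; exact: (@ex_derive _ _ _ _ _ _ _ (psid z)).
have pi20 : 0 <= pi / 2 :> R by have := pi_gt0 R; lra.
have H : psi t <= psi (pi / 2).
  apply: (ger0_derive1_le_cc pd dpsi0 psi_c); rewrite ?in_itv/= ?t01 ?pi20 ?lexx//.
  by case/andP: t01.
move: H; rewrite /psi sin_pihalf expr1n mulr1 Et_pihalf => H.
rewrite mulrC; apply: le_trans H.
rewrite ler_peMr//; first by apply: ex_ge0 => //; exact: ipr_ge0.
by rewrite -[leLHS]expR0 ler_expR mulr_ge0 ?sqr_ge0// mulr_ge0 ?b0_ge0.
Qed.

End one_instance.

(** Another site means another interpolation that ends at the same model law, which permits
    averaging one-site estimates over the sites. *)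
Definition with_site (I : instance) (j : 'I_(iN I)) : instance :=
  Instance (ile I) (icav I) j.

(** The product of [eps_0 eps_1 - q] with an odd power of the overlap without the site has mean 0 at
    time 0, so only its derivative counts. There each pair of replicas is controlled, through
    Young's inequality, by the moment of order [2k+2] itself, with total factor [contraction_rate].
    Exchanging the overlaps with and without the site costs [1/N] times lower moments. *)
Lemma site_bound k : exists C, forall I : instance,
  `|ET (I := I) (fun w => (ep ord0 (inord 1) w - q) * Xr ord0 (inord 1) w ^+ (2 * k).+1)| <=
  contraction_rate * ET (I := I) (fun w => Xr ord0 (inord 1) w ^+ (2 * k.+1)) +
  C * (dl I ^+ 2 * ET (I := I) (fun w => Xr ord0 (inord 1) w ^+ (2 * k) + dl I ^+ (2 * k))).
Proof.
(* [c1] and [c2] are the costs of replacing [x] with [xm] in the powers [2k+1] and [2k+2];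
   [4^k = 2^(2k)] comes from the power of a sum of two terms, and 3 bounds [B] below. *)
pose c1 : R := (2 * k).+1%:R * 4 ^+ k.
pose c2 : R := (2 * k.+1)%:R * (3 * 4 ^+ k).
pose C := 20 * bb * (p - 1)%:R * expR (24 * bb) * c2 +
    20 * bb * ((p - 1) ^ 2)%:R * (2 * (expR (24 * bb) * 4 ^+ k)) + 2 * c1.
exists C => I; set i := isite I; pose x := @Xr R p beta h q I ord0 (inord 1).
pose G w := x w ^+ (2 * k) + dl I ^+ (2 * k).
have d0 := dl_gt0 p2 I; have d1 := dl_le1 p2 I.
set r1 : 'I_nrep.+1 := inord 1.
pose xm := Xm (I := I) ord0 r1; pose e := ep (I := I) ord0 r1.
have ne w : `|e w| = 1 := norm_ep _ _ _.
pose B w := `|x w| + dl I ^+ 2.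
have d2 : 0 <= dl I ^+ 2 by exact: sqr_ge0.
have d2d : dl I ^+ 2 <= dl I by rewrite expr2 ler_piMr// ltW.
have d21 : dl I ^+ 2 <= 1 by rewrite exprn_ile1// ltW.
have xB w : `|x w| <= B w by rewrite lerDl.
have xmE w : xm w = x w - dl I ^+ 2 * e w by exact: XmE.
have dxm w : `|x w - xm w| = dl I ^+ 2.
  by rewrite xmE opprB addrC subrK normrM ne mulr1 ger0_norm.
have xmB w : `|xm w| <= B w.
  rewrite xmE; apply: le_trans (ler_normB _ _) _.
  by rewrite normrM ne mulr1 (ger0_norm d2).
have B3 w : B w <= 3 by have := norm_Xr p2 q01 ord0 r1 w; rewrite /B /x; lra.
have B0 w : 0 <= B w by rewrite addr_ge0.
have G0 w : 0 <= G w by rewrite /G !exprM addr_ge0// exprn_ge0// sqr_ge0.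
have BG w : B w ^+ (2 * k) <= 4 ^+ k * G w.
  apply: le_trans (expr_add_le _ _ _) _ => //.
  rewrite [2 ^+ _]exprM (_ : 2 ^+ 2 = 4); last by ring.
  rewrite ler_wpM2l ?exprn_ge0// /G lerD//.
    by rewrite !exprM real_normK ?num_real.
  by rewrite lerXn2r ?nnegrE// ltW.
have P1 w : `|x w ^+ (2 * k).+1 - xm w ^+ (2 * k).+1| <= c1 * (dl I ^+ 2 * G w).
  apply: le_trans (norm_expr_sub _ (xB w) (xmB w)) _; rewrite dxm /c1.
  rewrite -[leRHS]mulrA [X in _ <= _ * X]mulrCA [X in _ <= _ * X]mulrC [leRHS]mulrA ler_wpM2r// ler_wpM2l//.
have P2 w : `|xm w ^+ (2 * k.+1) - x w ^+ (2 * k.+1)| <= c2 * (dl I ^+ 2 * G w).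
  rewrite mulnS distrC; apply: le_trans (norm_expr_sub _ (xB w) (xmB w)) _.
  rewrite dxm /c2 mulnS -!mulrA ler_wpM2l// exprS mulrA mulrC [leRHS](_ : _ =
    dl I ^+ 2 * (3 * (4 ^+ k * G w))); last by ring.
  by rewrite ler_wpM2l// ler_pM// exprn_ge0.
have P3 w : xm w ^+ (2 * k) <= 4 ^+ k * G w.
  apply: le_trans (BG w).
  by rewrite [leLHS]exprM -real_normK ?num_real// -exprM lerXn2r// nnegrE.
pose f w := (e w - q) * xm w ^+ (2 * k).+1.
have f2 : dep 2 f.
  apply: (@dep_pair I 2 ord0 r1 (fun s t => (spin s i * spin t i - q) *
    (ovl_cavity i s t - q) ^+ (2 * k).+1)) => //.
  by rewrite /r1 inordK.
have r01 : ord0 != r1 by apply/eqP => /(congr1 val); rewrite /= /r1 inordK.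
have E0f : E0 f = 0.
  by apply: E0_ep => // l w; rewrite /xm Xm_flip.
have [|xi xi01] := Et_mvt (isT : (2 < nrep)%N) f2 (t1 := pi / 2).
  by rewrite lexx andbT divr_gt0// pi_gt0.
rewrite E0f subr0 sin_pihalf expr1n Et_pihalf mul1r => ETf.
have xi0 : 0 <= xi <= pi / 2 by case/andP: xi01 => /ltW -> /ltW ->.
pose A := (p - 1)%:R * Et xi (fun w => xm w ^+ (2 * k.+1)) +
  ((p - 1) ^ 2)%:R * (2 * (dl I ^+ 2 * Et xi (fun w => xm w ^+ (2 * k)))).
have even_pow (y : R) n : `|y| ^+ (2 * n) = y ^+ (2 * n).
  by rewrite !exprM real_normK ?num_real.
have term l l' : l' != l ->
  Et xi (fun w => `|xm w| ^+ (2 * k).+1 * `|Qm (I := I) l l' w|) <= A.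
  move=> ll.
  have step : Et xi (fun w => `|xm w| ^+ (2 * k).+1 * `|Qm (I := I) l l' w|) <=
    (p - 1)%:R * Et xi (fun w => `|xm w| ^+ (2 * k).+1 * `|Xm (I := I) l l' w|) +
    ((p - 1) ^ 2)%:R * (dl I ^+ 2 * Et xi (fun w => `|xm w| ^+ (2 * k).+1)).
    rewrite /Et -!exZ -exD; apply: ex_le => [w|w]; first exact: ipr_ge0.
    have := ler_wpM2l (exprn_ge0 (2 * k).+1 (normr_ge0 (xm w))) (norm_Qm p2 q01 (I := I) l l' w).
    by move=> /le_trans; apply; rewrite le_eqVlt; apply/orP; left; apply/eqP; ring.
  apply: le_trans step _; apply: lerD; apply: ler_wpM2l => //.
    (* The mixed moment is bounded by the pure moments of the two pairs of replicas, which coincide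
       by symmetry among replicas. *)
    have y w := young_power (2 * k).+1 (normr_ge0 (xm w)) (normr_ge0 (Xm (I := I) l l' w)).
    have := ex_le (ipr_ge0 xi) y; rewrite exZ exD exZ.
    have -> : ex (ipr (isite I) xi) (fun w => `|xm w| ^+ (2 * k).+2) = Et xi (fun w => xm w ^+ (2 * k.+1)).
      by apply: eq_ex => w; rewrite -even_pow mulnS.
    have -> : ex (ipr (isite I) xi) (fun w => `|Xm (I := I) l l' w| ^+ (2 * k).+2) =
        Et xi (fun w => xm w ^+ (2 * k.+1)).
      rewrite -(Et_pair xi (fun s t => (ovl_cavity i s t - q) ^+ (2 * k.+1)) (a := l) (b := l')).
        by apply: eq_ex => w; rewrite -even_pow mulnS.
      by rewrite eq_sym.
    rewrite -[X in _ <= _ + X]mul1r -mulrDl natr1 ler_pM2l//.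
  rewrite mulrCA ler_wpM2l// -exZ; apply: ex_le => [w|w]; first exact: ipr_ge0.
  rewrite exprS even_pow ler_wpM2r ?norm_Xm//.
  by rewrite -even_pow exprn_ge0.
have Ex0 n : 0 <= Et xi (fun w => xm w ^+ (2 * n)).
  by apply: ex_ge0 => [w|w]; [exact: ipr_ge0|rewrite -even_pow exprn_ge0].
have A0 : 0 <= A by rewrite addr_ge0 ?(mulr_ge0 _ (mulr_ge0 _ (mulr_ge0 _ _)))// mulr_ge0.
(* The weights sum to 20, [|eps eps - q| <= 2] gives 40, and the factor [1/2] of the mean value
   theorem restores 20. *)
have first : `|ET f| <= 20 * bb * A.
  rewrite ETf normrM ger0_norm ?invr_ge0//.
  suff H : `|Et xi (fun w => f w * cav_kernel p beta q 2 (isite I) w)| <= 40 * bb * A.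
    by apply: le_trans (ler_wpM2l _ H) _; rewrite ?invr_ge0//; lra.
  apply: le_trans (Et_norm _ _) _.
  apply: (@le_trans _ _ (Et xi (fun w => \sum_(l < nrep.+1) \sum_(l' < nrep.+1 | l' != l)
     `|kap 2 l * kap 3 l'| * (bb * 2 * (`|xm w| ^+ (2 * k).+1 * `|Qm (I := I) l l' w|))))).
    apply: ex_le => [w|w]; first exact: ipr_ge0.
    rewrite kernel_offdiag// normrM.
    apply: le_trans (ler_wpM2l (normr_ge0 _) (ler_norm_sum _ _ _)) _.
    rewrite mulr_sumr; apply: ler_sum => l _.
    apply: le_trans (ler_wpM2l (normr_ge0 _) (ler_norm_sum _ _ _)) _.
    rewrite mulr_sumr; apply: ler_sum => l' _.
    rewrite /f normrM normrX normrM mulrCA ler_wpM2l//.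
    rewrite normrM (ger0_norm b0_ge0) mulrCA -[leRHS]mulrA ler_wpM2l ?b0_ge0//.
    rewrite (normrM (ep l l' w)) norm_ep mul1r -mulrA ler_wpM2r ?mulr_ge0 ?exprn_ge0//.
    exact: norm_epq.
  rewrite /Et ex_sum.
  have -> : 40 * bb * A = \sum_(l < nrep.+1) \sum_(l' < nrep.+1 | l' != l)
      `|kap 2 l * kap 3 l' : R| * (bb * 2 * A).
    transitivity (20 * (bb * 2 * A)); first by ring.
    rewrite -sum_kap_offdiag mulr_suml; apply: eq_bigr => l _.
    by rewrite mulr_suml.
  apply: ler_sum => l _; rewrite ex_sum; apply: ler_sum => l' ll.
  by rewrite exZ ler_wpM2l// exZ ler_wpM2l ?(mulr_ge0 b0_ge0)//; exact: term.
have grw n : Et xi (fun w => xm w ^+ (2 * n)) <=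
    expR (24 * bb) * ET (fun w => xm w ^+ (2 * n)).
  apply: gronwall => //; last by move=> w; rewrite -even_pow exprn_ge0.
  apply: (@dep_pair I 2 ord0 r1 (fun s t => (ovl_cavity i s t - q) ^+ (2 * n))) => //.
  by rewrite /r1 inordK.
have g1 : ET (fun w => xm w ^+ (2 * k.+1)) <=
    ET (fun w => x w ^+ (2 * k.+1)) + c2 * (dl I ^+ 2 * ET G).
  rewrite /ET -!exZ -exD; apply: ex_le => [w|w]; first exact: iprT_ge0.
  by rewrite -lerBlDl; apply: le_trans (P2 w); exact: ler_norm.
have g2 : ET (fun w => xm w ^+ (2 * k)) <= 4 ^+ k * ET G.
  by rewrite /ET -exZ; apply: ex_le => [w|w]; [exact: iprT_ge0|exact: P3].
have second : `|ET (fun w => (e w - q) * x w ^+ (2 * k).+1) - ET f| <=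
    2 * c1 * (dl I ^+ 2 * ET G).
  rewrite /ET -exB -!exZ; apply: le_trans (ex_norm _ _) _; first exact: iprT_ge0.
  apply: ex_le => [w|w]; first exact: iprT_ge0.
  rewrite /f -mulrBr normrM -[leRHS]mulrA ler_pM// ?norm_epq//.
have E24 : 0 <= expR (24 * bb) by exact: expR_ge0.
have b00 := b0_ge0.
have A1 : A <= expR (24 * bb) * ((p - 1)%:R * (ET (fun w => x w ^+ (2 * k.+1)) + c2 * (dl I ^+ 2 * ET G)) +
  ((p - 1) ^ 2)%:R * (2 * (4 ^+ k * (dl I ^+ 2 * ET G)))).
  rewrite [leRHS]mulrDr; apply: lerD.
    rewrite [leRHS]mulrCA ler_wpM2l//; apply: le_trans (grw _) _.
    by rewrite ler_wpM2l.
  rewrite [leRHS]mulrCA ler_wpM2l// [leRHS]mulrCA ler_wpM2l// [leLHS]mulrC.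
  apply: le_trans (ler_wpM2r d2 (grw _)) _; rewrite -mulrA ler_wpM2l//.
  by rewrite [leRHS]mulrCA [leLHS]mulrC ler_wpM2l.
have A2 := ler_wpM2l (_ : 0 <= 20 * bb) A1.
rewrite -[ET _](subrK (ET f)); apply: le_trans (ler_normD _ _) _.
apply: le_trans (lerD second (le_trans first (A2 _))) _.
  by rewrite mulr_ge0.
by rewrite /C /contraction_rate le_eqVlt; apply/orP; left; apply/eqP; ring.
Qed.

(* By symmetry among sites [R_ab] is the average over the sites of
   [eps_a eps_b]. *)
Lemma avg_site (I : instance) a b (f : {ffun 'I_nrep.+1 -> config (iN I)} -> R) A B :
  (forall j, `|ET (I := with_site j) (fun w => (ep (I := with_site j) a b w - q) * f w) - A| <= B) ->
  `|ET (I := I) (fun w => Xr a b w * f w) - A| <= B.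
Proof.
move=> HB; have N0 := N_gt0 (R := R) (iN_gt0 p2 I).
have E : ET (I := I) (fun w => Xr a b w * f w) - A =
   (iN I)%:R^-1 * \sum_(j < iN I)
     (ET (I := with_site j) (fun w => (ep (I := with_site j) a b w - q) * f w) - A).
  rewrite sumrB sumr_const card_ord mulrBr -[X in _ = _ - _ * X]mulr_natl mulKf ?gt_eqF//.
  congr (_ - _).
  have -> : \sum_(j < iN I) ET (I := with_site j) (fun w => (ep (I := with_site j) a b w - q) * f w) =
    ex (@iprT _ _ _ _ _ I) (fun w => \sum_(j < iN I) (ep (I := with_site j) a b w - q) * f w).
    by rewrite ex_sum.
  rewrite -exZ; apply: eq_ex => w.
  rewrite -mulr_suml mulrA; congr (_ * _); rewrite sumrB sumr_const card_ord mulrBr.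
  by rewrite -[X in _ = _ - _ * X]mulr_natl mulKf ?gt_eqF.
rewrite E normrM norm_invN ler_pdivrMl// mulr_natl.
apply: le_trans (ler_norm_sum _ _ _) _.
rewrite -[X in _ <= _ *+ X]card_ord -sumr_const; exact: ler_sum.
Qed.

End moments.

(** * Moments of the overlap and a common scale for all pairs *)

Lemma sum_expr_le {R : realType} (J : Type) (r : seq J) (y : J -> R) (d : R) m :
  0 <= d -> (forall j, 0 <= y j) ->
  (d + \sum_(j <- r) y j) ^+ m <=
  (2 ^+ m) ^+ size r * (d ^+ m + \sum_(j <- r) y j ^+ m).
Proof.
move=> d0 y0; elim: r => [|j r IH]; first by rewrite !big_nil !addr0 expr0 mul1r.
rewrite !big_cons addrCA.
have s0 : 0 <= d + \sum_(j <- r) y j by rewrite addr_ge0// sumr_ge0.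
apply: le_trans (expr_add_le m (y0 j) s0) _.
rewrite /= exprS -mulrA ler_wpM2l ?exprn_ge0// addrCA [leRHS]mulrDr lerD//.
by rewrite ler_peMl ?exprn_ge0// exprn_ege1// exprn_ege1// ler1n.
Qed.

Section asymptotics.
Context {R : realType}.
Variables (p : nat) (beta h q : R).
Hypotheses (p2 : (2 <= p)%N) (q01 : 0 <= q <= 1).
Hypothesis m2 : tanh_moment p beta h q 2 = q.
Hypothesis contr : contraction_rate p beta < 1.
Notation instance := (instance p beta h q).
Notation bb := (b0 p beta).
Notation r0 := (ord0 : 'I_nrep.+1).
Notation r1 := (inord 1 : 'I_nrep.+1).

(** Averaged over sites, the one-site bound contains the moment on both sides; [contr] allows it to
    be absorbed on the left, and what remains is [1/N] times the previous order. *)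
Lemma moment_bound k : exists C, forall I : instance,
  ET (I := I) (fun w => Xr r0 r1 w ^+ (2 * k)) <= C * dl I ^+ (2 * k).
Proof.
elim: k => [|k [Ck IH]].
  exists 1 => I; rewrite mulr1 (_ : ET _ = 1)// -(Et_cst I (pi / 2) 1) -Et_pihalf.
  by apply: eq_ex => w; rewrite expr0.
have [C HC] := site_bound p2 q01 m2 k.
have th : 0 < 1 - contraction_rate p beta by rewrite subr_gt0.
(* [C] comes without a sign, hence the absolute value. *)
exists (`|C| * (Ck + 1) / (1 - contraction_rate p beta)) => I.
set M := ET _.
have M0 : 0 <= M.
  by apply: ex_ge0 => w; [exact: iprT_ge0|rewrite exprM exprn_ge0 ?sqr_ge0].
have d2 : 0 <= dl I ^+ 2 by exact: sqr_ge0.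
have EG : ET (I := I) (fun w => Xr r0 r1 w ^+ (2 * k) + dl I ^+ (2 * k)) <=
    (Ck + 1) * dl I ^+ (2 * k).
  have -> : ET (I := I) (fun w => Xr r0 r1 w ^+ (2 * k) + dl I ^+ (2 * k)) =
     ET (I := I) (fun w => Xr r0 r1 w ^+ (2 * k)) + dl I ^+ (2 * k).
    rewrite [LHS]exD; congr (_ + _).
    by rewrite -[RHS](Et_cst I (pi / 2)) Et_pihalf.
  by rewrite mulrDl mul1r lerD2r.
have EG0 : 0 <= ET (I := I) (fun w => Xr r0 r1 w ^+ (2 * k) + dl I ^+ (2 * k)).
  apply: ex_ge0 => w; first exact: iprT_ge0.
  by rewrite !exprM addr_ge0// exprn_ge0// sqr_ge0.
have step : `|ET (I := I) (fun w => Xr r0 r1 w * Xr r0 r1 w ^+ (2 * k).+1) - 0| <=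
    contraction_rate p beta * M + C * (dl I ^+ 2 *
      ET (I := I) (fun w => Xr r0 r1 w ^+ (2 * k) + dl I ^+ (2 * k))).
  by apply: avg_site => // j; rewrite subr0; exact: (HC (with_site j)).
rewrite subr0 in step.
have {}step := le_trans (ler_norm _) step.
rewrite (_ : ET _ = M) in step; last by apply: eq_ex => w; rewrite -exprS mulnS.
rewrite mulrAC ler_pdivlMr// mulrBr mulr1 lerBlDl mulrC.
apply: le_trans step _; rewrite lerD2l.
apply: le_trans (ler_wpM2r _ (ler_norm C)) _; first by rewrite mulr_ge0.
rewrite -[leRHS]mulrA ler_wpM2l// mulnS exprD mulrCA.
by rewrite ler_wpM2l.
Qed.

Definition pairs : seq ('I_nrep.+1 * 'I_nrep.+1) :=
  [seq ab <- enum {: 'I_nrep.+1 * 'I_nrep.+1} | ab.1 != ab.2].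

(* A single random scale that dominates every [R_ab - q], [a <> b], and
   [N^(-1/2)]: a monomial of degree [k] in these is [O (Dd ^+ k)]. *)
Definition Dd (I : instance) (w : {ffun 'I_nrep.+1 -> config (iN I)}) : R :=
  dl I + \sum_(ab <- pairs) `|Xr ab.1 ab.2 w|.

(** Orders of magnitude are tracked pointwise, where they multiply, and become powers of [N^(-1/2)]
    only on taking expectations ([rateO]). *)
Definition OD (k : nat) (f : forall I : instance, {ffun 'I_nrep.+1 -> config (iN I)} -> R) :=
  exists C, forall I w, `|f I w| <= C * Dd w ^+ k.

Definition rateO (k : nat) (x : instance -> R) :=
  exists C, forall I, `|x I| <= C * dl I ^+ k.

Lemma Dd_ge_dl (I : instance) (w : {ffun 'I_nrep.+1 -> config (iN I)}) : dl I <= Dd w.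
Proof. by rewrite lerDl sumr_ge0. Qed.

Lemma Dd_gt0 (I : instance) (w : {ffun 'I_nrep.+1 -> config (iN I)}) : 0 < Dd w.
Proof. exact: lt_le_trans (dl_gt0 p2 I) (Dd_ge_dl w). Qed.

Definition Dmax : R := 1 + 2 * (size pairs)%:R.

Lemma Dd_le (I : instance) (w : {ffun 'I_nrep.+1 -> config (iN I)}) : Dd w <= Dmax.
Proof.
rewrite lerD ?dl_le1//; elim: pairs => [|ab r IH]; first by rewrite big_nil mulr0.
by rewrite big_cons /= -[(size r).+1%:R]natr1 mulrDr mulr1 addrC lerD// norm_Xr.
Qed.

Lemma Xr_le_Dd (I : instance) (w : {ffun 'I_nrep.+1 -> config (iN I)}) a b : a != b ->
  `|Xr a b w| <= Dd w.
Proof.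
move=> ab; have inp : (a, b) \in pairs by rewrite mem_filter ab mem_enum.
rewrite /Dd (big_rem _ inp)/= addrCA lerDl addr_ge0 ?sumr_ge0// ltW// dl_gt0//.
Qed.

(** The power of the sum is split into powers for single pairs; these are alike by symmetry, and
    [gronwall] refers them to the model. *)
Lemma Et_Dd k : exists C, forall (I : instance) t, 0 <= t <= pi / 2 ->
  Et (I := I) t (fun w => Dd w ^+ k) <= C * dl I ^+ k.
Proof.
have [C HC] := moment_bound k.
pose K := (2 ^+ (2 * k)) ^+ size pairs * (1 + (size pairs)%:R * (expR (24 * bb) * C)).
exists K => I t t01.
have d0 := dl_gt0 p2 I.
have pairE a b : a != b -> Et (I := I) t (fun w => `|Xr a b w| ^+ (2 * k)) <=
    expR (24 * bb) * C * dl I ^+ (2 * k).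
  move=> ab; have even_pow (y : R) n : `|y| ^+ (2 * n) = y ^+ (2 * n).
    by rewrite !exprM real_normK ?num_real.
  rewrite (_ : Et _ _ = Et (I := I) t (fun w => Xr r0 r1 w ^+ (2 * k))); last first.
    rewrite -(Et_pair t (fun s s' => (overlap s s' - q) ^+ (2 * k)) ab).
    by apply: eq_ex => w; rewrite even_pow.
  rewrite -mulrA; apply: le_trans (ler_wpM2l _ (HC I)); last exact: expR_ge0.
  apply: gronwall => //; last by move=> w; rewrite exprM exprn_ge0// sqr_ge0.
  apply: (@dep_pair _ _ _ _ _ I 2 r0 r1 (fun s s' => (overlap s s' - q) ^+ (2 * k))) => //.
  by rewrite inordK.
have even_bound : Et (I := I) t (fun w => Dd w ^+ (2 * k)) <= K * dl I ^+ (2 * k).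
  apply: (@le_trans _ _ (Et (I := I) t (fun w => (2 ^+ (2 * k)) ^+ size pairs *
    (dl I ^+ (2 * k) + \sum_(ab <- pairs) `|Xr ab.1 ab.2 w| ^+ (2 * k))))).
    apply: Et_le => w; apply: sum_expr_le => //; exact: ltW.
  rewrite /Et exZ -mulrA ler_wpM2l ?exprn_ge0// exD ex_sum.
  rewrite -/(Et t _) Et_cst mulrDl mul1r lerD2l.
  rewrite -mulrA mulr_natl -[size pairs]count_predT -[leRHS]addr0 -iter_addr -big_const_seq.
  rewrite big_seq [leRHS]big_seq; apply: ler_sum => ab.
  by rewrite mem_filter => /andP[ab1 _]; exact: pairE.
(* The order [k], possibly odd, follows from [2k]: as [Dd >= dl], one has [Dd^k dl^k <= Dd^(2k)]. *)
have dk : 0 < dl I ^+ k by rewrite exprn_gt0.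
rewrite -(ler_pM2r dk) -mulrA -exprD addnn -mul2n.
apply: le_trans even_bound; rewrite mulrC /Et -exZ; apply: Et_le => w.
have D0 := ltW (Dd_gt0 w); have l0 := ltW d0.
rewrite mul2n -addnn exprD ler_wpM2r ?exprn_ge0//.
by rewrite lerXn2r ?nnegrE// Dd_ge_dl.
Qed.

End asymptotics.

(** * Calculus of orders of magnitude, and expansions around time 0 *)

Section calculus.
Context {R : realType}.
Variables (p : nat) (beta h q : R).
Hypotheses (p2 : (2 <= p)%N) (q01 : 0 <= q <= 1).
Hypothesis m2 : tanh_moment p beta h q 2 = q.
Hypothesis contr : contraction_rate p beta < 1.
Notation instance := (instance p beta h q).
Notation OD := (@OD R p beta h q).
Notation rateO := (@rateO R p beta h q).
Notation bb := (b0 p beta).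
Notation r0 := (ord0 : 'I_nrep.+1).
Notation r1 := (inord 1 : 'I_nrep.+1).
Notation obs := (forall I : instance, {ffun 'I_nrep.+1 -> config (iN I)} -> R).
Implicit Types (f g : obs) (a b : 'I_nrep.+1).

Lemma ODP k f : OD k f ->
  exists2 C, 0 <= C & forall I w, `|f I w| <= C * Dd w ^+ k.
Proof.
move=> [C HC]; exists `|C| => // I w; apply: le_trans (HC I w) _.
by rewrite ler_wpM2r ?ler_norm// exprn_ge0// ltW// Dd_gt0.
Qed.

Lemma eq_OD k f g : (forall I, f I =1 g I) -> OD k f -> OD k g.
Proof. by move=> fg [C HC]; exists C => I w; rewrite -fg. Qed.

Lemma OD_cst c : OD 0 (fun _ _ => c).
Proof. by exists `|c| => I w; rewrite expr0 mulr1. Qed.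

Lemma OD_D k f g : OD k f -> OD k g -> OD k (fun I w => f I w + g I w).
Proof.
move=> [C HC] [C' HC']; exists (C + C') => I w.
by rewrite mulrDl; apply: le_trans (ler_normD _ _) _; exact: lerD.
Qed.

Lemma OD_M k l f g : OD k f -> OD l g -> OD (k + l) (fun I w => f I w * g I w).
Proof.
move=> /ODP[C C0 HC] /ODP[C' C'0 HC']; exists (C * C') => I w.
by rewrite normrM exprD mulrACA ler_pM.
Qed.

Lemma OD_Z k c f : OD k f -> OD k (fun I w => c * f I w).
Proof. exact: (OD_M (OD_cst c)). Qed.

Lemma OD_B k f g : OD k f -> OD k g -> OD k (fun I w => f I w - g I w).
Proof.
move=> fk gk; have := OD_D fk (OD_Z (-1) gk).
by apply: eq_OD => I w; rewrite mulN1r.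
Qed.

Lemma OD_X k m f : OD k f -> OD (m * k) (fun I w => f I w ^+ m).
Proof.
move=> [C HC]; exists (C ^+ m) => I w.
by rewrite normrX mulnC exprM -exprMn lerXn2r ?nnegrE// (le_trans _ (HC I w)).
Qed.

Lemma OD_X1 m f : OD 1 f -> OD m (fun I w => f I w ^+ m).
Proof. by move=> /(OD_X m); rewrite muln1. Qed.

Lemma OD_sum k (J : finType) (P : pred J) (F : J -> obs) :
  (forall j, P j -> OD k (F j)) -> OD k (fun I w => \sum_(j | P j) F j I w).
Proof.
move=> FO.
have : forall j, exists C, P j -> forall I w, `|F j I w| <= C * Dd w ^+ k.
  by move=> j; case: (boolP (P j)) => [/FO[C HC]|_]; [exists C|exists 0].
move=> /choice[C HC]; exists (\sum_(j | P j) C j) => I w.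
rewrite mulr_suml; apply: le_trans (ler_norm_sum _ _ _) _; apply: ler_sum => j Pj.
exact: HC.
Qed.

Lemma OD_mono k l f : (k <= l)%N -> OD l f -> OD k f.
Proof.
move=> kl /ODP[C C0 HC]; exists (C * Dmax ^+ (l - k)) => I w.
have D0 := ltW (Dd_gt0 p2 w).
apply: le_trans (HC I w) _; rewrite -mulrA ler_wpM2l//.
rewrite -{1}(subnK kl) exprD ler_wpM2r ?exprn_ge0// lerXn2r ?nnegrE//.
- by rewrite /Dmax addr_ge0// mulr_ge0.
- exact: Dd_le.
Qed.

Lemma OD_dl2 : OD 2 (fun I _ => dl I ^+ 2).
Proof.
exists 1 => I w; have d0 := ltW (dl_gt0 p2 I).
by rewrite mul1r ger0_norm ?sqr_ge0// lerXn2r ?nnegrE ?Dd_ge_dl// (le_trans d0)// Dd_ge_dl.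
Qed.

Lemma OD_Xr a b : a != b -> OD 1 (fun I => @Xr R p beta h q I a b).
Proof. by move=> ab; exists 1 => I w; rewrite mul1r Xr_le_Dd. Qed.

Lemma OD_ep a b : OD 0 (fun I => @ep R p beta h q I a b).
Proof. by exists 1 => I w; rewrite mulr1 norm_ep. Qed.

Lemma OD_epq a b : OD 0 (fun I w => @ep R p beta h q I a b w - q).
Proof. exact: OD_B (OD_ep a b) (OD_cst q). Qed.

Lemma OD_Xm a b : a != b -> OD 1 (fun I => @Xm R p beta h q I a b).
Proof.
move=> ab; have := OD_B (OD_Xr ab) (OD_mono (isT : (1 <= 2)%N) (OD_M OD_dl2 (OD_ep a b))).
by apply: eq_OD => I w; rewrite XmE.
Qed.

Lemma OD_norm k f : OD k f -> OD k (fun I w => `|f I w|).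
Proof. by move=> [C HC]; exists C => I w; rewrite normr_id. Qed.

Lemma OD_dominated k f g : (forall I w, `|f I w| <= g I w) -> OD k g -> OD k f.
Proof.
move=> fg [C HC]; exists C => I w; apply: le_trans (HC I w).
by apply: le_trans (fg I w) (ler_norm _).
Qed.

Lemma OD_Qm a b : a != b -> OD 1 (fun I => @Qm R p beta h q I a b).
Proof.
move=> ab; apply: OD_dominated (fun I w => norm_Qm p2 q01 a b w) _.
apply: OD_D; apply: OD_Z; first exact/OD_norm/OD_Xm.
exact: (OD_mono (isT : (1 <= 2)%N) OD_dl2).
Qed.

Lemma OD_Qm_taylor a b : a != b ->
  OD 2 (fun I w => @Qm R p beta h q I a b w - (p - 1)%:R * q ^+ (p - 2) * Xm a b w).
Proof.
move=> ab; apply: OD_dominated (fun I w => norm_Qm_taylor p2 q01 a b w) _.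
apply: OD_Z; apply: OD_D; last exact: OD_dl2.
exact: (OD_X 2 (OD_Xm ab)).
Qed.

Lemma OD_kernel n : (n < nrep)%N ->
  OD 1 (fun I w => cav_kernel p beta q n (isite I) w).
Proof.
move=> nm; apply: (eq_OD (f := fun I w => \sum_(l < nrep.+1) \sum_(l' < nrep.+1 | l' != l)
    kap n l * kap n.+1 l' * (bb * (ep l l' w * Qm l l' w)))).
  by move=> I w; rewrite kernel_offdiag.
apply: OD_sum => l _; apply: OD_sum => l' ll'; apply: OD_Z; apply: OD_Z.
by apply: (OD_M (OD_ep l l')); apply: OD_Qm; rewrite eq_sym.
Qed.

Lemma OD_Et k f : OD k f -> exists2 C, 0 <= C & forall (I : instance) t,
  0 <= t <= pi / 2 -> `|Et t (f I)| <= C * dl I ^+ k.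
Proof.
move=> /ODP[C C0 HC]; have [C' HC'] := Et_Dd p2 q01 m2 contr k.
exists (C * `|C'|) => [|I t t01]; first by rewrite mulr_ge0.
apply: le_trans (Et_norm _ _) _.
apply: (@le_trans _ _ (Et (I := I) t (fun w => C * Dd w ^+ k))).
  exact: Et_le.
rewrite /Et exZ -mulrA ler_wpM2l//; apply: le_trans (HC' I t t01) _.
by rewrite ler_wpM2r ?ler_norm// exprn_ge0// ltW// dl_gt0.
Qed.

Lemma eq_O k x y : x =1 y -> rateO k x -> rateO k y.
Proof. by move=> xy [C HC]; exists C => I; rewrite -xy. Qed.

Lemma O_D k x y : rateO k x -> rateO k y -> rateO k (fun I => x I + y I).
Proof.
move=> [C HC] [C' HC']; exists (C + C') => I.
by rewrite mulrDl; apply: le_trans (ler_normD _ _) _; exact: lerD.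
Qed.

Lemma O_Z k c x : rateO k x -> rateO k (fun I => c * x I).
Proof.
move=> [C HC]; exists (`|c| * C) => I; by rewrite normrM -mulrA ler_wpM2l.
Qed.

Lemma O_B k x y : rateO k x -> rateO k y -> rateO k (fun I => x I - y I).
Proof.
move=> xk yk; have := O_D xk (O_Z (-1) yk).
by apply: eq_O => I; rewrite mulN1r.
Qed.

Lemma O_dl m k x : rateO k x -> rateO (m + k) (fun I => dl I ^+ m * x I).
Proof.
move=> [C HC]; exists C => I; have d0 := ltW (dl_gt0 p2 I).
by rewrite normrM ger0_norm ?exprn_ge0// exprD mulrCA ler_wpM2l// exprn_ge0.
Qed.

Lemma O_sum k (J : finType) (P : pred J) (F : J -> instance -> R) :
  (forall j, P j -> rateO k (F j)) -> rateO k (fun I => \sum_(j | P j) F j I).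
Proof.
move=> FO.
have : forall j, exists C, P j -> forall I, `|F j I| <= C * dl I ^+ k.
  by move=> j; case: (boolP (P j)) => [/FO[C HC]|_]; [exists C|exists 0].
move=> /choice[C HC]; exists (\sum_(j | P j) C j) => I.
rewrite mulr_suml; apply: le_trans (ler_norm_sum _ _ _) _; apply: ler_sum => j Pj.
exact: HC.
Qed.

Lemma O_E0 k f : OD k f -> rateO k (fun I => E0 (f I)).
Proof.
move=> /OD_Et[C C0 HC]; exists C => I; apply: HC.
by rewrite lexx divr_ge0// pi_ge0.
Qed.

Lemma O_ET k f : OD k f -> rateO k (fun I => ET (f I)).
Proof.
move=> /OD_Et[C C0 HC]; exists C => I; rewrite -Et_pihalf; apply: HC.
by rewrite lexx andbT divr_ge0// pi_ge0.
Qed.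

(** The kernel has order 1, so passing between the model and time 0 gains one order. *)
Lemma O_mvt1 n k f : (n < nrep)%N -> (forall I, dep n (f I)) -> OD k f ->
  rateO k.+1 (fun I => ET (f I) - E0 (f I)).
Proof.
move=> nm fn fk.
have := OD_Et (OD_M fk (OD_kernel nm)); rewrite addn1 => -[C C0 HC].
exists (2^-1 * C) => I.
have [|xi xi01] := Et_mvt nm (fn I) (t1 := pi / 2).
  by rewrite lexx andbT divr_gt0// pi_gt0.
rewrite Et_pihalf sin_pihalf expr1n mul1r => ->.
rewrite normrM ger0_norm ?invr_ge0// -mulrA ler_wpM2l ?invr_ge0//.
by apply: HC; case/andP: xi01 => /ltW -> /ltW ->.
Qed.

Lemma dep_kernel n N (f : {ffun 'I_nrep.+1 -> config N} -> R) i : dep n f ->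
  dep n.+2 (fun w => f w * cav_kernel p beta q n i w).
Proof.
move=> fn w w' ww'; rewrite (fn _ w'); last by move=> l ln; rewrite ww'// ltnW// ltnW.
congr (_ * _); apply: eq_bigr => l _; apply: eq_bigr => l' _.
case: (ltnP l n.+2) => ln; last first.
  by rewrite /kap ltnNge (ltnW (ltnW ln)) /= gtn_eqF ?mul0r// ltnW.
case: (ltnP l' n.+2) => l'n; last first.
  by rewrite {2 4}/kap ltnNge (ltnW l'n) /= gtn_eqF// !mulr0 !mul0r.
by rewrite !ww'.
Qed.

(** The derivative at the intermediate time is compared in turn with time 0, which produces a second
    kernel and a second order. *)
Lemma O_mvt2 n k f : (n.+2 < nrep)%N -> (forall I, dep n (f I)) -> OD k f ->
  rateO k.+2 (fun I => ET (f I) - E0 (f I) -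
    2^-1 * E0 (fun w => f I w * cav_kernel p beta q n (isite I) w)).
Proof.
move=> nm fn fk; have nm' : (n < nrep)%N by apply: leq_trans nm; rewrite ltnS leqW.
have := OD_Et (OD_M (OD_M fk (OD_kernel nm')) (OD_kernel nm)).
rewrite -addnA addn2 => -[C C0 HC].
exists (2^-1 * (2^-1 * C)) => I.
have [|xi xi01] := Et_mvt nm' (fn I) (t1 := pi / 2).
  by rewrite lexx andbT divr_gt0// pi_gt0.
rewrite Et_pihalf sin_pihalf expr1n mul1r => ->.
have [|x2 x201] := Et_mvt nm (@dep_kernel n (iN I) (f I) (isite I) (fn I)) (t1 := xi).
  by case/andP: xi01 => -> /ltW ->.
rewrite -mulrBr => ->.
have H : `|Et x2 (fun w => f I w * cav_kernel p beta q n (isite I) w *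
    cav_kernel p beta q n.+2 (isite I) w)| <= C * dl I ^+ k.+2.
  apply: HC; case/andP: xi01 => x0 x1; case/andP: x201 => y0 y1.
  by rewrite ltW//= ltW// (lt_trans y1).
have s1 : `|sin xi ^+ 2 / 2| <= 2^-1.
  rewrite ger0_norm ?divr_ge0 ?sqr_ge0//.
  have := cos2Dsin2 xi; have := sqr_ge0 (cos xi); lra.
rewrite normrM (ger0_norm (x := 2^-1)) ?invr_ge0// -[leRHS]mulrA ler_wpM2l ?invr_ge0//.
by rewrite normrM -[leRHS]mulrA ler_pM.
Qed.

(** * Linear equations between overlap moments *)

Notation q4 := (qhat4 p beta h q).
(* [E(eps_a eps_b - q) eps_l eps_l'] in the decoupled system: a repeated replica
   cancels, leaving [E tanh^r] with [r = 4, 2, 0]. *)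
Definition cov4 a b l l' : R :=
  match ((l == a) + (l == b) + (l' == a) + (l' == b))%N with
  | 0 => q4 - q ^+ 2
  | 1 => q - q ^+ 2
  | _ => 1 - q ^+ 2
  end.

Section factorization.
Variable I : instance.
Notation N := (iN I).
Notation i := (isite I).
Variable f : {ffun 'I_nrep.+1 -> config N} -> R.
Hypothesis finv : forall l w, f (flip_at (flip_spin i) w l) = f w.

Lemma E0_ep1 a b : a != b -> E0 (fun w => ep a b w * f w) = q * E0 f.
Proof.
move=> ab; have := E0_ep m2 ab finv.
rewrite (_ : E0 _ = E0 (fun w => ep a b w * f w) - q * E0 f).
  by move/eqP; rewrite subr_eq0 => /eqP.
by rewrite -exZ -exB; apply: eq_ex => w; ring.
Qed.

Lemma epp a b c w : ep (I := I) a b w * ep a c w = ep b c w.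
Proof.
rewrite /ep mulrACA -expr2 spin_sq mul1r; by [].
Qed.

Lemma epC a b w : ep (I := I) a b w = ep b a w.
Proof. by rewrite /ep mulrC. Qed.

Lemma E0_ep2_aux a b l l' : a != b -> l != l' ->
  E0 (fun w => ep a b w * (ep l l' w * f w)) = (cov4 a b l l' + q ^+ 2) * E0 f.
Proof.
move=> ab ll'; rewrite /cov4.
have share c d e : d != e -> E0 (fun w => ep c d w * (ep c e w * f w)) = q * E0 f.
  by move=> de; rewrite -(E0_ep1 de); apply: eq_ex => w; rewrite mulrA epp.
have ep1 c d w : ep (I := I) c d w * ep c d w = 1 by rewrite epp /ep -expr2 spin_sq.
case: (eqVneq l a) => [la|la].
  rewrite la (negbTE ab) in ll' *; rewrite [l' == a]eq_sym (negbTE ll') /=.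
  case: (eqVneq l' b) => [->|lb].
    by rewrite subrK mul1r; apply: eq_ex => w; rewrite mulrA ep1 mul1r.
  by rewrite subrK; apply: share; rewrite eq_sym.
case: (eqVneq l b) => [lb|lb].
  rewrite lb in ll' *; rewrite [l' == b]eq_sym (negbTE ll') addn0.
  case: (eqVneq l' a) => [->|l'a] /=.
    by rewrite subrK mul1r; apply: eq_ex => w; rewrite mulrA epC ep1 mul1r.
  rewrite subrK -(share b a l'); last by rewrite eq_sym.
  by apply: eq_ex => w; rewrite (epC a b).
case: (eqVneq l' a) => [l'a|l'a].
  rewrite l'a (negbTE ab) /= subrK -(share a b l); last by rewrite eq_sym.
  by apply: eq_ex => w; rewrite (epC l a).
case: (eqVneq l' b) => [l'b|l'b].
  rewrite l'b /= subrK -(share b a l); last by rewrite eq_sym.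
  by apply: eq_ex => w; rewrite (epC l b) (epC a b).
have us : uniq [:: a; b; l; l'].
  by rewrite /= !inE !negb_or ab ll' eq_sym la eq_sym l'a eq_sym lb eq_sym l'b.
rewrite /= subrK -[q4]/(tanh_moment p beta h q (size [:: a; b; l; l'])).
rewrite -(E0_factor us finv).
by apply: eq_ex => w; rewrite !big_cons big_nil /ep; ring.
Qed.

Lemma E0_ep2 a b l l' : a != b -> l != l' ->
  E0 (fun w => (ep a b w - q) * (ep l l' w * f w)) = cov4 a b l l' * E0 f.
Proof.
move=> ab ll'; have h1 := E0_ep2_aux ab ll'; have h2 := E0_ep1 ll'.
rewrite (_ : E0 _ = E0 (fun w => ep a b w * (ep l l' w * f w)) -
   q * E0 (fun w => ep l l' w * f w)).
  by rewrite h1 h2; ring.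
by rewrite -exZ -exB; apply: eq_ex => w; ring.
Qed.

End factorization.

Lemma r01 : r0 != r1. Proof. by apply/eqP => /(congr1 val); rewrite /= inordK. Qed.

Lemma OD_exp_sub f g m : OD 1 f -> OD 1 g -> OD 2 (fun I w => f I w - g I w) ->
  OD m.+1 (fun I w => f I w ^+ m - g I w ^+ m).
Proof.
move=> f1 g1 fg2; elim: m => [|m IH].
  by exists 0 => I w; rewrite !expr0 subrr normr0 mul0r.
apply: (eq_OD _ (OD_D (OD_M f1 IH) (OD_M fg2 (OD_X1 m g1)))) => I w.
by rewrite !exprS; ring.
Qed.

Lemma OD_pow_sub a b m : a != b ->
  OD m.+1 (fun I w => @Xm R p beta h q I a b w ^+ m - Xr a b w ^+ m).
Proof.
move=> ab; apply: OD_exp_sub; [exact: OD_Xm|exact: OD_Xr|].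
apply: (eq_OD _ (OD_Z (-1) (OD_M OD_dl2 (OD_ep a b)))) => I w.
by rewrite XmE; ring.
Qed.

(** The linear term is kept although it carries [1/N]: it has order [m+1], the order of the moments
    to be computed. *)
Lemma OD_taylor m : OD m.+2 (fun I w => @Xr R p beta h q I r0 r1 w ^+ m -
  Xm r0 r1 w ^+ m - m%:R * (dl I ^+ 2 * ep r0 r1 w * Xm r0 r1 w ^+ m.-1)).
Proof.
have B0 : 0 <= 2 * Dmax :> R by rewrite mulr_ge0// addr_ge0// mulr_ge0.
have [C C0 HC] := norm_taylor_second m B0.
exists (C * 2 ^+ m.+2) => I w.
have d0 := dl_gt0 p2 I; have d1 := dl_le1 p2 I; have D0 := Dd_gt0 p2 w.
have dD := Dd_ge_dl w.
have d2d : dl I ^+ 2 <= dl I by rewrite expr2 ler_piMr// ltW.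
have ne : `|dl I ^+ 2 * ep r0 r1 w| = dl I ^+ 2.
  by rewrite normrM norm_ep mulr1 ger0_norm ?sqr_ge0.
have h1 : 0 <= 2 * Dd w <= 2 * Dmax.
  by rewrite mulr_ge0 ?(ltW D0)//= ler_wpM2l// Dd_le.
have h2 : `|Xm r0 r1 w| <= 2 * Dd w.
  rewrite XmE; apply: le_trans (ler_normB _ _) _.
  by rewrite ne; have := Xr_le_Dd p2 w r01; lra.
have h3 : `|dl I ^+ 2 * ep r0 r1 w| <= (2 * Dd w) ^+ 2.
  rewrite ne exprMn -[leLHS]mul1r ler_pM ?sqr_ge0//.
    by rewrite -[leLHS](expr1n _ 2) lerXn2r ?nnegrE// ler1n.
  by rewrite lerXn2r ?nnegrE// ltW.
have := HC _ _ _ h1 h2 h3.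
rewrite (_ : Xm r0 r1 w + _ = Xr r0 r1 w); last by rewrite XmE subrK.
by rewrite [(2 * Dd w) ^+ _]exprMn => H; rewrite -[leRHS]mulrA.
Qed.

Lemma O_cst0 k x : (forall I, x I = 0) -> rateO k x.
Proof. by move=> x0; exists 0 => I; rewrite x0 normr0 mul0r. Qed.

Lemma Xm_pow_flip (I : instance) a b m l w :
  Xm (I := I) a b (flip_at (flip_spin (isite I)) w l) ^+ m = Xm a b w ^+ m.
Proof. by rewrite Xm_flip. Qed.

Definition slope : R := (p - 1)%:R * q ^+ (p - 2).

(** At time 0 the overlap of the kernel is linearized with slope [(p-1) q^(p-2)]; both this and the
    return to the model cost one order more than the main term. *)
Lemma rate_pow_overlap n m (l l' : 'I_nrep.+1) : (n.+2 < nrep)%N -> (2 <= n)%N ->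
  (l < n.+2)%N -> (l' < n.+2)%N -> l != l' ->
  rateO m.+2 (fun I => E0 (fun w => Xm (I := I) r0 r1 w ^+ m * Qm (I := I) l l' w) -
    slope * ET (fun w => Xr (I := I) r0 r1 w ^+ m * Xr l l' w)).
Proof.
move=> nm n2 ln l'n ll'.
have D1 : OD m.+2 (fun I w => @Xm R p beta h q I r0 r1 w ^+ m * Qm (I := I) l l' w -
    slope * (Xr r0 r1 w ^+ m * Xr l l' w)).
  have t1 := OD_M (OD_X1 m (OD_Xm r01)) (OD_Qm_taylor ll').
  have t2 := OD_Z slope (OD_M (OD_X1 m (OD_Xm r01)) (OD_M OD_dl2 (OD_ep l l'))).
  have t3 := OD_Z slope (OD_M (OD_pow_sub m r01) (OD_Xr ll')).
  rewrite addn2 in t1; rewrite addn0 addn2 in t2; rewrite addn1 in t3.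
  apply: (eq_OD _ (OD_D (OD_B t1 t2) t3)) => I w.
  have -> : dl I ^+ 2 * ep l l' w = Xr l l' w - Xm l l' w by rewrite XmE; ring.
  by rewrite /slope; ring.
have O1 := O_E0 D1.
have d6 (I : instance) : dep n.+2 (fun w => Xr (I := I) r0 r1 w ^+ m * Xr l l' w).
  move=> w w' ww'; rewrite /Xr !ww'// inordK//.
have O2 := O_mvt1 nm d6 (OD_M (OD_X1 m (OD_Xr r01)) (OD_Xr ll')).
rewrite addn1 in O2.
apply: (eq_O _ (O_B O1 (O_Z slope O2))) => I /=.
rewrite [X in X - _](_ : _ = E0 (fun w => Xm (I := I) r0 r1 w ^+ m * Qm (I := I) l l' w) -
   slope * E0 (fun w => Xr (I := I) r0 r1 w ^+ m * Xr l l' w)); first by ring.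
by rewrite -exZ -exB.
Qed.

(** The prefactor [1/N] supplies two orders, so that factorizing at time 0 and returning to the
    model is accurate enough. *)
Lemma rate_cavity_term (a b : 'I_nrep.+1) n m : (n.+2 < nrep)%N -> (2 <= n)%N ->
  (a < n)%N -> (b < n)%N -> a != b ->
  rateO m.+2 (fun I => m%:R * (dl I ^+ 2 *
    (ET (fun w => (ep (I := I) a b w - q) * (ep r0 r1 w * Xm r0 r1 w ^+ m.-1)) -
     cov4 a b r0 r1 * ET (fun w => Xr (I := I) r0 r1 w ^+ m.-1)))).
Proof.
move=> nm n2 an bn ab; have nm' : (n < nrep)%N by apply: leq_trans nm; rewrite ltnS leqW.
have r1n : (r1 < n)%N by rewrite inordK.
have r0n : (r0 < n)%N by exact: leq_trans n2.
(* For [m = 0] the prefactor vanishes, so the truncated predecessor [m.-1] is harmless. *)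
case: m => [|m]; first by apply: O_cst0 => I; rewrite mul0r.
apply: O_Z; rewrite -[m.+3]/(2 + m.+1)%N; apply: O_dl => /=.
have d1 (I : instance) : dep n (fun w => (ep (I := I) a b w - q) * (ep r0 r1 w * Xm r0 r1 w ^+ m)).
  by move=> w w' ww'; rewrite /ep /Xm !ww'.
have t1 := O_mvt1 nm' d1 (OD_M (OD_epq a b) (OD_M (OD_ep r0 r1) (OD_X1 m (OD_Xm r01)))).
rewrite !add0n in t1.
have t2 := O_E0 (OD_pow_sub m r01).
have d2 (I : instance) : dep n (fun w => Xr (I := I) r0 r1 w ^+ m).
  by move=> w w' ww'; rewrite /Xr !ww'.
have t3 := O_mvt1 nm' d2 (OD_X1 m (OD_Xr r01)).
have t := O_D t1 (O_Z (cov4 a b r0 r1) (O_B t2 t3)).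
apply: (eq_O _ t) => I /=.
rewrite (E0_ep2 (@Xm_pow_flip I r0 r1 m) ab r01).
have -> : E0 (fun w => Xm (I := I) r0 r1 w ^+ m - Xr r0 r1 w ^+ m) =
    E0 (fun w => Xm (I := I) r0 r1 w ^+ m) - E0 (fun w => Xr (I := I) r0 r1 w ^+ m).
  by rewrite /E0 exB.
by ring.
Qed.

(** With [Xm] in place of [Xr] the value at time 0 vanishes and the expansion starts with the
    kernel, where the spins at the site factor out through [cov4]. The Taylor expansion of [Xr^m]
    around [Xm^m] adds the term in [1/N]. *)
Lemma rate_expansion (a b : 'I_nrep.+1) n m : (n.+2 < nrep)%N -> (2 <= n)%N ->
  (a < n)%N -> (b < n)%N -> a != b ->
  rateO m.+2 (fun I => ET (fun w => (ep (I := I) a b w - q) * Xr r0 r1 w ^+ m) -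
   (m%:R * (dl I ^+ 2 * (cov4 a b r0 r1 * ET (fun w => Xr (I := I) r0 r1 w ^+ m.-1))) +
    \sum_(l < nrep.+1) \sum_(l' < nrep.+1 | l' != l)
      2^-1 * bb * slope * (kap n l * kap n.+1 l' * cov4 a b l l') *
      ET (fun w => Xr (I := I) r0 r1 w ^+ m * Xr l l' w))).
Proof.
move=> nm n2 an bn ab; have nm' : (n < nrep)%N by apply: leq_trans nm; rewrite ltnS leqW.
have r1n : (r1 < n)%N by rewrite inordK.
have r0n : (r0 < n)%N by exact: leq_trans n2.
have t1 := O_ET (OD_M (OD_epq a b) (OD_taylor m)); rewrite add0n in t1.
have t2 := rate_cavity_term m nm n2 an bn ab.
have d1 (I : instance) : dep n (fun w => (ep (I := I) a b w - q) * Xm r0 r1 w ^+ m).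
  by move=> w w' ww'; rewrite /ep /Xm !ww'.
have t3 := O_mvt2 nm d1 (OD_M (OD_epq a b) (OD_X1 m (OD_Xm r01))).
rewrite add0n in t3.
have t4 : rateO m.+2 (fun I => \sum_(l < nrep.+1) \sum_(l' < nrep.+1 | l' != l)
    2^-1 * bb * (kap n l * kap n.+1 l' * cov4 a b l l') *
    (E0 (fun w => Xm (I := I) r0 r1 w ^+ m * Qm (I := I) l l' w) -
     slope * ET (fun w => Xr (I := I) r0 r1 w ^+ m * Xr l l' w))).
  apply: O_sum => l _; apply: O_sum => l' ll'.
  (* Replicas of index at least [n.+2] have weight 0 in the kernel. *)
  case: (ltnP l n.+2) => ln; last first.
    apply: O_cst0 => I.
    by rewrite {1}/kap ltnNge (ltnW (ltnW ln)) /= gtn_eqF ?(mul0r, mulr0)// ltnW.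
  case: (ltnP l' n.+2) => l'n; last first.
    apply: O_cst0 => I.
    by rewrite {2}/kap ltnNge (ltnW l'n) /= gtn_eqF// !(mul0r, mulr0).
  by apply: O_Z; apply: (rate_pow_overlap _ nm) => //; rewrite eq_sym.
have t := O_D (O_D t1 t2) (O_D t3 t4).
apply: (eq_O _ t) => I /=.
pose F w := (ep (I := I) a b w - q) * Xm r0 r1 w ^+ m.
pose G w := (ep (I := I) a b w - q) * (ep r0 r1 w * Xm r0 r1 w ^+ m.-1).
pose c (l l' : 'I_nrep.+1) : R := 2^-1 * bb * (kap n l * kap n.+1 l' * cov4 a b l l').
pose A (l l' : 'I_nrep.+1) := E0 (fun w => Xm (I := I) r0 r1 w ^+ m * Qm l l' w).
pose B (l l' : 'I_nrep.+1) := ET (fun w => Xr (I := I) r0 r1 w ^+ m * Xr l l' w).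
have e1 : ET (fun w => (ep (I := I) a b w - q) * (Xr r0 r1 w ^+ m - Xm r0 r1 w ^+ m -
      m%:R * (dl I ^+ 2 * ep r0 r1 w * Xm r0 r1 w ^+ m.-1))) =
    ET (fun w => (ep (I := I) a b w - q) * Xr r0 r1 w ^+ m) - ET F -
    m%:R * dl I ^+ 2 * ET G.
  by rewrite /ET -exZ -!exB; apply: eq_ex => w; rewrite /F /G; ring.
have e2 : E0 (fun w => (ep (I := I) a b w - q) * Xm r0 r1 w ^+ m) = 0 :=
  E0_ep m2 ab (@Xm_pow_flip I r0 r1 m).
have e3 : 2^-1 * E0 (fun w => F w * cav_kernel p beta q n (isite I) w) =
    \sum_(l < nrep.+1) \sum_(l' < nrep.+1 | l' != l) c l l' * A l l'.
  rewrite (_ : E0 _ = E0 (fun w => \sum_(l < nrep.+1) \sum_(l' < nrep.+1 | l' != l)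
     (kap n l * kap n.+1 l' * bb) *
     ((ep (I := I) a b w - q) * (ep l l' w * (Xm r0 r1 w ^+ m * Qm l l' w))))); last first.
    apply: eq_ex => w; rewrite kernel_offdiag// mulr_sumr; apply: eq_bigr => l _.
    by rewrite mulr_sumr; apply: eq_bigr => l' _; rewrite /F; ring.
  rewrite /E0 ex_sum mulr_sumr; apply: eq_bigr => l _.
  rewrite ex_sum mulr_sumr; apply: eq_bigr => l' ll'.
  rewrite exZ -/(E0 _) (E0_ep2 (f := fun w => Xm (I := I) r0 r1 w ^+ m * Qm l l' w)) //.
  - by rewrite /c /A; ring.
  - by move=> j w; rewrite Xm_flip Qm_flip.
  - by rewrite eq_sym.
have e4 : \sum_(l < nrep.+1) \sum_(l' < nrep.+1 | l' != l) c l l' * (A l l' - slope * B l l') =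
    \sum_(l < nrep.+1) \sum_(l' < nrep.+1 | l' != l) c l l' * A l l' -
    \sum_(l < nrep.+1) \sum_(l' < nrep.+1 | l' != l)
      2^-1 * bb * slope * (kap n l * kap n.+1 l' * cov4 a b l l') * B l l'.
  rewrite -sumrB; apply: eq_bigr => l _; rewrite -sumrB; apply: eq_bigr => l' _.
  by rewrite /c; ring.
rewrite e1 e2 e3 e4.
by ring.
Qed.

Lemma rate_overlap (a b : 'I_nrep.+1) n m : (n.+2 < nrep)%N -> (2 <= n)%N ->
  (a < n)%N -> (b < n)%N -> a != b ->
  rateO m.+2 (fun I => ET (fun w => Xr (I := I) a b w * Xr r0 r1 w ^+ m) -
   (m%:R * (dl I ^+ 2 * (cov4 a b r0 r1 * ET (fun w => Xr (I := I) r0 r1 w ^+ m.-1))) +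
    \sum_(l < nrep.+1) \sum_(l' < nrep.+1 | l' != l)
      2^-1 * bb * slope * (kap n l * kap n.+1 l' * cov4 a b l l') *
      ET (fun w => Xr (I := I) r0 r1 w ^+ m * Xr l l' w))).
Proof.
move=> nm n2 an bn ab; have [C HC] := rate_expansion m nm n2 an bn ab.
exists C => I; apply: avg_site => // j; exact: (HC (with_site j)).
Qed.

(* A pair of replicas enters only through the number of indices that it shares
   with a fixed pair; [c2] is the value for equal pairs. *)
Definition pick3 (n : nat) (c0 c1 c2 : R) : R :=
  match n with 0 => c0 | 1 => c1 | _ => c2 end.

Definition shared (a b l l' : nat) : nat :=
  ((l == a) + (l == b) + (l' == a) + (l' == b))%N.

Notation r2 := (inord 2 : 'I_nrep.+1).
Notation r3 := (inord 3 : 'I_nrep.+1).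

Lemma XrC (I : instance) a b w : Xr (I := I) a b w = Xr b a w.
Proof.
rewrite /Xr /overlap; congr (_ * _ - _); apply: eq_bigr => j _; exact: mulrC.
Qed.

Lemma ET_rename (I : instance) (f : {ffun 'I_nrep.+1 -> config (iN I)} -> R)
    (s : seq 'I_nrep.+1) : uniq s -> exists2 sg,
  forall j, (j < size s)%N -> sg (inord j) = nth ord0 s j &
  ET f = ET (fun w => f [ffun j => w (sg j)]).
Proof.
move=> us; have [sg sgE E] := Et_rename (pi / 2) f us.
by exists sg => //; rewrite -!Et_pihalf.
Qed.

Lemma inord0 : inord 0 = r0. Proof. exact/val_inj/inordK. Qed.

Lemma ET_share (I : instance) m (a b c : 'I_nrep.+1) : uniq [:: a; b; c] ->
  ET (fun w => Xr (I := I) a b w ^+ m * Xr a c w) =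
  ET (fun w => Xr (I := I) r0 r1 w ^+ m * Xr r0 r2 w).
Proof.
move=> us; have [sg sgE ->] := ET_rename (fun w => Xr (I := I) r0 r1 w ^+ m * Xr r0 r2 w) us.
have s0 := sgE 0 isT; have s1 := sgE 1 isT; have s2 := sgE 2 isT.
by apply: eq_ex => w; rewrite /Xr !ffunE -inord0 s0 s1 s2.
Qed.

Lemma ET_disjoint (I : instance) m (a b c d : 'I_nrep.+1) : uniq [:: a; b; c; d] ->
  ET (fun w => Xr (I := I) a b w ^+ m * Xr c d w) =
  ET (fun w => Xr (I := I) r0 r1 w ^+ m * Xr r2 r3 w).
Proof.
move=> us; have [sg sgE ->] := ET_rename (fun w => Xr (I := I) r0 r1 w ^+ m * Xr r2 r3 w) us.
have s0 := sgE 0 isT; have s1 := sgE 1 isT; have s2 := sgE 2 isT; have s3 := sgE 3 isT.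
by apply: eq_ex => w; rewrite /Xr !ffunE -inord0 s0 s1 s2 s3.
Qed.

(** Replicas are exchangeable and overlaps symmetric, so only the number of indices common with the
    pair of the first two replicas matters. *)
Lemma ET_kind (I : instance) m (l l' : 'I_nrep.+1) : l != l' ->
  ET (fun w => Xr (I := I) r0 r1 w ^+ m * Xr l l' w) =
  pick3 (shared 0 1 l l')
    (ET (fun w => Xr (I := I) r0 r1 w ^+ m * Xr r2 r3 w))
    (ET (fun w => Xr (I := I) r0 r1 w ^+ m * Xr r0 r2 w))
    (ET (fun w => Xr (I := I) r0 r1 w ^+ m.+1)).
Proof.
move=> ll'.
have sw (a b : 'I_nrep.+1) : ET (fun w => Xr (I := I) r0 r1 w ^+ m * Xr a b w) =
    ET (fun w => Xr (I := I) r1 r0 w ^+ m * Xr b a w).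
  by apply: eq_ex => w; rewrite (XrC r0 r1) (XrC a b).
have n01 := r01.
have v0 (a : 'I_nrep.+1) : ((a : nat) == 0%N) = (a == r0) by [].
have v1 (a : 'I_nrep.+1) : ((a : nat) == 1%N) = (a == r1).
  by rewrite -(inj_eq val_inj) /= inordK.
rewrite /shared !v0 !v1.
case: (eqVneq l r0) => [l0|l0].
  rewrite l0 (negbTE n01) in ll' *; rewrite [l' == r0]eq_sym (negbTE ll') /=.
  case: (eqVneq l' r1) => [->|l1].
    by apply: eq_ex => w; rewrite exprSr.
  by apply: ET_share; rewrite /= !inE !negb_or n01 ll' eq_sym l1.
case: (eqVneq l r1) => [l1|l1].
  rewrite l1 in ll' *; rewrite [l' == r1]eq_sym (negbTE ll') addn0.
  case: (eqVneq l' r0) => [->|l'0] /=.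
    by apply: eq_ex => w; rewrite exprSr (XrC r1 r0).
  rewrite -(@ET_share I m r1 r0 l'); last first.
    by rewrite /= !inE !negb_or eq_sym n01 ll' eq_sym l'0.
  by apply: eq_ex => w; rewrite (XrC r0 r1).
case: (eqVneq l' r0) => [l'0|l'0].
  rewrite l'0 (negbTE n01) /= -(@ET_share I m r0 r1 l); last first.
    by rewrite /= !inE !negb_or n01 eq_sym l0 eq_sym l1.
  by apply: eq_ex => w; rewrite (XrC l r0).
case: (eqVneq l' r1) => [l'1|l'1].
  rewrite l'1 /= -(@ET_share I m r1 r0 l); last first.
    by rewrite /= !inE !negb_or eq_sym n01 eq_sym l1 eq_sym l0.
  by apply: eq_ex => w; rewrite (XrC l r1) (XrC r0 r1).
apply: ET_disjoint.
by rewrite /= !inE !negb_or n01 ll' eq_sym l0 eq_sym l'0 eq_sym l1 eq_sym l'1.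
Qed.

(** [w], [v], [u] stand for the moments of pairs that share 0, 1 or 2 indices with the first two
    replicas. In the closed forms below, the factor 2 cancels the [1/2] of the mean value
    theorem. *)
Definition replica_sum (n a b : nat) (c0 c1 c2 w v u : R) : R :=
  \sum_(l < nrep.+1) \sum_(l' < nrep.+1) if (l' : nat) == l then 0 else
    kap n l * kap n.+1 l' * pick3 (shared a b l l') c0 c1 c2 *
      pick3 (shared 0 1 l l') w v u.

Lemma replica_sum2 c0 c1 c2 w v u : replica_sum 2 0 1 c0 c1 c2 w v u =
  2 * (c2 * u - 4 * c1 * v + 3 * c0 * w).
Proof.
by rewrite /replica_sum !big_ord_recl !big_ord0 /kap /=; ring.
Qed.

Lemma replica_sum3 c0 c1 c2 w v u : replica_sum 3 0 2 c0 c1 c2 w v u =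
  2 * (c1 * u + (c2 - 2 * c1 - 3 * c0) * v + (6 * c0 - 3 * c1) * w).
Proof.
by rewrite /replica_sum !big_ord_recl !big_ord0 /kap /=; ring.
Qed.

Lemma replica_sum4 c0 c1 c2 w v u : replica_sum 4 2 3 c0 c1 c2 w v u =
  2 * (c0 * u + (4 * c1 - 8 * c0) * v + (c2 - 8 * c1 + 10 * c0) * w).
Proof.
by rewrite /replica_sum !big_ord_recl !big_ord0 /kap /=; ring.
Qed.

End calculus.

(** * Solving the system for the moments *)

Section recursion.
Context {R : realType}.
Variables (p : nat) (beta h q : R).
Hypotheses (p2 : (2 <= p)%N) (q01 : 0 <= q <= 1).
Hypothesis m2 : tanh_moment p beta h q 2 = q.
Hypothesis contr : contraction_rate p beta < 1.
Notation instance := (instance p beta h q).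
Notation OD := (@OD R p beta h q).
Notation rateO := (@rateO R p beta h q).
Notation bb := (b0 p beta).
Notation r0 := (ord0 : 'I_nrep.+1).
Notation r1 := (inord 1 : 'I_nrep.+1).
Notation r2 := (inord 2 : 'I_nrep.+1).
Notation r3 := (inord 3 : 'I_nrep.+1).
Notation q4 := (qhat4 p beta h q).
Notation cov := (cov4 p beta h q).
Notation sl := (slope p q).

Definition cent_moment (m : nat) (I : instance) : R :=
  ET (fun w => Xr (I := I) r0 r1 w ^+ m).
Definition share_moment (m : nat) (I : instance) : R :=
  ET (fun w => Xr (I := I) r0 r1 w ^+ m * Xr r0 r2 w).
Definition disj_moment (m : nat) (I : instance) : R :=
  ET (fun w => Xr (I := I) r0 r1 w ^+ m * Xr r2 r3 w).

Lemma cov4E (a b l l' : 'I_nrep.+1) : l != l' ->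
  cov a b l l' = pick3 (shared a b l l') (q4 - q ^+ 2) (q - q ^+ 2) (1 - q ^+ 2).
Proof.
move=> ll'; rewrite /cov4 /shared /pick3.
by rewrite -!(inj_eq val_inj).
Qed.

Lemma overlap_equation (a b : 'I_nrep.+1) n m : (n.+2 < nrep)%N -> (2 <= n)%N ->
  (a < n)%N -> (b < n)%N -> a != b ->
  rateO m.+2 (fun I => ET (fun w => Xr (I := I) a b w * Xr r0 r1 w ^+ m) -
   (m%:R * (dl I ^+ 2 * (cov a b r0 r1 * cent_moment m.-1 I)) +
    2^-1 * bb * sl * replica_sum n a b (q4 - q ^+ 2) (q - q ^+ 2) (1 - q ^+ 2)
      (disj_moment m I) (share_moment m I) (cent_moment m.+1 I))).
Proof.
move=> nm n2 an bn ab; apply: eq_O (rate_overlap p2 q01 m2 contr m nm n2 an bn ab) => I.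
congr (_ - (_ + _)); rewrite /replica_sum mulr_sumr; apply: eq_bigr => l _.
rewrite mulr_sumr big_mkcond /=; apply: eq_bigr => l' _.
have -> : ((l' : nat) == l) = (l' == l) by [].
case: (eqVneq l' l) => [_|nl]; first by rewrite mulr0.
by rewrite cov4E 1?eq_sym// ET_kind 1?eq_sym// /= -/(disj_moment m I); ring.
Qed.

(** This is [beta^2 p(p-1)/2 q^(p-2)]; [den1] and [den2] are the denominators of [Asq] and of [Bsq]
    and [Csq]. *)
Definition coupling : R := bb * sl.
Definition kappa : R := 1 - 2 * q + q4.
Definition den1 : R := 1 - coupling * kappa.
Definition den2 : R := 1 - coupling * (1 - 4 * q + 3 * q4).
Definition amp_A : R := kappa / den1.
Definition amp_B : R := (q - q4) * (1 + coupling * amp_A) / den2.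
Definition amp_C : R := ((q4 - q ^+ 2) * (1 + coupling * amp_A) +
  coupling * (2 * (2 * q + q ^+ 2 - 3 * q4)) * amp_B) / den2.
(* Up to the square of [(p-1) q^(p-2)], the three terms are [A^2], [B^2], [C^2]. *)
Definition limit_var : R := amp_A + 2 * amp_B + amp_C.

(* In the coordinates [u - 2 v + w], [v - w], [w] the system is triangular. *)
Lemma solve_system (u v w G c0 c1 c2 e1 e2 e3 : R) : den1 != 0 -> den2 != 0 ->
  c0 = q4 - q ^+ 2 -> c1 = q - q ^+ 2 -> c2 = 1 - q ^+ 2 ->
  e1 = u - (c2 * G + coupling * (c2 * u - 4 * c1 * v + 3 * c0 * w)) ->
  e2 = v - (c1 * G + coupling * (c1 * u + (c2 - 2 * c1 - 3 * c0) * v +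
                           (6 * c0 - 3 * c1) * w)) ->
  e3 = w - (c0 * G + coupling * (c0 * u + (4 * c1 - 8 * c0) * v +
                           (c2 - 8 * c1 + 10 * c0) * w)) ->
  let y := 2 * (2 * q + q ^+ 2 - 3 * q4) in
  u - limit_var * G =
    (1 + 2 * (q - q4) * coupling / den2 +
      (c0 * coupling + coupling * y * (q - q4) * coupling / den2) / den2) / den1 *
       (e1 - 2 * e2 + e3) +
    (2 / den2 + coupling * y / den2 ^+ 2) * (e2 - e3) + den2^-1 * e3.
Proof.
move=> d1 d2 c0E c1E c2E e1E e2E e3E y.
(* In [e1 - 2 e2 + e3] the source [G] has coefficient [c2 - 2 c1 + c0 = kappa] up to sign, and the
   coupled terms recombine into [kappa (u - 2v + w)]. *)
have AE : u - 2 * v + w = amp_A * G + (e1 - 2 * e2 + e3) / den1.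
  apply: (mulIf d1); rewrite [RHS]mulrDl mulfVK// /amp_A [_ / _ * G]mulrAC mulfVK//.
  by rewrite e1E e2E e3E c0E c1E c2E /den1 /kappa; ring.
have BE : v - w = ((q - q4) * (G + coupling * (u - 2 * v + w)) + (e2 - e3)) / den2.
  apply: (mulIf d2); rewrite mulfVK//.
  by rewrite e2E e3E c0E c1E c2E /den2; ring.
have wE : w = (c0 * (G + coupling * (u - 2 * v + w)) + coupling * y * (v - w) + e3) / den2.
  apply: (mulIf d2); rewrite mulfVK//.
  by rewrite e3E c0E c1E c2E /den2 /y; ring.
have -> : u = (u - 2 * v + w) + 2 * (v - w) + w by ring.
rewrite {3}wE BE AE /limit_var /amp_C /amp_B -c0E -/y.
by field; rewrite d1 d2.
Qed.

Hypotheses (den1_neq0 : den1 != 0) (den2_neq0 : den2 != 0).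

(** The equations for the pairs (0,1), (0,2) and (2,3), with 2, 3 and 4 replicas, close on the same
    three moments. Their residuals [e1], [e2], [e3] are small, and the error in the conclusion is a
    fixed linear combination of them. *)
Lemma moment_recursion m : rateO m.+2 (fun I => cent_moment m.+1 I -
  limit_var * (m%:R * dl I ^+ 2 * cent_moment m.-1 I)).
Proof.
have s0 (k : nat) : (k <= nrep)%N -> val (inord k : 'I_nrep.+1) = k by move=> kn; rewrite /= inordK.
have ne (j k : nat) : (j <= nrep)%N -> (k <= nrep)%N -> j != k ->
    (inord j : 'I_nrep.+1) != inord k.
  by move=> jn kn; rewrite -(inj_eq val_inj) !s0.
have E1 := @overlap_equation r0 r1 2 m isT isT isT.
have E2 := @overlap_equation r0 r2 3 m isT isT isT.
have E3 := @overlap_equation r2 r3 4 m isT isT.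
rewrite !cov4E ?r01// in E1 E2 E3.
rewrite /shared ?s0// /= in E1 E2 E3.
have n02 : r0 != r2 by rewrite -inord0 ne.
have {}E1 := E1 isT isT.
have {}E2 := E2 isT n02.
have {}E3 := E3 isT isT (ne 2 3 isT isT isT).
pose e1 (I : instance) := cent_moment m.+1 I -
  ((1 - q ^+ 2) * (m%:R * dl I ^+ 2 * cent_moment m.-1 I) + coupling *
   ((1 - q ^+ 2) * cent_moment m.+1 I - 4 * (q - q ^+ 2) * share_moment m I +
    3 * (q4 - q ^+ 2) * disj_moment m I)).
pose e2 (I : instance) := share_moment m I -
  ((q - q ^+ 2) * (m%:R * dl I ^+ 2 * cent_moment m.-1 I) + coupling *
   ((q - q ^+ 2) * cent_moment m.+1 I +
    ((1 - q ^+ 2) - 2 * (q - q ^+ 2) - 3 * (q4 - q ^+ 2)) * share_moment m I +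
    (6 * (q4 - q ^+ 2) - 3 * (q - q ^+ 2)) * disj_moment m I)).
pose e3 (I : instance) := disj_moment m I -
  ((q4 - q ^+ 2) * (m%:R * dl I ^+ 2 * cent_moment m.-1 I) + coupling *
   ((q4 - q ^+ 2) * cent_moment m.+1 I +
    (4 * (q - q ^+ 2) - 8 * (q4 - q ^+ 2)) * share_moment m I +
    ((1 - q ^+ 2) - 8 * (q - q ^+ 2) + 10 * (q4 - q ^+ 2)) * disj_moment m I)).
have O1 : rateO m.+2 e1.
  apply: eq_O E1 => I; rewrite replica_sum2 /e1 /coupling.
  rewrite (_ : ET _ = cent_moment m.+1 I); first by field.
  by apply: eq_ex => w; rewrite exprS.
have O2 : rateO m.+2 e2.
  apply: eq_O E2 => I; rewrite replica_sum3 /e2 /coupling.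
  rewrite (_ : ET _ = share_moment m I); first by field.
  by apply: eq_ex => w; rewrite mulrC.
have O3 : rateO m.+2 e3.
  apply: eq_O E3 => I; rewrite replica_sum4 /e3 /coupling.
  rewrite (_ : ET _ = disj_moment m I); first by field.
  by apply: eq_ex => w; rewrite mulrC.
have Oc : rateO m.+2 (fun I => e1 I - 2 * e2 I + e3 I).
  by apply: O_D => //; apply: O_B => //; exact: O_Z.
have := O_D (O_D (O_Z _ Oc) (O_Z _ (O_B O2 O3))) (O_Z den2^-1 O3).
move=> H; apply: (eq_O _ (H _ _)) => I; apply/esym.
exact: (solve_system den1_neq0 den2_neq0 erefl erefl erefl erefl erefl erefl).
Qed.

End recursion.

(** * Moments of the standard Gaussian *)

Section gaussian_moments.
Context {R : realType}.
Notation N01 := (@normal_prob R 0 1).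

Lemma gauss_ERintegral (f : R -> R) : gauss_E f = \int[N01]_x f x.
Proof. by rewrite /gauss_E unlock. Qed.

Lemma gauss_E_cst (c : R) : gauss_E (fun=> c) = c.
Proof. by rewrite /gauss_E expectation_cst. Qed.

Lemma gauss_moment0 : gauss_moment R 0 = 1.
Proof. exact: gauss_E_cst. Qed.

Lemma norm_expr_le_expR (x : R) n : `|x ^+ n| <= n`!%:R * expR `|x|.
Proof.
case: n => [|n]; first by rewrite expr0 normr1 fact0 mul1r -expR0 ler_expR.
have := expR_ge1Dxn n (normr_ge0 x).
have f0 : 0 < n.+1`!%:R :> R by rewrite ltr0n fact_gt0.
rewrite normrX -ler_pdivrMl// [_^-1 * _]mulrC.
by apply: le_trans; rewrite lerDr.
Qed.

Lemma gauss_moment1 : gauss_moment R 1 = 0.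
Proof.
have [|||] := @gauss_ibp R (fun=> 1) (fun=> 0) 1.
- by move=> x; exact: cvg_cst.
- by move=> x; rewrite normr1 mul1r -expR0 ler_expR.
- by move=> x; rewrite normr0 mul1r expR_ge0.
rewrite /gauss_moment gauss_ERintegral.
under eq_Rintegral do rewrite mulr1.
move=> _ _ E; under eq_Rintegral do rewrite expr1.
by rewrite E -gauss_ERintegral gauss_E_cst.
Qed.

Lemma gauss_momentSS k : gauss_moment R k.+2 = k.+1%:R * gauss_moment R k.
Proof.
have [|||| _ i2 ibp] := @gauss_ibp R (fun x => x ^+ k.+1)
  (fun x => k.+1%:R * x ^+ k) k.+1`!%:R.
- move=> x; have D := @is_deriveX R R id k.+1 x 1 1 (is_derive_id _ _).
  have -> : (fun x : R => x ^+ k.+1) = id ^+ k.+1.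
    by rewrite exprfctE.
  by apply: is_derive_eq; rewrite /= scaler1.
- by move=> x; apply: cvgM; [exact: cvg_cst|exact: exprn_continuous].
- by move=> x; exact: norm_expr_le_expR.
- move=> x; rewrite normrM normr_nat factS natrM -mulrA ler_wpM2l//.
  exact: norm_expr_le_expR.
rewrite /gauss_moment !gauss_ERintegral.
under eq_Rintegral do rewrite exprS.
rewrite ibp RintegralZl//.
have := @integrableZl _ _ _ N01 _ measurableT k.+1%:R^-1 _ i2.
apply: eq_integrable => // x _ /=.
by rewrite -EFinM mulrA mulVf ?mul1r// pnatr_eq0.
Qed.
End gaussian_moments.

(** * Inequalities between the moments of [tanh] *)

Section tanh_moments.
Context {R : realType}.
Variables (p : nat) (beta h q : R).
Notation T := (tanh_moment p beta h q).
Notation N01 := (@normal_prob R 0 1).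

(** Nonnegative polynomials on [[-1, 1]] have nonnegative expectation at [tanh]. The three
    inequalities below use [(t^2 - q)^2], [t^2 (1 - t^2)] and [(1 - t^2)^2]. *)
Lemma tanh_moment_combination (c0 c1 c2 : R) :
  (forall t, `|t| <= 1 -> 0 <= c0 + c1 * t ^+ 2 + c2 * t ^+ 4) ->
  0 <= c0 + c1 * T 2 + c2 * T 4.
Proof.
move=> c_ge0; pose t y := tanh (local_field p beta h q y).
have it n : N01.-integrable [set: R] (EFin \o (fun y => t y ^+ n)).
  apply: (@bounded_integrable _ _ _ _ _ 1).
    by apply: measurable_funX; exact: measurable_tanh_field.
  by move=> y; rewrite normrX exprn_ile1// norm_tanh_le1.
have iZ c n : N01.-integrable [set: R] (EFin \o (fun y => c * t y ^+ n)).
  have -> : EFin \o (fun y => c * t y ^+ n) =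
    (fun y => c%:E * (EFin \o (fun y => (t y ^+ n)%R)) y)%E by [].
  by apply: integrableZl.
have -> : c0 + c1 * T 2 + c2 * T 4 =
    \int[N01]_y (c0 + c1 * t y ^+ 2 + c2 * t y ^+ 4).
  rewrite RintegralD//; last first.
    have := @integrableD _ _ _ N01 _ measurableT _ _ (iZ c0 0) (iZ c1 2).
    by apply: eq_integrable => // y _ /=; rewrite expr0 mulr1.
  rewrite RintegralD//; last first.
    by have := iZ c0 0; apply: eq_integrable => // y _ /=; rewrite expr0 mulr1.
  rewrite !RintegralZl// /tanh_moment !gauss_ERintegral.
  by rewrite -[X in X + _ * _ + _]gauss_E_cst gauss_ERintegral.
apply: fine_ge0; apply: integral_ge0 => y _; rewrite lee_fin.
exact/c_ge0/norm_tanh_le1.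
Qed.

Hypothesis m2 : T 2 = q.
Notation q4 := (qhat4 p beta h q).

Lemma qhat4_ge : q ^+ 2 <= q4.
Proof.
have := @tanh_moment_combination (q ^+ 2) (- (2 * q)) 1.
rewrite m2 -/q4 => H; rewrite -subr_ge0.
rewrite (_ : _ - _ = q ^+ 2 + - (2 * q) * q + 1 * q4); last by ring.
apply: H => t _.
by rewrite (_ : _ + _ = (t ^+ 2 - q) ^+ 2) ?sqr_ge0//; ring.
Qed.

Lemma qhat4_le : q4 <= q.
Proof.
have := @tanh_moment_combination 0 1 (-1).
rewrite m2 -/q4 => H; rewrite -subr_ge0.
rewrite (_ : _ - _ = 0 + 1 * q + -1 * q4); last by ring.
apply: H => t t1.
rewrite (_ : _ + _ = t ^+ 2 * (1 - `|t| ^+ 2)); last first.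
  by rewrite real_normK ?num_real//; ring.
by rewrite mulr_ge0 ?sqr_ge0// subr_ge0 exprn_ile1.
Qed.

Lemma qhat4_curvature : 0 <= 1 - 2 * q + q4.
Proof.
have := @tanh_moment_combination 1 (-2) 1.
rewrite m2 -/q4 => H.
rewrite (_ : _ + _ = 1 + -2 * q + 1 * q4); last by ring.
apply: H => t _.
by rewrite (_ : _ + _ = (1 - t ^+ 2) ^+ 2) ?sqr_ge0//; ring.
Qed.

End tanh_moments.

(** * Consequences of the high-temperature condition *)

Section high_temperature.
Context {R : realType}.
Variables (p : nat) (beta betap h q : R).
Hypotheses (p2 : (2 <= p)%N) (q01 : 0 <= q <= 1).
Hypothesis m2 : tanh_moment p beta h q 2 = q.
Hypothesis betap_eq :
  8 * p%:R ^+ 2 * betap ^+ 2 * expR (16 * betap ^+ 2 * p%:R) = 2^-1.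
Hypotheses (beta0 : 0 < beta) (beta_lt : beta < betap).
Notation q4 := (qhat4 p beta h q).
Notation lam := (coupling p beta q).
Notation D1 := (den1 p beta h q).
Notation D2 := (den2 p beta h q).

Let p_ge1 : 1 <= p%:R :> R. Proof. by rewrite ler1n ltnW. Qed.
Let pB : (p - 1)%:R = p%:R - 1 :> R. Proof. by rewrite natrB// ltnW. Qed.

Let beta_sq : beta ^+ 2 <= betap ^+ 2.
Proof. by rewrite ler_sqr ?nnegrE ?ltW// (lt_trans beta0). Qed.

(** As [24 bb = 12 beta^2 p], the rate is at most [10 p^2 betap^2 exp (16 betap^2 p)], which the
    equation for [betap] makes equal to [10/16]. *)
Lemma contraction_rate_lt1 : contraction_rate p beta < 1.
Proof.
have bge := ltW beta0; have b2 := sqr_ge0 beta; have P0 := ler0n R p.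
apply: (@le_lt_trans _ _ (10 * (p%:R ^+ 2 * betap ^+ 2 * expR (16 * betap ^+ 2 * p%:R)))).
  rewrite /contraction_rate /b0 pB.
  rewrite (_ : 20 * _ * _ * _ = 10 * (p%:R * (p%:R - 1) * beta ^+ 2 *
    expR (24 * (beta ^+ 2 * (p%:R / 2))))); last by field.
  rewrite ler_pM2l//; apply: ler_pM; rewrite ?expR_ge0//.
  - by rewrite !mulr_ge0 ?subr_ge0.
  - apply: ler_pM => //; first by rewrite mulr_ge0 ?subr_ge0.
    by rewrite expr2 ler_wpM2l// gerDl lerN10.
  - rewrite ler_expR (_ : 24 * _ = 12 * beta ^+ 2 * p%:R); last by field.
    rewrite ler_wpM2r//; apply: ler_pM => //; by rewrite ?ler_nat.
have E : p%:R ^+ 2 * betap ^+ 2 * expR (16 * betap ^+ 2 * p%:R) = 16^-1.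
  have := betap_eq; lra.
by rewrite E; lra.
Qed.

(** The exponential in the equation for [betap] is at least 1, so [p^2 betap^2 <= 1/16], and the
    coupling is at most half of that. *)
Let bs_bounds : 0 <= lam <= 32^-1.
Proof.
have /andP[q0 q1] := q01; have bge := ltW beta0; have b2 := sqr_ge0 beta; have P0 := ler0n R p.
have P1 : 0 <= p%:R - 1 :> R by rewrite subr_ge0.
rewrite /coupling /b0 /slope pB; apply/andP; split.
  by rewrite !mulr_ge0 ?divr_ge0 ?exprn_ge0.
have le1 : (p%:R - 1) * q ^+ (p - 2) <= p%:R.
  rewrite -[X in _ <= X]mulr1; apply: ler_pM; rewrite ?exprn_ge0//.
    by rewrite gerDl lerN10.
  by rewrite exprn_ile1.
have e1 : 1 <= expR (16 * betap ^+ 2 * p%:R).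
  rewrite -expR0 ler_expR; apply: mulr_ge0 => //; exact: mulr_ge0 (sqr_ge0 _).
have e2 : p%:R ^+ 2 * betap ^+ 2 <= 16^-1 :> R.
  have X0 : 0 <= p%:R ^+ 2 * betap ^+ 2 by rewrite mulr_ge0 ?sqr_ge0.
  have := betap_eq; have := ler_wpM2l X0 e1; lra.
have e3 : beta ^+ 2 * (p%:R * ((p%:R - 1) * q ^+ (p - 2))) <= betap ^+ 2 * (p%:R * p%:R).
  apply: ler_pM => //; first by rewrite !mulr_ge0 ?exprn_ge0.
  exact: ler_wpM2l.
lra.
Qed.

Lemma den1_gt0 : 0 < D1.
Proof.
have /andP[q0 q1] := q01; have /andP[b0 b1] := bs_bounds.
have q4q := qhat4_le m2; have k0 := qhat4_curvature m2.
rewrite /den1 /kappa subr_gt0.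
have : lam * (1 - 2 * q + q4) <= 32^-1 * 1 by apply: ler_pM => //; lra.
by move=> H; lra.
Qed.

Lemma den2_ge : 31 / 32 <= D2.
Proof.
have /andP[q0 q1] := q01; have /andP[b0 b1] := bs_bounds.
have q4q := qhat4_le m2.
rewrite /den2.
have : lam * (1 - 4 * q + 3 * q4) <= lam * 1 by apply: ler_wpM2l => //; lra.
by move=> H; lra.
Qed.

(** Only the numerator of [amp_C] has a term without evident sign. With [w = 1 + lam A] it regroups
    as [(q4 - q^2) (w - 2 lam B) + 4 (q - q4) lam B], and [lam B <= w/16]. *)
Lemma limit_var_ge0 : 0 <= limit_var p beta h q.
Proof.
have /andP[q0 q1] := q01; have /andP[b0 b1] := bs_bounds.
have q4q := qhat4_le m2; have k0 := qhat4_curvature m2.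
have c0 := qhat4_ge m2; have d1 := den1_gt0; have d2 := den2_ge.
have d2' : 0 < D2 by lra.
have A0 : 0 <= amp_A p beta h q by rewrite divr_ge0// ltW.
have w1 : 1 <= 1 + lam * amp_A p beta h q by rewrite lerDl mulr_ge0.
set w := 1 + lam * amp_A p beta h q in w1 *.
have B0 : 0 <= amp_B p beta h q.
  by rewrite divr_ge0 ?(ltW d2')// mulr_ge0 ?subr_ge0// -/w; lra.
have B1 : amp_B p beta h q <= 2 * w.
  rewrite ler_pdivrMr// -/w.
  have := ler_wpM2r (_ : 0 <= w) (_ : q - q4 <= 1) => /(_ ltac:(lra) ltac:(lra)).
  have := ler_wpM2l (_ : 0 <= w) d2 => /(_ ltac:(lra)).
  lra.
rewrite /limit_var; apply: addr_ge0; first exact: addr_ge0 A0 (mulr_ge0 _ B0).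
rewrite divr_ge0 ?(ltW d2')// -/w.
set B := amp_B _ _ _ _ in B0 B1 *.
have bB : lam * B <= 32^-1 * (2 * w) by apply: ler_pM.
have bB0 : 0 <= lam * B by rewrite mulr_ge0.
have f0 : 0 <= (q4 - q ^+ 2) * (w - 2 * (lam * B)) by rewrite mulr_ge0 ?subr_ge0//; lra.
have f1 : 0 <= (q - q4) * (lam * B) by rewrite mulr_ge0 ?subr_ge0.
by rewrite (_ : _ + _ = (q4 - q ^+ 2) * (w - 2 * (lam * B)) + 4 * ((q - q4) * (lam * B)));
  [lra|ring].
Qed.

Lemma limit_varE : slope p q ^+ 2 * limit_var p beta h q =
  Asq p beta h q + 2 * Bsq p beta h q + Csq p beta h q.
Proof.
have d1 := lt0r_neq0 den1_gt0; have d2 : D2 != 0.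
  by apply: lt0r_neq0; have := den2_ge; lra.
move: d1 d2.
rewrite /limit_var /Csq /Bsq /Asq /amp_C /amp_B /amp_A /den1 /den2.
rewrite /kappa /coupling /b0 /slope mulnC exprM pB.
set s := q ^+ (p - 2); set x := qhat4 _ _ _ _ => d1 d2.
field.
by apply/andP; split; [move: d2|move: d1]; apply: contraNneq => H; apply/eqP; lra.
Qed.

End high_temperature.

(** * Limits of the moments *)

Section asymptotic_moments.
Context {R : realType}.
Variables (p : nat) (beta h q : R).
Hypotheses (p2 : (2 <= p)%N) (q01 : 0 <= q <= 1).
Hypothesis m2 : tanh_moment p beta h q 2 = q.
Hypothesis contr : contraction_rate p beta < 1.
Hypotheses (den1_neq0 : den1 p beta h q != 0) (den2_neq0 : den2 p beta h q != 0).
Hypothesis var_ge0 : 0 <= limit_var p beta h q.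
Notation instance := (instance p beta h q).
Notation OD := (@OD R p beta h q).
Notation rateO := (@rateO R p beta h q).
Notation r0 := (ord0 : 'I_nrep.+1).
Notation r1 := (inord 1 : 'I_nrep.+1).
Notation sl := (slope p q).
Notation sd := (Num.sqrt (limit_var p beta h q)).

(** The moments obey, up to errors, the recursion [a(k+2) = (k+1) a(k)] of the Gaussian ones; it
    advances by two, hence the strong induction from orders 0 and 1. *)
Lemma cent_moment_limit k : rateO k.+1 (fun I : instance =>
  cent_moment k I - gauss_moment R k * sd ^+ k * dl I ^+ k).
Proof.
have [n] := ubnP k; elim: n k => // n IH [_|[_|k]].
- apply: O_cst0 => I; rewrite gauss_moment0 !expr0 !mulr1 /cent_moment.
  by rewrite -Et_pihalf Et_cst subrr.
- apply: eq_O (moment_recursion p2 q01 m2 contr den1_neq0 den2_neq0 0) => I.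
  by rewrite gauss_moment1 !mul0r mulr0.
rewrite !ltnS => /ltnW kn.
have rec := moment_recursion p2 q01 m2 contr den1_neq0 den2_neq0 k.+1.
have := O_D rec (O_dl p2 2 (O_Z (limit_var p beta h q * k.+1%:R) (IH k kn))).
apply: eq_O => I; rewrite gauss_momentSS /=.
have := esym (sqr_sqrtr var_ge0); generalize sd => s ->.
by rewrite !exprS; ring.
Qed.

Lemma OD_power_overlap : OD 2 (fun I w =>
  (overlap (w r0) (w r1) ^+ (p - 1) - q ^+ (p - 1)) - sl * Xr (I := I) r0 r1 w).
Proof.
apply: (@OD_dominated _ _ _ _ _ _ _ (fun I w => ((p - 1) ^ 2)%:R * Xr (I := I) r0 r1 w ^+ 2)).
  move=> I w; have [q0 q1] := andP q01.
  rewrite /slope (_ : (p - 2)%N = (p - 1).-1); last by rewrite subn2 subn1.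
  apply: norm_expr_taylor; last by rewrite ger0_norm.
  exact: norm_overlap (iN_gt0 p2 I) _ _.
exact: (OD_Z p2 _ (OD_X1 2 (OD_Xr beta h q p2 r01))).
Qed.

(** Two observables of order 1 that differ at order 2 have [k]-th powers that differ at order
    [k+1]. *)
Lemma power_overlap_limit k : rateO k.+1 (fun I : instance =>
  ET (I := I) (fun w => (overlap (w r0) (w r1) ^+ (p - 1) - q ^+ (p - 1)) ^+ k) -
  dl I ^+ k * gauss_moment R k * (sl * sd) ^+ k).
Proof.
have X1 := OD_Z p2 sl (OD_Xr beta h q p2 r01).
have F2 := OD_power_overlap.
have F1 : OD 1 (fun I w => overlap (w r0) (w r1) ^+ (p - 1) - q ^+ (p - 1)).
  have := OD_D (OD_mono p2 q01 (isT : 1 <= 2)%N F2) X1.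
  by apply: eq_OD => I w; rewrite subrK.
have := O_D (O_ET p2 q01 m2 contr (OD_exp_sub p2 k F1 X1 F2))
  (O_Z (sl ^+ k) (cent_moment_limit k)).
apply: eq_O => I; rewrite /ET exB.
under [X in _ - X + _]eq_ex do rewrite exprMn.
by rewrite exZ /cent_moment /ET !exprMn; ring.
Qed.

End asymptotic_moments.

(** * The limit of the moments for the model *)

Lemma powR_half {R : realType} (x : R) k : 0 <= x -> x `^ (k%:R / 2) = Num.sqrt x ^+ k.
Proof. by move=> x0; rewrite mulrC powRrM powR12_sqrt// powR_mulrn// sqrtr_ge0. Qed.

Theorem theorem7p5 (R : realType) (p : nat) (beta betap h q : R)
    (hp : (2 <= p)%N) (hh : 0 < h)
    (hbetap0 : 0 < betap)
    (hbetap : 8 * p%:R ^+ 2 * betap ^+ 2 * expR (16 * betap ^+ 2 * p%:R) = 2^-1)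
    (hbeta0 : 0 < beta) (hbeta : beta < betap)
    (hq : is_overlap_limit p beta h q) :
  forall k : nat, exists L : R,
  forall (N : nat) (hN : (p <= N)%N)
    (d : measure_display) (T : measurableType d) (P : probability T R)
    (g : incr_index N p -> {RV P >-> R})
    (hgauss : forall a, is_std_gaussian (g a))
    (hindep : mutually_independent g),
  (`| nu beta h g (fun s : {ffun 'I_2 -> config N} =>
          ((R12 s : R) ^+ (p - 1) - q ^+ (p - 1)) ^+ k)%R
      - ((N%:R `^ (k%:R / 2))^-1 * gauss_moment R k *
         (Asq p beta h q + 2 * Bsq p beta h q + Csq p beta h q)
            `^ (k%:R / 2))%R%:E |
    <= (L / N%:R `^ ((k%:R + 1) / 2))%R%:E)%E.
Proof.
move=> k; have [q01 /esym m2] := hq.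
have contr := contraction_rate_lt1 hp hbetap hbeta0 hbeta.
have d1 := den1_gt0 hp q01 m2 hbetap hbeta0 hbeta.
have d2 := den2_ge hp q01 m2 hbetap hbeta0 hbeta.
have V0 := limit_var_ge0 hp q01 m2 hbetap hbeta0 hbeta.
have d2n : den2 p beta h q != 0 by apply: lt0r_neq0; lra.
have [L HL] := power_overlap_limit hp q01 m2 contr (lt0r_neq0 d1) d2n V0 k.
exists L => N hN d T P g hgauss hindep.
have N0 : (0 < N)%N := leq_trans (ltnW hp) hN.
have cav := model_cavity beta h hp q01 hN hgauss hindep.
(* Any site will do: all interpolations end at the same model law. *)
have {HL} := HL (Instance hN cav (Ordinal N0)).
rewrite (nu_gibbs_prob beta h q hp hN hgauss hindep
  (fun s t => (overlap s t ^+ (p - 1) - q ^+ (p - 1)) ^+ k)).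
(* The sign lets the square root of [slope^2 * limit_var] be [slope] times that of [limit_var]. *)
have s0 : 0 <= slope p q by have /andP[q0 _] := q01; rewrite mulr_ge0// exprn_ge0.
rewrite -(limit_varE hp q01 m2 hbetap hbeta0 hbeta) natr1 !powR_half//;
  last by rewrite mulr_ge0 ?sqr_ge0.
rewrite sqrtrM ?sqr_ge0// sqrtr_sqr (ger0_norm s0).
by rewrite -EFinB abse_EFin lee_fin /dl -!exprVn.
Qed.
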